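(* Let $\mathcal{C}$, $G$, $H$, $\alpha$, $H_1$ be as described in the context, let $\operatorname{char}(k)=p\neq 2,3$, and assume that $H$ acts transitively on $\mathcal{C}(x,y)$. Let $s=|O^{p'}G|$, $t=|O^{p'}H|$, and $n=|H:H_1|$. If both $G$ and $H$ are abelian, then $k\mathcal{C}$ is of finite representation type if and only if both $O^{p'}G$ and $O^{p'}H$ act trivially on $\mathcal{C}(x,y)$, and one of the following conditions holds: (1) $s,t\geqslant p$ and $n=1$ (i.e., $H=H_1$); (2) ($s=1$ and $t\geqslant p$) or ($t=1$ and $s\geqslant p$), and $n\leqslant 2$; (3) $s=t=1$ and $n\leqslant 3$.
   Context: $k$ is an algebraically closed field of characteristic $p\geqslant 0$. A finite EI category is a small category with finitely many morphisms in which every endomorphism is an isomorphism. Its category algebra $k\mathcal{C}$ is the $k$-algebra with basis the set of all morphisms, the product of two morphisms being their composite (composed from right to left) if it exists and $0$ otherwise. $k\mathcal{C}$ is of finite representation type if it has only finitely many isomorphism classes of finitely generated indecomposable left modules. $\mathcal{C}$ is a connected skeletal finite EI category with exactly two objects $x,y$, with $\mathcal{C}(x,y)\neq\emptyset$ and $\mathcal{C}(y,x)=\emptyset$; here $\mathcal{C}(x,y)$ is the set of morphisms from $x$ to $y$. Put $G=\mathcal{C}(x,x)$ and $H=\mathcal{C}(y,y)$; $G$ acts on $\mathcal{C}(x,y)$ on the right and $H$ on the left by composition. $\mathcal{C}(x,y)$ is a single orbit as an $(H,G)$-biset, and $\alpha\in\mathcal{C}(x,y)$ is a fixed morphism. Define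 $H_1=\operatorname{Stab}_H(\alpha G)=\{h\in H:h\alpha G=\alpha G\}$. Standing assumption: both $G$ and $H$ have cyclic Sylow $p$-subgroups. For a finite group $X$, $O^{p'}X$ is the subgroup generated by all Sylow $p$-subgroups of $X$; when $p=0$, the trivial group is regarded as the Sylow $0$-subgroup. A subgroup acts trivially on $\mathcal{C}(x,y)$ if it fixes every element. *)

(* Defs.v *)
From HB Require Import structures.
From mathcomp Require Import all_boot all_order all_algebra all_fingroup all_solvable.

Set Implicit Arguments.
Unset Strict Implicit.
Unset Printing Implicit Defensive.

Import GRing.Theory.

(* [ccomp g f] is "g after f". Finitely many morphisms force finitely many
   objects, because of the identities; hence [ob] is a finType. *)
Record finCat := FinCat {
  ob : finType;
  mor : ob -> ob -> finType;
  idmor : forall x, mor x x;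
  ccomp : forall x y z, mor y z -> mor x y -> mor x z;
  ccomp_idl : forall x y (f : mor x y), ccomp (idmor y) f = f;
  ccomp_idr : forall x y (f : mor x y), ccomp f (idmor x) = f;
  ccompA : forall x y z w (h : mor z w) (g : mor y z) (f : mor x y),
    ccomp h (ccomp g f) = ccomp (ccomp h g) f
}.

Arguments idmor {C} x : rename.
Arguments ccomp {C x y z} g f : rename.

Definition is_isom (C : finCat) (x y : ob C) (f : mor x y) : bool :=
  [exists g : mor y x, (ccomp g f == idmor x) && (ccomp f g == idmor y)].

Record finEICat := FinEICat {
  EI_cat :> finCat;
  EI_axiom : forall (x : ob EI_cat) (f : mor x x), is_isom f
}.

Definition skeletal (C : finCat) : Prop :=
  forall (x y : ob C) (f : mor x y), is_isom f -> x = y.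

Definition connected_cat (C : finCat) : Prop :=
  forall x y : ob C,
    connect [rel a b : ob C | (0 < #|mor a b|) || (0 < #|mor b a|)] x y.

(* The endomorphisms of x as a group, with g * h := ccomp g h. *)

Definition endo (C : finEICat) (x : ob C) : Type := mor x x.

HB.instance Definition _ (C : finEICat) (x : ob C) :=
  Finite.copy (endo x) (mor x x).

Definition endo_mul (C : finEICat) (x : ob C) (g h : endo x) : endo x :=
  ccomp g h.

Definition endo_inv (C : finEICat) (x : ob C) (f : endo x) : endo x :=
  xchoose (existsP (EI_axiom f)).

Lemma endo_mulA (C : finEICat) (x : ob C) : associative (@endo_mul C x).
Proof. by move=> h g f; exact: ccompA. Qed.

Lemma endo_mul1 (C : finEICat) (x : ob C) :
  left_id (idmor x : endo x) (@endo_mul C x).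
Proof. by move=> f; exact: ccomp_idl. Qed.

Lemma endo_mulV (C : finEICat) (x : ob C) :
  left_inverse (idmor x : endo x) (@endo_inv C x) (@endo_mul C x).
Proof. by move=> f; have /andP[/eqP] := xchooseP (existsP (EI_axiom f)). Qed.

HB.instance Definition _ (C : finEICat) (x : ob C) :=
  Finite_isGroup.Build (endo x)
    (@endo_mulA C x) (@endo_mul1 C x) (@endo_mulV C x).

(* The orbit alpha G and the stabiliser {h | h alpha G = alpha G}. *)

Definition right_orbit (C : finEICat) (x y : ob C) (alpha : mor x y) :
  {set mor x y} := [set ccomp alpha g | g : endo x].

Definition stab_right_orbit (C : finEICat) (x y : ob C) (alpha : mor x y) :
  {set endo y} :=
  [set h : endo y |
    [set ccomp h b | b in right_orbit alpha] == right_orbit alpha].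

Lemma stab_right_orbit_group_set (C : finEICat) (x y : ob C)
  (alpha : mor x y) : group_set (stab_right_orbit alpha).
Proof.
apply/group_setP; split=> [|h h'].
  rewrite inE; apply/eqP; rewrite -[RHS]imset_id.
  by apply: eq_imset => b; exact: ccomp_idl.
rewrite !inE => /eqP hS /eqP h'S; apply/eqP.
rewrite -[RHS]hS -[in RHS]h'S -imset_comp.
by apply: eq_imset => b /=; rewrite ccompA.
Qed.

Canonical stab_right_orbit_group (C : finEICat) (x y : ob C)
  (alpha : mor x y) := Group (stab_right_orbit_group_set alpha).

Definition acts_trivially_left (C : finEICat) (x y : ob C)
  (K : {set endo y}) : Prop :=
  forall h, h \in K -> forall f : mor x y, ccomp h f = f.

Definition acts_trivially_right (C : finEICat) (x y : ob C)
  (K : {set endo x}) : Prop :=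
  forall g, g \in K -> forall f : mor x y, ccomp f g = f.

Arguments acts_trivially_left {C} x {y} K.
Arguments acts_trivially_right {C x} y K.

Local Open Scope group_scope.

(* For p = 0 the only subgroup P with 0.-Sylow(G) P is the trivial one. *)

Definition cyclic_Sylows (p : nat) (gT : finGroupType) (G : {set gT}) : Prop :=
  forall P : {group gT}, p.-Sylow(G) P -> cyclic P.

Definition Op' (p : nat) (gT : finGroupType) (G : {set gT}) : {set gT} :=
  <<\bigcup_(P : {group gT} | p.-Sylow(G) P) P>>.

Lemma Sylow0E (gT : finGroupType) (G P : {group gT}) :
  0.-Sylow(G) P = (P :==: 1).
Proof.
apply/idP/eqP => [/and3P[_ P0 _]|->].
  apply: card1_trivg; apply/eqP; rewrite eqn_leq cardG_gt0 andbT leqNgt.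
  apply/negP => /pdivP[q q_pr q_dv].
  have := pgroupP P0 q q_pr q_dv; rewrite !inE => /eqP q0.
  by rewrite q0 in q_pr.
rewrite /pHall sub1G pgroup1 indexg1 /=.
apply/pnatP => // q q_pr _; rewrite !inE; apply/negP => /eqP q0.
by rewrite q0 in q_pr.
Qed.

Local Open Scope ring_scope.

Definition has_char (p : nat) (R : nzRingType) : Prop :=
  (p = 0%N /\ [pchar R] =i pred0) \/ p \in [pchar R].

(* The category algebra: functions on the set of all morphisms, with the
   convolution product extending composition; cf. kmor_mul, kmor_mul0. *)

Definition allmor (C : finCat) := {p : ob C * ob C & mor p.1 p.2}.

Definition Mor (C : finCat) (x y : ob C) (f : mor x y) : allmor C :=
  existT (fun p : ob C * ob C => mor p.1 p.2 : Type) (x, y) f.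

Definition catalg (k : pzRingType) (C : finCat) : Type := {ffun allmor C -> k}.

HB.instance Definition _ (k : pzRingType) (C : finCat) :=
  GRing.Lmodule.copy (catalg k C) {ffun allmor C -> k^o}.

Definition kmor (k : pzRingType) (C : finCat) (x y : ob C) (f : mor x y) :
  catalg k C := [ffun m => (m == Mor f)%:R].

Definition catalg_one (k : pzRingType) (C : finCat) : catalg k C :=
  \sum_(x : ob C) kmor k (idmor x).

Definition catalg_mul (k : pzRingType) (C : finCat) (a b : catalg k C) :
  catalg k C :=
  [ffun m : allmor C => \sum_(y : ob C) \sum_(g : mor y (tag m).2)
     \sum_(f : mor (tag m).1 y | ccomp g f == tagged m) a (Mor g) * b (Mor f)].

Lemma Mor_inj (C : finCat) (x y : ob C) : injective (@Mor C x y).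
Proof. by move=> f g /eqP; rewrite eq_Tagged => /eqP. Qed.

Lemma MorE (C : finCat) (m : allmor C) : m = Mor (tagged m).
Proof. by case: m => -[]. Qed.

Lemma catalg_mulE (k : pzRingType) (C : finCat) (a b : catalg k C)
  (x z : ob C) (m : mor x z) :
  catalg_mul a b (Mor m) = \sum_(y : ob C) \sum_(g : mor y z)
     \sum_(f : mor x y | ccomp g f == m) a (Mor g) * b (Mor f).
Proof. by rewrite ffunE. Qed.

Lemma catalgP (k : pzRingType) (C : finCat) (a b : catalg k C) :
  (forall x y (f : mor x y), a (Mor f) = b (Mor f)) -> a = b.
Proof. by move=> ab; apply/ffunP => m; rewrite (MorE m). Qed.

Lemma catalg_oneE (k : pzRingType) (C : finCat) (x y : ob C) (f : mor x y) :
  catalg_one k C (Mor f) = (Mor f == Mor (idmor x))%:R.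
Proof.
rewrite sum_ffunE (bigD1 x) //= big1 ?addr0 ?ffunE // => z zx.
rewrite ffunE; case: eqP => // /(congr1 (fun m => (tag m).1)) /= xz.
by rewrite xz eqxx in zx.
Qed.

Lemma catalg_mulA (k : pzRingType) (C : finCat) : associative (@catalg_mul k C).
Proof.
move=> a b c; apply: catalgP => x z m.
transitivity (\sum_(w : ob C) \sum_(y : ob C) \sum_(u : mor w z)
   \sum_(v : mor y w) \sum_(f : mor x y)
     if ccomp u (ccomp v f) == m then a (Mor u) * b (Mor v) * c (Mor f) else 0).
  rewrite catalg_mulE; apply: eq_bigr => w _.
  rewrite exchange_big /=; apply: eq_bigr => u _.
  transitivity (\sum_(h : mor x w) \sum_(y : ob C) \sum_(v : mor y w)
     \sum_(f : mor x y) if (ccomp v f == h) && (ccomp u h == m)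
        then a (Mor u) * b (Mor v) * c (Mor f) else 0).
    rewrite big_mkcond; apply: eq_bigr => h _; case: ifP => [_|hm].
      rewrite catalg_mulE mulr_sumr; apply: eq_bigr => y _.
      rewrite mulr_sumr; apply: eq_bigr => v _.
      rewrite mulr_sumr big_mkcond; apply: eq_bigr => f _.
      by rewrite andbT mulrA.
    by rewrite big1 // => y _; rewrite big1 // => v _; rewrite big1 // => f _;
       rewrite andbF.
  rewrite exchange_big; apply: eq_bigr => y _.
  rewrite exchange_big; apply: eq_bigr => v _.
  rewrite exchange_big; apply: eq_bigr => f _.
  rewrite (bigD1 (ccomp v f)) //= eqxx big1 ?addr0 // => h hvf.
  by rewrite eq_sym (negPf hvf).
rewrite catalg_mulE exchange_big; apply: eq_bigr => y _ /=.
transitivity (\sum_(g : mor y z) \sum_(w : ob C) \sum_(u : mor w z)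
   \sum_(v : mor y w) \sum_(f : mor x y) if (ccomp u v == g) && (ccomp g f == m)
      then a (Mor u) * b (Mor v) * c (Mor f) else 0).
  rewrite [RHS]exchange_big; apply: eq_bigr => w _ /=.
  rewrite [RHS]exchange_big; apply: eq_bigr => u _ /=.
  rewrite [RHS]exchange_big; apply: eq_bigr => v _ /=.
  rewrite [RHS]exchange_big; apply: eq_bigr => f _ /=.
  rewrite [RHS](bigD1 (ccomp u v)) //= eqxx ccompA big1 ?addr0 // => g guv.
  by rewrite eq_sym (negPf guv).
apply: eq_bigr => g _.
transitivity (\sum_(f : mor x y | ccomp g f == m) \sum_(w : ob C)
   \sum_(u : mor w z) \sum_(v : mor y w | ccomp u v == g)
      a (Mor u) * b (Mor v) * c (Mor f)); last first.
  apply: eq_bigr => f _; rewrite catalg_mulE mulr_suml; apply: eq_bigr => w _.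
  by rewrite mulr_suml; apply: eq_bigr => u _; rewrite mulr_suml.
rewrite [RHS]exchange_big; apply: eq_bigr => w _ /=.
rewrite [RHS]exchange_big; apply: eq_bigr => u _ /=.
rewrite exchange_big [RHS]big_mkcond; apply: eq_bigr => f _ /=.
case: ifP => fm.
  by rewrite [RHS]big_mkcond; apply: eq_bigr => v _; rewrite andbT.
by rewrite big1 // => v _; rewrite andbF.
Qed.

Lemma catalg_mul1 (k : pzRingType) (C : finCat) :
  left_id (catalg_one k C) (@catalg_mul k C).
Proof.
move=> a; apply: catalgP => x z m; rewrite catalg_mulE.
rewrite (bigD1 z) //= [X in _ + X]big1 ?addr0 => [|y yz]; last first.
  rewrite big1 // => g _; rewrite big1 // => f _.
  rewrite catalg_oneE; case: eqP => [|_]; last by rewrite mul0r.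
  move/(congr1 (fun m => (tag m).2)) => /= zy.
  by rewrite zy eqxx in yz.
rewrite (bigD1 (idmor z)) //= [X in _ + X]big1 ?addr0 => [|g gz]; last first.
  rewrite big1 // => f _; rewrite catalg_oneE (inj_eq (@Mor_inj _ _ _)).
  by rewrite (negPf gz) mul0r.
rewrite (big_pred1 m) => [|f]; last by rewrite ccomp_idl.
by rewrite catalg_oneE eqxx mul1r.
Qed.

Lemma catalg_mulr1 (k : pzRingType) (C : finCat) :
  right_id (catalg_one k C) (@catalg_mul k C).
Proof.
move=> a; apply: catalgP => x z m; rewrite catalg_mulE.
rewrite (bigD1 x) //= [X in _ + X]big1 ?addr0 => [|y yx]; last first.
  rewrite big1 // => g _; rewrite big1 // => f _.
  rewrite catalg_oneE; case: eqP => [|_]; last by rewrite mulr0.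
  move/(congr1 (fun m => (tag m).2)) => /= yx'.
  by rewrite yx' eqxx in yx.
under eq_bigr => g _ do rewrite big_mkcond.
rewrite exchange_big (bigD1 (idmor x)) //= [X in _ + X]big1 ?addr0 => [|f fx].
  rewrite -big_mkcond (big_pred1 m) => [|g]; last by rewrite ccomp_idr.
  by rewrite catalg_oneE eqxx mulr1.
rewrite big1 // => g _; rewrite catalg_oneE (inj_eq (@Mor_inj _ _ _)).
by rewrite (negPf fx) mulr0 if_same.
Qed.

Lemma catalg_mulDl (k : pzRingType) (C : finCat) :
  left_distributive (@catalg_mul k C) +%R.
Proof.
move=> a b c; apply/ffunP => m; rewrite !ffunE -big_split; apply: eq_bigr => y _.
rewrite -big_split; apply: eq_bigr => g _; rewrite -big_split.
by apply: eq_bigr => f _; rewrite ffunE mulrDl.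
Qed.

Lemma catalg_mulDr (k : pzRingType) (C : finCat) :
  right_distributive (@catalg_mul k C) +%R.
Proof.
move=> a b c; apply/ffunP => m; rewrite !ffunE -big_split; apply: eq_bigr => y _.
rewrite -big_split; apply: eq_bigr => g _; rewrite -big_split.
by apply: eq_bigr => f _; rewrite ffunE mulrDr.
Qed.

HB.instance Definition _ (k : pzRingType) (C : finCat) :=
  GRing.Zmodule_isPzRing.Build (catalg k C) (@catalg_mulA k C)
    (@catalg_mul1 k C) (@catalg_mulr1 k C) (@catalg_mulDl k C)
    (@catalg_mulDr k C).

Lemma catalg_scaleE (k : pzRingType) (C : finCat) (c : k) (a : catalg k C)
  (m : allmor C) : (c *: a) m = c * a m.
Proof. by rewrite ffunE. Qed.

Lemma catalg_scaleAl (k : pzRingType) (C : finCat) (c : k)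
  (a b : catalg k C) : c *: (a * b) = (c *: a) * b.
Proof.
apply/ffunP => m; rewrite catalg_scaleE !ffunE mulr_sumr; apply: eq_bigr => y _.
rewrite mulr_sumr; apply: eq_bigr => g _; rewrite mulr_sumr.
by apply: eq_bigr => f _; rewrite catalg_scaleE mulrA.
Qed.

Lemma catalg_scaleAr (k : comPzRingType) (C : finCat) (c : k)
  (a b : catalg k C) : c *: (a * b) = a * (c *: b).
Proof.
apply/ffunP => m; rewrite catalg_scaleE !ffunE mulr_sumr; apply: eq_bigr => y _.
rewrite mulr_sumr; apply: eq_bigr => g _; rewrite mulr_sumr.
by apply: eq_bigr => f _; rewrite catalg_scaleE mulrCA.
Qed.

Lemma catalg_sum_kmor (k : pzRingType) (C : finCat) (a : catalg k C) :
  a = \sum_(m : allmor C) a m *: kmor k (tagged m).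
Proof.
apply/ffunP => m; rewrite sum_ffunE (bigD1 m) //= big1 ?addr0 => [|m' m'm].
  by rewrite catalg_scaleE ffunE -MorE eqxx mulr1.
by rewrite catalg_scaleE ffunE -MorE eq_sym (negPf m'm) mulr0.
Qed.

Lemma kmor_mul (k : pzRingType) (C : finCat) (x y z : ob C) (g : mor y z)
  (f : mor x y) : kmor k g * kmor k f = kmor k (ccomp g f).
Proof.
apply: catalgP => x' z' m; rewrite catalg_mulE [RHS]ffunE.
case: (eqVneq x' x) => [ex|nx]; last first.
  have -> : Mor m == Mor (ccomp g f) = false.
    by apply/eqP => /(congr1 (fun m => (tag m).1)) /= /eqP; rewrite (negPf nx).
  rewrite big1 // => w _; rewrite big1 // => u _; rewrite big1 // => v _.
  rewrite [X in _ * X]ffunE; case: eqP; last by rewrite mulr0.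
  by move/(congr1 (fun m => (tag m).1)) => /= /eqP; rewrite (negPf nx).
case: (eqVneq z' z) => [ez|nz]; last first.
  have -> : Mor m == Mor (ccomp g f) = false.
    by apply/eqP => /(congr1 (fun m => (tag m).2)) /= /eqP; rewrite (negPf nz).
  rewrite big1 // => w _; rewrite big1 // => u _; rewrite big1 // => v _.
  rewrite [X in X * _]ffunE; case: eqP; last by rewrite mul0r.
  by move/(congr1 (fun m => (tag m).2)) => /= /eqP; rewrite (negPf nz).
subst x' z'; rewrite (bigD1 y) //= [X in _ + X]big1 ?addr0 => [|w wy].
  rewrite (bigD1 g) //= [X in _ + X]big1 ?addr0 => [|u ug].
    rewrite big_mkcond (bigD1 f) //= big1 ?addr0 => [|v vf].
      rewrite !ffunE !eqxx mulr1 (inj_eq (@Mor_inj _ _ _)) eq_sym.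
      by case: eqP.
    rewrite [X in _ * X]ffunE (inj_eq (@Mor_inj _ _ _)) (negPf vf) mulr0.
    by rewrite if_same.
  rewrite big1 // => v _.
  by rewrite [X in X * _]ffunE (inj_eq (@Mor_inj _ _ _)) (negPf ug) mul0r.
rewrite big1 // => u _; rewrite big1 // => v _.
rewrite [X in X * _]ffunE; case: eqP; last by rewrite mul0r.
by move/(congr1 (fun m => (tag m).1)) => /= /eqP; rewrite (negPf wy).
Qed.

Lemma kmor_mul0 (k : pzRingType) (C : finCat) (x y y' z : ob C)
  (g : mor y' z) (f : mor x y) : y != y' -> kmor k g * kmor k f = 0.
Proof.
move=> nyy; apply: catalgP => x' z' m; rewrite catalg_mulE [RHS]ffunE.
rewrite big1 // => w _; rewrite big1 // => u _; rewrite big1 // => v _.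
rewrite !ffunE; case: eqP => [|_]; last by rewrite mul0r.
move/(congr1 (fun m => (tag m).1)) => /= wy'.
case: eqP => [|_]; last by rewrite mulr0.
move/(congr1 (fun m => (tag m).2)) => /= wy.
by rewrite -wy -wy' eqxx in nyy.
Qed.

(* Modules over a ring A : pzRingType; [lmodType A] is the type of unital left
   A-modules (A need not be commutative). *)

Definition fin_generated (A : pzRingType) (M : lmodType A) : Prop :=
  exists (n : nat) (e : 'I_n -> M),
    forall v : M, exists c : 'I_n -> A, v = \sum_(i < n) c i *: e i.

Definition lmod_iso (A : pzRingType) (M N : lmodType A) : Prop :=
  exists f : {linear M -> N}, bijective f.

(* Boolean predicates suffice for U and V: in a direct sum, membership in U is
   the vanishing of the V-component, and equality on M is decidable. *)
Definition indecomposable (A : pzRingType) (M : lmodType A) : Prop :=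
  (exists v : M, v != 0) /\
  forall U V : {pred M},
    submod_closed U -> submod_closed V ->
    (forall m : M, exists u v : M, [/\ u \in U, v \in V & m = u + v]) ->
    (forall m : M, m \in U -> m \in V -> m = 0) ->
    (forall u : M, u \in U -> u = 0) \/ (forall v : M, v \in V -> v = 0).

Definition finite_rep_type (A : pzRingType) : Prop :=
  exists (n : nat) (M : 'I_n -> lmodType A),
    forall N : lmodType A, fin_generated N -> indecomposable N ->
      exists i : 'I_n, lmod_iso N (M i).

(* Main.v *)
Require Import Defs.
From HB Require Import structures.
From mathcomp Require Import all_boot all_order all_algebra all_fingroup all_solvable.
From mathcomp Require Import separable.
From Stdlib Require Import Classical ClassicalEpsilon.

Set Implicit Arguments.
Unset Strict Implicit.
Unset Printing Implicit Defensive.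
Import GRing.Theory.
Local Open Scope ring_scope.

(** Let [G] and [H] be the automorphism groups of [x] and [y], and [H1] the
    stabilizer of the orbit [alpha G]. Since [H] permutes the morphisms from [x]
    to [y] transitively, a module is a representation [V] of [G], a
    representation [W] of [H] and one linear map [e : V -> W], the action of
    [alpha], which is compatible with every pair [(h, g)] such that
    [h alpha = alpha g]. Vectors are rows, so that composites act in the order in
    which they are read.

    Suppose that the [p]-elements of both groups act trivially on the morphisms.
    The elements of order prime to [p] are diagonalizable, and [V] and [W] split
    into joint eigenspaces. The map [e] links a character [chi] of [G] only to
    characters of [H] prescribed by [chi] on [H1]; there are at most
    [n = |H : H1|] of them, and each is linked to one [chi] only. A generator [u]
    or [w] of a Sylow [p]-subgroup contributes on each eigenspace one nilpotent
    operator, [u - 1] or [w - 1], whose composite with [e] vanishes. An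
    indecomposable module is thus a representation of a star: a center, at most
    [n] legs, a nilpotent loop at the center if [s > 1] and at the end of every leg
    if [t > 1], and all composites of arrows with loops equal to zero. Filtering
    the center by the kernels of the powers of its loop, and by the preimages
    under each leg of the images of the powers of the loop at its end, turns this
    into the problem of classifying subspace configurations: one chain of
    subspaces for the center if [s > 1], and for every leg one chain if [t > 1] or
    one subspace if [t = 1]. The three conditions of the theorem say that these
    are at most two chains, or one chain and two subspaces, or three subspaces,
    and these configurations are of finite type.

    Sufficiency. In each of the three cases a summand of bounded dimension is
    exhibited in any nonzero module: one or two chains of vectors at the center
    and one at the end of each leg, together with linear forms dual to them
    ([chain_system]). Vectors and forms are chosen extremal with respect to the
    filtrations ([chains_one_leg], [chains_two_legs],
    [chains_left_and_two_legs], [chains_three_legs]), and the unitriangular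
    pairing between them makes the span of the chains a direct summand
    ([split_basis]). In the basis of the chains the generators of the algebra have
    entries zero, one or a root of unity of bounded order ([bounded_basis]),
    which leaves finitely many matrices ([finite_rep_type_criterion]).

    Necessity. In every other case there is a family of modules indexed by the
    field, with an invariant of maps, additive and multiplicative, that is nonzero
    on identities and vanishes on maps between different members; then the
    members have pairwise nonisomorphic indecomposable summands
    ([infinite_rep_type_criterion]). If the [p]-elements act trivially, the families
    are the classical ones: four lines in a plane for [n >= 4], or for [n >= 3] and
    [s > 1], and three flags in a space of dimension three for [n >= 3] and [t > 1],
    or for [n >= 2] and [s, t > 1]. If the [p]-elements of [H] act nontrivially, a
    homomorphism onto the group of order [p] does not vanish on them but kills the
    stabilizer of [alpha], and four lines are found inside modules with Jordan
    blocks of sizes four and two ([infinite_invariant_lines],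
    [infinite_equivariant_maps]); blocks of size four exist because [p] is at
    least five. If they act trivially, so do those of [G]
    ([trivial_left_right]). *)

(** * Modules over the category algebra as matrix representations *)

Section Representations.
Variables (k : fieldType) (C : finCat).
Local Notation A := (catalg k C).

Definition is_rep (d : nat) (R : allmor C -> 'M[k]_d) : Prop :=
  [/\ \sum_(z : ob C) R (Mor (idmor z)) = 1%:M,
      forall (x y z : ob C) (f : mor x y) (g : mor y z),
        R (Mor f) *m R (Mor g) = R (Mor (ccomp g f))
    & forall (x y y' z : ob C) (f : mor x y) (g : mor y' z), y != y' ->
        R (Mor f) *m R (Mor g) = 0].

Definition rep_alg (d : nat) (R : allmor C -> 'M[k]_d) (a : A) : 'M[k]_d :=
  \sum_(m : allmor C) a m *: R m.

Section RepAlg.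
Variables (d : nat) (R : allmor C -> 'M[k]_d).

Lemma rep_algD a b : rep_alg R (a + b) = rep_alg R a + rep_alg R b.
Proof.
rewrite /rep_alg -big_split; apply: eq_bigr => m _.
by rewrite ffunE scalerDl.
Qed.

Lemma rep_algZ c a : rep_alg R (c *: a) = c *: rep_alg R a.
Proof.
rewrite /rep_alg scaler_sumr; apply: eq_bigr => m _.
by rewrite catalg_scaleE scalerA.
Qed.

Lemma rep_alg0 : rep_alg R 0 = 0.
Proof. by rewrite -[0](scale0r 0) rep_algZ scale0r. Qed.

Lemma rep_algN a : rep_alg R (- a) = - rep_alg R a.
Proof. by rewrite -scaleN1r rep_algZ scaleN1r. Qed.

Lemma rep_alg_sum (I : Type) (r : seq I) (P : pred I) (F : I -> A) :
  rep_alg R (\sum_(i <- r | P i) F i) = \sum_(i <- r | P i) rep_alg R (F i).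
Proof. by apply: (big_morph _ rep_algD rep_alg0). Qed.

Lemma rep_alg_kmor (x y : ob C) (f : mor x y) : rep_alg R (kmor k f) = R (Mor f).
Proof.
rewrite /rep_alg (bigD1 (Mor f)) //= ffunE eqxx scale1r big1 ?addr0 // => m mf.
by rewrite ffunE (negPf mf) scale0r.
Qed.

Hypothesis hR : is_rep R.

Lemma rep_alg1 : rep_alg R 1 = 1%:M.
Proof.
have -> : (1 : A) = \sum_(z : ob C) kmor k (idmor z) by [].
case: hR => <- _ _.
by rewrite rep_alg_sum; apply: eq_bigr => z _; rewrite rep_alg_kmor.
Qed.

(** Composition is written from right to left while row vectors are acted on
    from the right, whence the reversal. *)
Lemma rep_algM a b : rep_alg R (a * b) = rep_alg R b *m rep_alg R a.
Proof.
rewrite {1}(catalg_sum_kmor a) {1}(catalg_sum_kmor b).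
rewrite mulr_suml rep_alg_sum {3}/rep_alg mulmx_sumr; apply: eq_bigr => m _.
rewrite mulr_sumr rep_alg_sum {2}/rep_alg mulmx_suml; apply: eq_bigr => m' _.
rewrite -catalg_scaleAl rep_algZ -catalg_scaleAr rep_algZ.
rewrite -scalemxAr -scalemxAl !scalerA mulrC.
congr (_ *: _); case: hR => _ RM R0.
case: m m' => -[y' z] g [[x y] f] /=.
rewrite (MorE (existT _ (x, y) f)) (MorE (existT _ (y', z) g)) /=.
case: (eqVneq y y') => [e|ne]; last by rewrite kmor_mul0 ?rep_alg0 ?R0.
by subst y'; rewrite kmor_mul rep_alg_kmor RM.
Qed.

End RepAlg.

Definition repmod (d : nat) (R : allmor C -> 'M[k]_d) (hR : is_rep R) : Type :=
  'rV[k]_d.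

HB.instance Definition _ d R hR :=
  GRing.Zmodule.copy (@repmod d R hR) 'rV[k]_d.

Section RepModLmod.
Variables (d : nat) (R : allmor C -> 'M[k]_d) (hR : is_rep R).

Definition repmod_scale (a : A) (v : repmod hR) : repmod hR :=
  (v : 'rV_d) *m rep_alg R a.

Fact repmod_scaleA (a b : A) (v : repmod hR) :
  repmod_scale a (repmod_scale b v) = repmod_scale (a * b) v.
Proof. by rewrite /repmod_scale -mulmxA rep_algM. Qed.

Fact repmod_scale1 : left_id 1 repmod_scale.
Proof. by move=> v; rewrite /repmod_scale rep_alg1 // mulmx1. Qed.

Fact repmod_scaleDr : right_distributive repmod_scale +%R.
Proof. by move=> a u v; rewrite /repmod_scale mulmxDl. Qed.

Fact repmod_scaleDl (v : repmod hR) :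
  {morph repmod_scale^~ v : a b / a + b >-> a + b}.
Proof. by move=> a b; rewrite /repmod_scale rep_algD mulmxDr. Qed.

End RepModLmod.

HB.instance Definition _ d R hR :=
  GRing.Zmodule_isLmodule.Build A (@repmod d R hR)
    (@repmod_scaleA d R hR) (@repmod_scale1 d R hR)
    (@repmod_scaleDr d R hR) (@repmod_scaleDl d R hR).

Lemma repmod_scaleE d R (hR : @is_rep d R) (a : A) (v : repmod hR) :
  a *: v = ((v : 'rV_d) *m rep_alg R a : 'rV_d).
Proof. by []. Qed.

End Representations.

(** * Isomorphisms and indecomposability in terms of matrices *)

Section ModuleIso.
Variable A : pzRingType.

Lemma lmod_iso_intro (M N : lmodType A) (f : M -> N) (g : N -> M) :
  linear f -> cancel f g -> cancel g f -> lmod_iso M N.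
Proof.
move=> fL fK gK.
pose fl : {linear M -> N} := HB.pack f (GRing.isLinear.Build A M N _ f fL).
by exists fl; exists g.
Qed.

Lemma lmod_iso_inv (M N : lmodType A) : lmod_iso M N ->
  exists f : M -> N, exists g : N -> M,
    [/\ linear f, linear g, cancel f g & cancel g f].
Proof.
move=> [f [g fK gK]]; exists f; exists g; split=> //; first exact: linearP.
by move=> a u v; apply: (can_inj fK); rewrite linearP !gK.
Qed.

Lemma lmod_iso_sym (M N : lmodType A) : lmod_iso M N -> lmod_iso N M.
Proof.
by move=> /lmod_iso_inv[f [g [fL gL fK gK]]]; apply: (lmod_iso_intro gL).
Qed.

Lemma lmod_iso_trans (M N P : lmodType A) :
  lmod_iso M N -> lmod_iso N P -> lmod_iso M P.
Proof.
move=> /lmod_iso_inv[f [g [fL _ fK gK]]] /lmod_iso_inv[f' [g' [fL' _ fK' gK']]].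
apply: (@lmod_iso_intro _ _ (f' \o f) (g \o g')).
- by move=> a u v /=; rewrite fL fL'.
- by move=> u /=; rewrite fK'.
- by move=> u /=; rewrite gK.
Qed.

Lemma indecomposable_iso (M N : lmodType A) :
  lmod_iso M N -> indecomposable M -> indecomposable N.
Proof.
move=> /lmod_iso_inv[f [g [fL gL fK gK]]] [[v v0] ind].
have f0 : f 0 = 0 by have := fL (-1) 0 0; rewrite addr0 !scaleN1r oppr0 addNr.
have g0 : g 0 = 0 by apply: (can_inj fK); rewrite gK f0.
have gD u w : g (u + w) = g u + g w by have := gL 1 u w; rewrite !scale1r.
split; first by exists (f v); apply: contraNneq v0 => /(congr1 g); rewrite fK g0 => ->.
have sub U : submod_closed U -> submod_closed [pred m : M | f m \in (U : {pred N})].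
  move=> [U0 UP]; split; first by rewrite inE f0.
  by move=> a u w; rewrite !inE fL => Uu Uw; apply: UP.
move=> U V cU cV hD hI.
have [||U0|V0] := ind [pred m : M | f m \in U] [pred m : M | f m \in V]
  (sub _ cU) (sub _ cV).
- move=> m; have [u [w [Uu Vw e]]] := hD (f m).
  exists (g u); exists (g w); rewrite !inE !gK; split=> //.
  by rewrite -gD -e fK.
- by move=> m; rewrite !inE => Um Vm; rewrite -[m]fK (hI _ Um Vm).
- by left=> u Uu; rewrite -[u]gK (U0 (g u)) // inE gK.
- by right=> u Uu; rewrite -[u]gK (V0 (g u)) // inE gK.
Qed.

End ModuleIso.

Section Reps.
Variables (k : fieldType) (C : finCat).
Local Notation A := (catalg k C).

Definition intertwines (d d' : nat) (R : allmor C -> 'M[k]_d)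
  (R' : allmor C -> 'M[k]_d') (X : 'M[k]_(d, d')) : Prop :=
  forall m, R m *m X = X *m R' m.

Lemma intertwines_alg d d' (R : allmor C -> 'M[k]_d) (R' : allmor C -> 'M_d')
  X a : intertwines R R' X -> rep_alg R a *m X = X *m rep_alg R' a.
Proof.
move=> RX; rewrite mulmx_suml mulmx_sumr; apply: eq_bigr => m _.
by rewrite -scalemxAl -scalemxAr RX.
Qed.

Lemma repmod_iso d d' R R' (hR : @is_rep k C d R) (hR' : @is_rep k C d' R')
  (X : 'M_(d, d')) (Y : 'M_(d', d)) :
  intertwines R R' X -> X *m Y = 1%:M -> Y *m X = 1%:M ->
  lmod_iso (repmod hR) (repmod hR').
Proof.
move=> RX XY YX.
apply: (@lmod_iso_intro _ (repmod hR) (repmod hR')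
  (fun v => (v : 'rV_d) *m X) (fun v => (v : 'rV_d') *m Y)).
- move=> a u v; rewrite !repmod_scaleE mulmxDl -!mulmxA.
  by rewrite (intertwines_alg a RX).
- by move=> v; rewrite -mulmxA XY mulmx1.
- by move=> v; rewrite -mulmxA YX mulmx1.
Qed.

(** A linear map between two such modules is multiplication by an intertwiner. *)
Lemma repmod_iso_inv d d' R R' (hR : @is_rep k C d R) (hR' : @is_rep k C d' R') :
  lmod_iso (repmod hR) (repmod hR') ->
  exists X : 'M_(d, d'), exists Y : 'M_(d', d),
    [/\ intertwines R R' X, intertwines R' R Y, X *m Y = 1%:M & Y *m X = 1%:M].
Proof.
have key d1 d2 R1 R2 (hR1 : @is_rep k C d1 R1) (hR2 : @is_rep k C d2 R2)
  (f : repmod hR1 -> repmod hR2) : linear f ->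
  exists X : 'M_(d1, d2), intertwines R1 R2 X /\
     forall v : 'rV_d1, f v = v *m X.
  move=> fL.
  have fk (c : k) (u v : 'rV_d1) :
      f (c *: u + v : 'rV_d1) = c *: (f u : 'rV_d2) + f v :> 'rV_d2.
    have := fL (c *: (1 : A)) u v; rewrite !repmod_scaleE !rep_algZ !rep_alg1 //.
    by rewrite -!scalemxAr !mulmx1.
  pose fl : {linear 'rV[k]_d1 -> 'rV[k]_d2} :=
    HB.pack (f : 'rV[k]_d1 -> 'rV[k]_d2)
      (GRing.isLinear.Build k 'rV[k]_d1 'rV[k]_d2 _ _ fk).
  have fE (v : 'rV_d1) : f v = v *m lin1_mx fl by rewrite mul_rV_lin1.
  exists (lin1_mx fl); split=> // -[[x y] m].
  apply/row_matrixP => i; rewrite !rowE !mulmxA -!fE.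
  have := fL (kmor k m) (delta_mx 0 i) 0; rewrite !addr0.
  have -> : f 0 = 0 by rewrite (fE 0) mul0mx.
  by rewrite addr0 !repmod_scaleE !rep_alg_kmor; exact.
move=> /lmod_iso_inv[f [g [/key[X [hX fE]] /key[Y [hY gE]] fK gK]]].
exists X; exists Y; split=> //; apply/row_matrixP => i; rewrite !rowE mulmx1.
  by rewrite mulmxA -fE -gE fK.
by rewrite mulmxA -gE -fE gK.
Qed.

Lemma repmod_fin_generated d R (hR : @is_rep k C d R) :
  fin_generated (repmod hR).
Proof.
exists d; exists (fun i => delta_mx 0 i : 'rV_d) => v.
exists (fun i => (v : 'rV_d) 0 i *: (1 : A)); rewrite {1}[v]row_sum_delta.
apply: eq_bigr => i _.
by rewrite repmod_scaleE rep_algZ rep_alg1 // -scalemxAr mulmx1.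
Qed.

Lemma indecomposable_idem d R (hR : @is_rep k C d R) (E : 'M_d) :
  indecomposable (repmod hR) -> intertwines R R E -> E *m E = E ->
  E = 0 \/ E = 1%:M.
Proof.
move=> [_ ind] RE EE.
have [||||U0|V0] := ind [pred v : repmod hR | (v : 'rV_d) *m E == v]
                      [pred v : repmod hR | (v : 'rV_d) *m E == 0].
1,2: split; first by rewrite inE mul0mx.
1,2: move=> a u v; rewrite !inE => /eqP uE /eqP vE; rewrite mulmxDl vE;
  by rewrite repmod_scaleE -mulmxA (intertwines_alg a RE) mulmxA uE ?mul0mx ?addr0.
- move=> v; exists ((v : 'rV_d) *m E); exists (v - (v : 'rV_d) *m E).
  by rewrite !inE mulmxBl -!mulmxA EE subrr addrC subrK.
- by move=> v; rewrite !inE => /eqP vE /eqP v0; rewrite -vE.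
- left; apply/row_matrixP => i; rewrite row0; apply: (U0 (row i E)).
  by rewrite inE rowE -mulmxA EE.
- right; apply/row_matrixP => i; apply/eqP; rewrite -subr_eq0; apply/eqP.
  rewrite -linearB /= -opprB linearN /= (V0 (row i (1%:M - E))) ?oppr0 //.
  by rewrite inE rowE -mulmxA mulmxBl mul1mx EE subrr mulmx0.
Qed.

Lemma repmod_indecomposable d R (hR : @is_rep k C d R) :
  (0 < d)%N ->
  (forall E : 'M_d, intertwines R R E -> E *m E = E -> E = 0 \/ E = 1%:M) ->
  indecomposable (repmod hR).
Proof.
move=> d0 hE; split.
  exists (const_mx 1 : 'rV_d); apply/eqP => /rowP/(_ (Ordinal d0)).
  by rewrite !mxE => /eqP; rewrite oner_eq0.
move=> U V [U0 UP] [V0 VP] hD hI.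
have scK (c : k) (v : 'rV_d) : (c *: (1 : A)) *: (v : repmod hR) = (c *: v : 'rV_d).
  by rewrite repmod_scaleE rep_algZ rep_alg1 // -scalemxAr mulmx1.
have U0' : (0 : 'rV_d) \in U by [].
have V0' : (0 : 'rV_d) \in V by [].
have UPk (c : k) (u v : 'rV_d) : u \in U -> v \in U -> (c *: u + v : 'rV_d) \in U.
  by move=> Uu Uv; have := UP (c *: (1 : A)) _ _ Uu Uv; rewrite scK.
have VPk (c : k) (u v : 'rV_d) : u \in V -> v \in V -> (c *: u + v : 'rV_d) \in V.
  by move=> Uu Uv; have := VP (c *: (1 : A)) _ _ Uu Uv; rewrite scK.
have ex i : exists u : 'rV_d, (u \in U) && ((delta_mx 0 i - u : 'rV_d) \in V).
  have [u [v [Uu Vv e]]] := hD (delta_mx 0 i : 'rV_d).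
  have e' : delta_mx 0 i = (u : 'rV_d) + v :> 'rV_d := e.
  by exists u; rewrite Uu e' [u + v - u]addrC addKr.
pose E := \matrix_i xchoose (ex i).
have [EU EV] : (forall v : 'rV_d, v *m E \in U)
               /\ (forall v : 'rV_d, (v - v *m E : 'rV_d) \in V).
  have key (v : 'rV_d) (r : seq 'I_d) :
      let w := \sum_(i <- r) v 0 i *: delta_mx 0 i in
      (w *m E \in U) && ((w - w *m E : 'rV_d) \in V).
    elim: r => [|i r /= /andP[IHU IHV]]; first by rewrite /= big_nil mul0mx subr0 U0' V0'.
    have /andP[Uu Vu] := xchooseP (ex i).
    rewrite big_cons mulmxDl opprD addrACA -!scalemxAl -rowE rowK -scalerBr.
    by rewrite UPk // VPk.
  by split=> v; have := key v (index_enum _); rewrite /= -row_sum_delta => /andP[].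
have uniqE (u v : 'rV_d) : u \in U -> v \in V -> (u + v) *m E = u.
  move=> Uu Vv; apply/eqP; rewrite -subr_eq0; apply/eqP.
  have -> : (u + v) *m E - u = -1 *: u + (u + v) *m E by rewrite scaleN1r addrC.
  apply: hI; first exact: UPk.
  have -> : -1 *: u + (u + v) *m E = -1 *: (u + v - (u + v) *m E) + v.
    by rewrite !scaleN1r opprB opprD -!addrA addNr addr0 addrC.
  exact: VPk.
have RE : intertwines R R E.
  move=> m; apply/row_matrixP => i; rewrite !rowE !mulmxA.
  set v := delta_mx 0 i.
  have -> : v *m R m = v *m E *m R m + (v - v *m E) *m R m.
    by rewrite -mulmxDl [v *m E + _]addrC subrK.
  have hm u : (kmor k (tagged m) : A) *: (u : repmod hR) = u *m R m :> 'rV_d.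
    by rewrite repmod_scaleE rep_alg_kmor -MorE.
  apply: uniqE.
  - by rewrite -hm -[_ *: _]addr0; apply: UP (EU v) U0.
  - by rewrite -hm -[_ *: _]addr0; apply: VP (EV v) V0.
have EE : E *m E = E.
  apply/row_matrixP => i; rewrite rowE mulmxA -rowE.
  by have := uniqE (row i E) 0; rewrite addr0; apply=> //; rewrite rowE.
case: (hE E RE EE) => [E0|E1]; [left=> u Uu|right=> v Vv].
  by have := uniqE u 0 Uu V0'; rewrite E0 mulmx0 => /esym.
by have := uniqE 0 v U0' Vv; rewrite E1 mulmx1 add0r.
Qed.

(** Finite generation over the category algebra means finite dimension over
    the field, the algebra being finite dimensional; a basis is extracted from a
    finite spanning family by discarding dependent vectors. *)
Lemma fin_generated_repmod (N : lmodType A) : fin_generated N ->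
  exists d, exists R, exists hR : @is_rep k C d R, lmod_iso N (repmod hR).
Proof.
move=> [q [e eP]].
pose sc (c : k) (v : N) : N := (c *: (1 : A)) *: v.
have scA c (a : A) v : (c *: a) *: v = sc c (a *: v).
  by rewrite /sc scalerA -catalg_scaleAl mul1r.
have scAr c (a : A) v : a *: sc c v = sc c (a *: v).
  by rewrite /sc !scalerA -catalg_scaleAr -catalg_scaleAl mulr1 mul1r.
have scM c c' v : sc c (sc c' v) = sc (c * c') v.
  by rewrite /sc scalerA -catalg_scaleAl mul1r scalerA.
have sc1 v : sc 1 v = v by rewrite /sc !scale1r.
have sc0 v : sc 0 v = 0 by rewrite /sc !scale0r.
have scDl c c' v : sc (c + c') v = sc c v + sc c' v by rewrite /sc !scalerDl.
have scDr c u v : sc c (u + v) = sc c u + sc c v by rewrite /sc scalerDr.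
have sc_sum c (I : Type) (r : seq I) (F : I -> N) :
    sc c (\sum_(i <- r) F i) = \sum_(i <- r) sc c (F i) by rewrite /sc scaler_sumr.
pose comb d (b : 'I_d -> N) (c : 'rV[k]_d) := \sum_i sc (c 0 i) (b i).
have combP d (b : 'I_d -> N) a u v : comb d b (a *: u + v) = sc a (comb d b u) + comb d b v.
  rewrite /comb sc_sum -big_split; apply: eq_bigr => i _.
  by rewrite !mxE scDl scM.
have [d [b [bS bF]]] : exists d, exists b : 'I_d -> N,
    (forall v, exists c, v = comb d b c) /\ (forall c, comb d b c = 0 -> c = 0).
  have [d0 [b0 bS0]] : exists d, exists b : 'I_d -> N, forall v, exists c, v = comb d b c.
    exists #|{: allmor C * 'I_q}|.
    exists (fun j => let mi : allmor C * 'I_q := enum_val j in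
                   (kmor k (tagged mi.1) : A) *: e mi.2) => v.
    have [c ->] := eP v.
    exists (\row_j (let mi : allmor C * 'I_q := enum_val j in c mi.2 mi.1)).
    transitivity (\sum_(mi : allmor C * 'I_q) sc (c mi.2 mi.1) ((kmor k (tagged mi.1) : A) *: e mi.2)).
      rewrite -(pair_bigA _ (fun m i => sc (c i m) (kmor k (tagged m) *: e i))) /=.
      rewrite exchange_big /=; apply: eq_bigr => i _.
      rewrite {1}(catalg_sum_kmor (c i)) scaler_suml; apply: eq_bigr => m _.
      by rewrite scA.
    rewrite /comb (reindex (@enum_val _ (mem {: allmor C * 'I_q}))) /=; last first.
      exact/onW_bij/enum_val_bij.
    by apply: eq_bigr => j _; rewrite mxE.
  elim: d0 b0 bS0 => [|d IH] b bS.
    by exists 0%N; exists b; split=> // c _; apply/rowP => -[].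
  have [free|] := classic (forall c, comb _ b c = 0 -> c = 0); first by exists d.+1, b.
  move=> nf; have [c hc] := not_all_ex_not _ _ nf.
  have [c0 /eqP cn0] := imply_to_and _ _ hc.
  have /rV0Pn[i ci] := cn0.
  apply: (IH (fun j => b (lift i j))) => v; have [c' ->] := bS v.
  pose c2 := c' - (c' 0 i / c 0 i) *: c.
  have c2i : c2 0 i = 0 by rewrite !mxE divfK // subrr.
  exists (\row_j c2 0 (lift i j)).
  have -> : comb _ b c' = comb _ b c2.
    have -> : c' = (c' 0 i / c 0 i) *: c + c2 by rewrite addrC subrK.
    by rewrite combP c0 /sc scaler0 add0r.
  rewrite /comb (bigD1_ord i) //= c2i sc0 add0r.
  by apply: eq_bigr => j _; rewrite mxE.
have exc v : exists c, v == comb d b c by have [c ->] := bS v; exists c.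
pose co v := xchoose (exc v).
have coK v : comb d b (co v) = v by rewrite -(eqP (xchooseP (exc v))).
have combN u v : comb d b (u - v) = comb d b u - comb d b v.
  have := combP d b (-1) v u; rewrite scaleN1r addrC => ->.
  by rewrite /sc !scaleN1r addrC.
have combK c : co (comb d b c) = c.
  apply/eqP; rewrite -subr_eq0; apply/eqP/bF.
  by rewrite combN coK subrr.
have coP c u v : co (sc c u + v) = c *: co u + co v.
  by rewrite -[RHS]combK combP !coK.
have co0 : co 0 = 0.
  by have := coP (-1) 0 0; rewrite addr0 scaleN1r addNr /sc scaler0.
have co_sum (I : Type) (r : seq I) (F : I -> N) :
    co (\sum_(i <- r) F i) = \sum_(i <- r) co (F i).
  apply: (big_morph co) => // u v.
  by have := coP 1 u v; rewrite sc1 scale1r.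
pose T (a : A) : 'M[k]_d := \matrix_i co (a *: b i).
have TE a v : co (a *: v) = co v *m T a.
  rewrite -{1}(coK v) /comb scaler_sumr co_sum mulmx_sum_row.
  apply: eq_bigr => i _; rewrite rowK scAr.
  by rewrite -[sc _ _]addr0 coP co0 addr0.
have Tdet (X Y : 'M[k]_d) : (forall v, co v *m X = co v *m Y) -> X = Y.
  move=> h; apply/row_matrixP => i; rewrite !rowE.
  by have := h (comb d b (delta_mx 0 i)); rewrite combK.
have TM a a' : T (a * a') = T a' *m T a.
  by apply: Tdet => v; rewrite mulmxA -!TE -scalerA.
have T1 : T 1 = 1%:M by apply: Tdet => v; rewrite -TE scale1r mulmx1.
have TD a a' : T (a + a') = T a + T a'.
  apply: Tdet => v; rewrite mulmxDr -!TE scalerDl.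
  by have := coP 1 (a *: v) (a' *: v); rewrite sc1 scale1r.
have T0 : T 0 = 0 by apply: Tdet => v; rewrite -TE scale0r co0 mulmx0.
have TZ c a : T (c *: a) = c *: T a.
  apply: Tdet => v; rewrite -scalemxAr -!TE scA.
  by rewrite -[sc _ _]addr0 coP co0 addr0.
pose R (m : allmor C) := T (kmor k (tagged m)).
have hR : is_rep R.
  split.
  - rewrite -T1; symmetry; apply: (big_morph T TD T0).
  - by move=> x y z f g; rewrite /R /= -TM kmor_mul.
  - by move=> x y y' z f g ne; rewrite /R /= -TM kmor_mul0.
have RT a : rep_alg R a = T a.
  rewrite [in RHS](catalg_sum_kmor a) (big_morph T TD T0).
  by apply: eq_bigr => m _; rewrite TZ.
exists d, R, hR; apply: (@lmod_iso_intro _ N (repmod hR) co (comb d b)) => //.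
by move=> a u v; rewrite repmod_scaleE RT -TE -{1}[a *: u]sc1 coP scale1r.
Qed.

End Reps.

(** * Criteria for finite and for infinite representation type *)

Section FiniteCriterion.
Variables (k : fieldType) (C : finCat).
Local Notation A := (catalg k C).

(** Generation as a unital algebra over the field, stated as an induction
    principle. *)
Definition generates (J : finType) (a : J -> A) : Prop :=
  forall P : A -> Prop,
    (forall j, P (a j)) -> P 1 ->
    (forall (c : k) u v, P u -> P v -> P (c *: u + v)) ->
    (forall u v, P u -> P v -> P (u * v)) -> forall u, P u.

(** Matrices with entries in a finite set and of bounded size leave only
    finitely many possibilities for a representation, since it is determined by
    the matrices of the generators. *)
Lemma finite_rep_type_criterion (J : finType) (a : J -> A) (S : seq k) (D : nat) :
  generates a ->
  (forall d R (hR : @is_rep k C d R), indecomposable (repmod hR) ->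
    exists r R' (hR' : @is_rep k C r R'),
      [/\ (r <= D)%N, lmod_iso (repmod hR) (repmod hR')
        & forall j i i', rep_alg R' (a j) i i' \in S]) ->
  finite_rep_type A.
Proof.
move=> gen hS.
pose T : finType := {r : 'I_D.+1 & {ffun J * 'I_r * 'I_r -> seq_sub S}}.
pose code (N : lmodType A) (t : T) := exists R (hR : @is_rep k C (tag t) R),
  lmod_iso N (repmod hR) /\
  forall j i i', rep_alg R (a j) i i' = val (tagged t (j, i, i')).
have code_iso N N' t : code N t -> code N' t -> lmod_iso N N'.
  move=> [R [hR [isoN e]]] [R' [hR' [isoN' e']]].
  have RR' u : rep_alg R u = rep_alg R' u.
    apply: (gen (fun u => rep_alg R u = rep_alg R' u)) => //.
    - by move=> j; apply/matrixP => i i'; rewrite e e'.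
    - by rewrite !rep_alg1.
    - by move=> c v w hv hw; rewrite !rep_algD !rep_algZ hv hw.
    - by move=> v w hv hw; rewrite !rep_algM // hv hw.
  apply: (lmod_iso_trans isoN); apply: (lmod_iso_trans _ (lmod_iso_sym isoN')).
  apply: (@repmod_iso _ _ _ _ _ _ hR hR' 1%:M 1%:M); rewrite ?mulmx1 //.
  move=> m; rewrite mul1mx mulmx1 (MorE m).
  by have := RR' (kmor k (tagged m)); rewrite !rep_alg_kmor.
have code_ex N : fin_generated N -> indecomposable N -> exists t, code N t.
  move=> fgN indN; have [d [R [hR isoN]]] := fin_generated_repmod fgN.
  have [r [R' [hR' [rD iso' eS]]]] := hS _ _ hR (indecomposable_iso isoN indN).
  pose c : {ffun J * 'I_r * 'I_r -> seq_sub S} :=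
    [ffun p => SeqSub (eS p.1.1 p.1.2 p.2)].
  exists (Tagged (fun r : 'I_D.+1 => {ffun J * 'I_r * 'I_r -> seq_sub S})
     (i := Ordinal (rD : (r < D.+1)%N)) c).
  exists R', hR'; split; first exact: lmod_iso_trans isoN iso'.
  by move=> j i i'; rewrite /= ffunE.
exists #|T|.
pose M0 : lmodType A := A^o.
pose M (i : 'I_#|T|) : lmodType A :=
  epsilon (inhabits M0) (fun N => code N (enum_val i)).
exists M => N fgN indN; have [t ct] := code_ex N fgN indN.
exists (enum_rank t); apply: (code_iso _ _ t) => //.
rewrite /M enum_rankK; exact: (epsilon_spec (inhabits M0) (fun N => code N t) (ex_intro _ N ct)).
Qed.

(** A family of vectors and a family of linear forms whose pairing is
    unitriangular, both spanning stable subspaces, split the module: the span of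
    the vectors is a complement of the common kernel of the forms. For an
    indecomposable module the vectors therefore form a basis. *)
Lemma split_basis (J : finType) (a : J -> A) d R (hR : @is_rep k C d R)
  (I : finType) (i0 : I) (s : I -> 'rV[k]_d) (t : I -> 'cV[k]_d) (pos : I -> nat)
  (cs ct : J -> I -> I -> k) :
  generates a -> indecomposable (repmod hR) ->
  (forall i, s i *m t i = 1%:M) ->
  (forall i i', i != i' -> (pos i' <= pos i)%N -> s i *m t i' = 0) ->
  (forall j i, s i *m rep_alg R (a j) = \sum_i' cs j i i' *: s i') ->
  (forall j i, rep_alg R (a j) *m t i = \sum_i' ct j i i' *: t i') ->
  exists R' (hR' : @is_rep k C #|I| R'), lmod_iso (repmod hR) (repmod hR') /\
    forall j, rep_alg R' (a j) = \matrix_(p, q) cs j (enum_val p) (enum_val q).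
Proof.
move=> gen ind st1 st0 hs ht; pose r := #|I|.
pose S : 'M[k]_(r, d) := \matrix_p s (enum_val p).
pose T : 'M[k]_(d, r) := \matrix_(i, p) t (enum_val p) i 0.
have rowS p : row p S = s (enum_val p) by rewrite rowK.
have colT p : col p T = t (enum_val p).
  by apply/colP => i; rewrite !mxE.
have PE p q : (S *m T) p q = (s (enum_val p) *m t (enum_val q)) 0 0.
  by rewrite -rowS -colT !mxE; apply: eq_bigr => i _; rewrite !mxE.
have Pu : S *m T \in unitmx.
  rewrite -row_free_unit; apply: inj_row_free => c /rowP cP.
  suff c0 n p : (pos (enum_val p) < n)%N -> c 0 p = 0.
    by apply/rowP => p; rewrite mxE (c0 _ _ (ltnSn _)).
  elim: n p => // n IH p; rewrite ltnS => pn.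
  have := cP p; rewrite !mxE (bigD1 p) //= PE st1 mxE eqxx mulr1.
  rewrite big1 ?addr0 // => q qp; rewrite PE.
  case: (ltnP (pos (enum_val q)) (pos (enum_val p))) => h.
    by rewrite IH ?mul0r // (leq_trans h).
  by rewrite st0 ?mxE ?mulr0 // (inj_eq enum_val_inj).
have [T' T'E ST'] : exists2 T', T' = T *m invmx (S *m T) & S *m T' = 1%:M.
  by exists (T *m invmx (S *m T)); rewrite // mulmxA mulmxV.
have hS j : S *m rep_alg R (a j) = (\matrix_(p, q) cs j (enum_val p) (enum_val q)) *m S.
  apply/row_matrixP => p; rewrite row_mul rowS hs [RHS]row_mul mulmx_sum_row.
  rewrite (reindex (@enum_val _ (mem I))) /=; last exact/onW_bij/enum_val_bij.
  by apply: eq_bigr => q _; rewrite rowS !mxE.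
have hT j : rep_alg R (a j) *m T = T *m (\matrix_(q, p) ct j (enum_val p) (enum_val q)).
  apply/matrixP => i p.
  transitivity ((rep_alg R (a j) *m t (enum_val p)) i 0).
    by rewrite -colT !mxE; apply: eq_bigr => l _; rewrite !mxE.
  rewrite ht (reindex (@enum_val _ (mem I))) /=; last exact/onW_bij/enum_val_bij.
  rewrite !mxE summxE; apply: eq_bigr => q _.
  by rewrite !mxE mulrC.
have stab u : (exists X, S *m rep_alg R u = X *m S) /\ (exists Y, rep_alg R u *m T = T *m Y).
  apply: (gen (fun u => (exists X, S *m rep_alg R u = X *m S)
                  /\ (exists Y, rep_alg R u *m T = T *m Y))).
  - by move=> j; split; eexists; [exact: hS|exact: hT].
  - by rewrite rep_alg1 //; split; exists 1%:M; rewrite ?mul1mx ?mulmx1.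
  - move=> c v w [[X vX] [Y vY]] [[X' wX] [Y' wY]]; rewrite rep_algD rep_algZ; split.
      by exists (c *: X + X'); rewrite mulmxDr mulmxDl -scalemxAr -scalemxAl vX wX.
    by exists (c *: Y + Y'); rewrite mulmxDr mulmxDl -scalemxAr -scalemxAl vY wY.
  - move=> v w [[X vX] [Y vY]] [[X' wX] [Y' wY]]; rewrite rep_algM //; split.
      by exists (X' *m X); rewrite mulmxA wX -mulmxA vX mulmxA.
    by exists (Y' *m Y); rewrite -mulmxA vY mulmxA wY -mulmxA.
have comm u : rep_alg R u *m (T' *m S) = T' *m S *m rep_alg R u.
  have [[X uX] [Y uY]] := stab u.
  have XY : X *m (S *m T) = S *m T *m Y by rewrite mulmxA -uX -!mulmxA uY.
  have YP : Y *m invmx (S *m T) = invmx (S *m T) *m X.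
    move: (S *m T) Pu XY => P Pu XY; apply: (can_inj (mulKmx Pu)).
    by rewrite mulmxA -XY mulmxK // mulKVmx.
  rewrite mulmxA T'E mulmxA uY -(mulmxA T) YP -!mulmxA; congr (_ *m (_ *m _)).
  by rewrite uX.
have RE : intertwines R R (T' *m S).
  by move=> m; have := comm (kmor k (tagged m)); rewrite !rep_alg_kmor -!MorE.
have EE : T' *m S *m (T' *m S) = T' *m S.
  by rewrite mulmxA -(mulmxA T') ST' mulmx1.
have [E0|T'S] := indecomposable_idem ind RE EE.
  have : S *m (T' *m S) *m T' = 1%:M by rewrite -mulmxA -(mulmxA T') ST' mulmx1.
  rewrite E0 mulmx0 mul0mx => /matrixP/(_ (enum_rank i0) (enum_rank i0)).
  by rewrite !mxE eqxx => /esym/eqP; rewrite oner_eq0.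
pose R' m := S *m R m *m T'.
have R'M m m' : R' m *m R' m' = S *m (R m *m R m') *m T'.
  by rewrite /R' -!mulmxA (mulmxA T') T'S mul1mx.
have hR' : is_rep R'.
  case: (hR) => R1 RM R0; split.
  - by rewrite -mulmx_suml -mulmx_sumr R1 mulmx1 ST'.
  - by move=> x y z f g; rewrite R'M RM.
  - by move=> x y y' z f g ne; rewrite R'M R0 // mulmx0 mul0mx.
exists R', hR'; split.
  apply: (@repmod_iso _ _ _ _ _ _ hR hR' T' S) => // m.
  by rewrite /R' !mulmxA T'S mul1mx.
move=> j; have -> : rep_alg R' (a j) = S *m rep_alg R (a j) *m T'.
  rewrite /rep_alg mulmx_sumr mulmx_suml; apply: eq_bigr => m _.
  by rewrite -scalemxAr -scalemxAl.
by rewrite hS -mulmxA ST' mulmx1.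
Qed.

End FiniteCriterion.

Lemma closed_field_uniq_seq (k : closedFieldType) (n : nat) :
  exists2 s : seq k, uniq s & size s = n.
Proof.
elim: n => [|n [s us ss]]; first by exists [::].
pose q := \prod_(z <- s) ('X - z%:P) : {poly k}.
have sq : size q = n.+1 by rewrite size_prod_XsubC ss.
have [z zq] : exists z, root (q * 'X + 1) z.
  apply/closed_rootP; rewrite size_MXaddC; case: ifP => [/andP[/eqP q0 _]|_].
    by rewrite q0 size_poly0 in sq.
  by rewrite sq.
exists (z :: s) => /=; last by rewrite ss.
rewrite us andbT; apply/negP => zs.
have qz : q.[z] = 0 by apply/eqP; rewrite -/(root q z) root_prod_XsubC.
by move: zq; rewrite /root !hornerE qz mul0r add0r oner_eq0.
Qed.

(** The full rank factorization of an idempotent presents its image as a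
    summand. *)
Lemma idempotent_split (k : fieldType) d (E : 'M[k]_d) : E *m E = E ->
  exists (U : 'M_(\rank E, d)) (V : 'M_(d, \rank E)),
    V *m U = E /\ U *m V = 1%:M.
Proof.
move=> EE; exists (row_base E), (col_base E); split; first exact: mulmx_base.
have := mulmx_base E.
have /row_freeP[U'] := row_base_free E; have /row_fullP[V'] := col_base_full E.
move: (col_base E) (row_base E) => V U V'V UU' VU.
have VUVU : V *m (U *m V) *m U = V *m U.
  by rewrite mulmxA VU -mulmxA VU EE.
have : V' *m (V *m (U *m V) *m U) *m U' = V' *m (V *m U) *m U' by rewrite VUVU.
by rewrite !mulmxA V'V !mul1mx -mulmxA UU' mulmx1.
Qed.

Section InfiniteCriterion.
Variables (k : closedFieldType) (C : finCat).
Local Notation A := (catalg k C).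

(** The image of an idempotent endomorphism of minimal rank on which the
    additive invariant does not vanish is indecomposable: a further splitting
    would leave the invariant nonzero on a smaller summand. *)
Lemma indecomposable_summand d R (hR : @is_rep k C d R) (kappa : 'M[k]_d -> k) :
  {morph kappa : f g / f + g} -> kappa 1%:M != 0 ->
  exists r R' (hR' : @is_rep k C r R') (U : 'M_(r, d)) (V : 'M_(d, r)),
    [/\ indecomposable (repmod hR'), intertwines R' R U, intertwines R R' V,
        U *m V = 1%:M & kappa (V *m U) != 0].
Proof.
move=> kD k1.
have k0 : kappa 0 = 0 by apply: (addrI (kappa 0)); rewrite -kD !addr0.
suff key n (E : 'M_d) : (\rank E < n)%N -> intertwines R R E -> E *m E = E ->
    kappa E != 0 ->
  exists r R' (hR' : @is_rep k C r R') (U : 'M_(r, d)) (V : 'M_(d, r)),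
    [/\ indecomposable (repmod hR'), intertwines R' R U, intertwines R R' V,
        U *m V = 1%:M & kappa (V *m U) != 0].
  apply: (key _ 1%:M (ltnSn _)) => //; last by rewrite mulmx1.
  by move=> m; rewrite mulmx1 mul1mx.
elim: n E => // n IH E; rewrite ltnS => rE RE EE kE.
have [U [V [VU UV]]] := idempotent_split EE.
move: (\rank E) rE U V VU UV => q rE U V VU UV.
have EV : E *m V = V by rewrite -VU -mulmxA UV mulmx1.
have UE : U *m E = U by rewrite -VU mulmxA UV mul1mx.
pose R' m := U *m R m *m V.
have R'U : intertwines R' R U.
  by move=> m; rewrite /R' -!mulmxA VU RE mulmxA UE.
have RV : intertwines R R' V.
  by move=> m; rewrite /R' !mulmxA VU -RE -mulmxA EV.
have hR' : is_rep R'.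
  have R'M m m' : R' m *m R' m' = U *m (R m *m R m') *m V.
    by rewrite {2}/R' !mulmxA R'U.
  case: (hR) => R1 RM R0; split.
  - by rewrite -mulmx_suml -mulmx_sumr R1 mulmx1 UV.
  - by move=> x y z f g; rewrite R'M RM.
  - by move=> x y y' z f g ne; rewrite R'M R0 // mulmx0 mul0mx.
clearbody R'; have r0 : (0 < q)%N.
  rewrite lt0n; apply: contraNneq kE => q0; subst q.
  by rewrite -VU (flatmx0 U) mulmx0 k0.
have [ind|] := classic (forall F : 'M_(q), intertwines R' R' F -> F *m F = F ->
   F = 0 \/ F = 1%:M).
  exists (q), R', hR', U, V; split=> //; last by rewrite VU.
  exact: repmod_indecomposable.
move=> nind; have [F hF] := not_all_ex_not _ _ nind.
have [RF hF'] := imply_to_and _ _ hF; have [FF nF] := imply_to_and _ _ hF'.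
have small (G : 'M_(q)) : intertwines R' R' G -> G *m G = G -> G <> 1%:M ->
    kappa (V *m G *m U) != 0 ->
    exists r R' (hR' : @is_rep k C r R') (U : 'M_(r, d)) (V : 'M_(d, r)),
    [/\ indecomposable (repmod hR'), intertwines R' R U, intertwines R R' V,
        U *m V = 1%:M & kappa (V *m U) != 0].
  move=> RG GG G1 kG; apply: (IH (V *m G *m U)) => //.
  - apply: leq_trans rE; apply: (leq_ltn_trans (mxrankM_maxl _ _)).
    apply: (leq_ltn_trans (mxrankM_maxr _ _)).
    rewrite ltn_neqAle rank_leq_row andbT; apply/negP => Gu.
    have {}Gu : G \in unitmx by rewrite -row_free_unit.
    by apply: G1; apply: (can_inj (mulKmx Gu)); rewrite mulmx1.
  - by move=> m; rewrite !mulmxA RV -(mulmxA V) RG -!mulmxA R'U.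
  - by rewrite -!mulmxA (mulmxA U) UV mul1mx (mulmxA G) GG.
have [kF|kF] := eqVneq (kappa (V *m F *m U)) 0; last first.
  by apply: (small F) => // F1; apply: nF; right.
apply: (small (1%:M - F)).
- by move=> m; rewrite mulmxBr mulmxBl mulmx1 mul1mx RF.
- by rewrite mulmxBr mulmx1 mulmxBl mul1mx FF subrr subr0.
- move=> F1; apply: nF; left; apply/eqP; rewrite -oppr_eq0; apply/eqP.
  by apply: (addrI 1%:M); rewrite addr0.
- move: kE; rewrite -VU -[V in kappa (V *m U)]mulmx1.
  have -> : V *m 1%:M *m U = V *m (1%:M - F) *m U + V *m F *m U.
    by rewrite -mulmxDl -mulmxDr subrK.
  by rewrite kD kF addr0.
Qed.

(** Each member of the family has an indecomposable summand seen by the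
    invariant, and these summands are pairwise nonisomorphic because the
    invariant is multiplicative and kills all maps between different members. *)
Lemma infinite_rep_type_criterion d (R : k -> allmor C -> 'M[k]_d)
  (kappa : 'M[k]_d -> k) :
  (forall l, is_rep (R l)) -> {morph kappa : f g / f + g} -> kappa 1%:M != 0 ->
  (forall l m n f g, intertwines (R l) (R m) f -> intertwines (R m) (R n) g ->
     kappa (f *m g) = kappa f * kappa g) ->
  (forall l m f, l != m -> intertwines (R l) (R m) f -> kappa f = 0) ->
  ~ finite_rep_type A.
Proof.
move=> hR kD k1 kM kne [n [M hM]].
have [s us ss] := closed_field_uniq_seq k n.+1.
pose P (j : 'I_n.+1) (i : 'I_n) := exists r R' (hR' : @is_rep k C r R')
   (U : 'M_(r, d)) (V : 'M_(d, r)),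
   [/\ lmod_iso (repmod hR') (M i), intertwines R' (R s`_j) U,
       intertwines (R s`_j) R' V, U *m V = 1%:M & kappa (V *m U) != 0].
have [f fP] : exists f, forall j, P j (f j).
  apply: fin_all_exists => j.
  have [r [R' [hR' [U [V [ind iU iV UV kVU]]]]]] := indecomposable_summand (hR s`_j) kD k1.
  have [i iso] := hM _ (repmod_fin_generated hR') ind.
  by exists i, r, R', hR', U, V.
have /injectivePn[j [j' jj' fjj']] : ~~ injectiveb f.
  by apply/negP => /injectiveP/leq_card; rewrite !card_ord ltnn.
have [r1 [R1 [hR1 [U1 [V1 [iso1 iU1 iV1 UV1 k1']]]]]] := fP j.
have [r2 [R2 [hR2 [U2 [V2 [iso2 iU2 iV2 UV2 k2']]]]]] := fP j'.
rewrite -fjj' in iso2.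
have [X [Y [iX iY XY YX]]] := repmod_iso_inv (lmod_iso_trans iso1 (lmod_iso_sym iso2)).
have sjj' : s`_j != s`_j'.
  by rewrite nth_uniq ?ss ?ltn_ord // (inj_eq val_inj).
have iF : intertwines (R s`_j) (R s`_j') (V1 *m X *m U2).
  by move=> m; rewrite !mulmxA iV1 -(mulmxA V1) iX -!mulmxA iU2.
have iG : intertwines (R s`_j') (R s`_j) (V2 *m Y *m U1).
  by move=> m; rewrite !mulmxA iV2 -(mulmxA V2) iY -!mulmxA iU1.
have := kM _ _ _ _ _ iF iG; rewrite (kne _ _ _ sjj' iF) mul0r.
rewrite -!mulmxA (mulmxA U2) UV2 mul1mx (mulmxA X) XY mul1mx => k0.
by rewrite k0 eqxx in k1'.
Qed.

End InfiniteCriterion.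

(** * Unipotent and explicit matrices *)

Section UnipotentPowers.
Variables (k : fieldType) (n : nat) (b : 'M[k]_n.+1) (q : nat).
Hypothesis bq : (1 + b) ^+ q = 1.

Lemma unipotent_congr i j : (i = j %[mod q])%N -> (1 + b) ^+ i = (1 + b) ^+ j.
Proof. by move=> ij; rewrite -(expr_mod i bq) ij expr_mod. Qed.

Lemma unipotentM (gT : finGroupType) (th : gT -> nat) :
  (forall g h, th (g * h)%g = th g + th h %[mod q])%N ->
  forall g h, (1 + b) ^+ th g *m (1 + b) ^+ th h = (1 + b) ^+ th (h * g)%g.
Proof. by move=> thM g h; rewrite (unipotent_congr (thM h g)) addnC exprD. Qed.

Lemma unipotent_fix m (e : 'M[k]_(m, n.+1)) i : e *m b = 0 -> e *m (1 + b) ^+ i = e.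
Proof.
move=> eb; elim: i => [|i IH]; first by rewrite expr0 mulmx1.
by rewrite exprSr -[_ * _]/(_ *m _) mulmxA IH mulmxDr mulmx1 eb addr0.
Qed.

Lemma unipotent_fixl m (e : 'M[k]_(n.+1, m)) i : b *m e = 0 -> (1 + b) ^+ i *m e = e.
Proof.
move=> eb; elim: i => [|i IH]; first by rewrite expr0 mul1mx.
by rewrite exprS -[_ * _]/(_ *m _) -mulmxA IH mulmxDl mul1mx eb addr0.
Qed.

Lemma unipotent_comm_inv (f : 'M[k]_n.+1) i : (i = 1 %[mod q])%N ->
  (1 + b) ^+ i *m f = f *m (1 + b) ^+ i -> b *m f = f *m b.
Proof.
move=> /unipotent_congr ->; rewrite expr1 mulmxDl mulmxDr.
by rewrite mulmx1 mul1mx => /addrI.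
Qed.

End UnipotentPowers.

Lemma unipotent_pchar (k : fieldType) (p n : nat) (b : 'M[k]_n.+1) :
  p \in [pchar k] -> b ^+ p = 0 -> (1 + b) ^+ p = 1.
Proof.
move=> pk bp; have pM : p \in [pchar 'M[k]_n.+1] by rewrite pchar_lalg.
have := pFrobenius_autD_comm pM (commr_sym (commr1 b)).
by rewrite !pFrobenius_autE bp expr1n addr0.
Qed.

Section AdditiveMod.
Variables (q : nat) (gT : finGroupType) (th : gT -> nat).
Hypothesis thM : forall g h, (th (g * h)%g = th g + th h %[mod q])%N.

Lemma additive_mod_id : (th 1%g = 0 %[mod q])%N.
Proof.
have := thM 1%g 1%g; rewrite mulg1 => /eqP.
by rewrite -{1}[th 1%g]addn0 eqn_modDl => /eqP.
Qed.

Lemma additive_modX (g : gT) n : (th (g ^+ n)%g = n * th g %[mod q])%N.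
Proof.
elim: n => [|n IH]; first by rewrite expg0 additive_mod_id.
by rewrite expgS thM mulSn -modnDmr IH modnDmr.
Qed.

Lemma additive_mod_unit (g : gT) : prime q -> ~~ (q %| th g)%N ->
  exists n, (th (g ^+ n)%g = 1 %[mod q])%N.
Proof.
move=> qp nq; have th0 : (0 < th g)%N by rewrite lt0n; apply: contraNneq nq => ->.
have co : coprime q (th g) by rewrite prime_coprime.
case: (egcdnP q th0) => u v uv _; exists u.
rewrite additive_modX uv gcdnC (eqP co).
by rewrite modnMDl.
Qed.

End AdditiveMod.

Section ExplicitMatrices.
Variable k : fieldType.

Definition mxl m n (rows : seq (seq k)) : 'M[k]_(m, n) :=
  \matrix_(i, j) (nth [::] rows i)`_j.

Lemma sum_inord n (F : 'I_n.+1 -> k) :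
  \sum_i F i = \sum_(i <- iota 0 n.+1) F (inord i).
Proof.
rewrite -val_enum_ord big_map big_enum; apply: eq_bigr => i _.
by rewrite /= inord_val.
Qed.

Lemma mulmx_inord m n q (A : 'M[k]_(m, n.+1)) (B : 'M[k]_(n.+1, q)) i j :
  (A *m B) i j = \sum_(l <- iota 0 n.+1) A i (inord l) * B (inord l) j.
Proof. by rewrite mxE sum_inord. Qed.

Lemma mxlE m n rows i j : (i < m.+1)%N -> (j < n.+1)%N ->
  mxl m.+1 n.+1 rows (inord i) (inord j) = (nth [::] rows i)`_j.
Proof. by move=> im jn; rewrite mxE !inordK. Qed.

End ExplicitMatrices.

Ltac simp01 := rewrite ?(mul0r, mulr0, mul1r, mulr1, add0r, addr0, subr0, oppr0, mulrN1, mulN1r).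
Lemma matrix_inord_eq (k : fieldType) m n (A B : 'M[k]_(m.+1, n.+1)) :
  (forall i j, (i < m.+1)%N -> (j < n.+1)%N ->
     A (inord i) (inord j) = B (inord i) (inord j)) -> A = B.
Proof.
by move=> h; apply/matrixP => i j; rewrite -(inord_val i) -(inord_val j) h.
Qed.

Lemma mxl_mulE (k : fieldType) m n q (rA rB : seq (seq k)) i j :
  (i < m.+1)%N -> (j < q.+1)%N ->
  (mxl m.+1 n.+1 rA *m mxl n.+1 q.+1 rB) (inord i) (inord j)
  = foldr (fun l s => (nth [::] rA i)`_l * (nth [::] rB l)`_j + s) 0 (iota 0 n.+1).
Proof.
move=> im jq; rewrite mulmx_inord.
have : all (fun l => (l < n.+1)%N) (iota 0 n.+1).
  by apply/allP => l; rewrite mem_iota.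
elim: (iota 0 n.+1) => [|l s IH] /=; first by rewrite big_nil.
by move=> /andP[ln ls]; rewrite big_cons IH // !mxlE.
Qed.

Lemma weight_nilpotent (k : fieldType) n (b : 'M[k]_n.+1) (w : 'I_n.+1 -> nat) N :
  (forall i j, (w j <= w i)%N -> b i j = 0) -> (forall i, (w i < N)%N) -> b ^+ N = 0.
Proof.
move=> bw wN; suff H m i j : (w j < w i + m)%N -> (b ^+ m) i j = 0.
  by apply/matrixP => i j; rewrite [RHS]mxE H // ltn_addl.
elim: m i j => [|m IH] i j.
  by rewrite addn0 expr0 mxE; case: eqP => // ->; rewrite ltnn.
move=> wij; rewrite exprS mxE big1 // => l _.
case: (leqP (w l) (w i)) => h; first by rewrite bw // mul0r.
by rewrite IH ?mulr0 // (leq_trans wij) // addnS -addSn leq_add2r.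
Qed.

Lemma mxl_nilpotent (k : fieldType) n (rows : seq (seq k)) (w : seq nat) N :
  (forall i j, (i < n.+1)%N -> (j < n.+1)%N ->
     (nth 0 w j <= nth 0 w i)%N -> (nth [::] rows i)`_j = 0) ->
  all (fun c => c < N)%N w -> size w = n.+1 -> mxl n.+1 n.+1 rows ^+ N = 0.
Proof.
move=> h wN sw; apply: (weight_nilpotent (w := fun i => nth 0%N w i)).
  by move=> i j wij; rewrite mxE h.
by move=> i; apply: (allP wN); rewrite mem_nth ?sw.
Qed.

Lemma mxl_entries (k : fieldType) m n (f : 'M[k]_(m.+1, n.+1)) :
  f = mxl m.+1 n.+1 (mkseq (fun i => mkseq (fun j => f (inord i) (inord j)) n.+1) m.+1).
Proof.
apply: matrix_inord_eq => i j im jn; rewrite mxlE // nth_mkseq // nth_mkseq //.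
Qed.

Lemma exprn_eq0_le (k : fieldType) n (b : 'M[k]_n.+1) i j :
  (i <= j)%N -> b ^+ i = 0 -> b ^+ j = 0.
Proof. by move=> ij bi; rewrite -(subnK ij) exprD bi mulr0. Qed.

Ltac entry H i j :=
  have := congr1 (fun M : matrix _ _ _ => M (inord i) (inord j)) H;
  rewrite !mxl_mulE //=; simp01.

Lemma block_conclusion (k : fieldType) n (f : 'M[k]_n.+1) (P : Prop) :
  (forall j, (0 < j)%N -> (j < n.+1)%N -> f (inord j) (inord 0) = 0) ->
  (P -> f (inord 0) (inord 0) = 0) ->
  (forall j, j != ord0 -> f j ord0 = 0) /\ (P -> f ord0 ord0 = 0).
Proof.
have -> : ord0 = inord 0 :> 'I_n.+1 by apply/val_inj; rewrite /= inordK.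
move=> h h0; split=> // j j0; rewrite -(inord_val j); apply: h => //.
by rewrite lt0n; apply: contraNneq j0 => j0; rewrite -j0 inord_val.
Qed.

Lemma block3_form (k : fieldType) n (f : 'M[k]_n.+1) :
  let W i j := f (inord i) (inord j) in
  (forall i j, (i < n.+1)%N -> (j < n.+1)%N -> (i %/ 3 != j %/ 3)%N -> W i j = 0) ->
  (forall c, ((3 * c).+2 < n.+1)%N -> W (3 * c).+1 (3 * c).+2 = 0) ->
  f = mxl n.+1 n.+1 (mkseq (fun i => mkseq (fun j =>
    if ((i %/ 3 == j %/ 3) && ~~ ((i %% 3 == 1) && (j %% 3 == 2)))%N
    then W i j else 0) n.+1) n.+1).
Proof.
move=> W Wz W12; apply: matrix_inord_eq => i j hi hj.
rewrite mxlE // nth_mkseq // nth_mkseq // -/(W i j).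
case: (eqVneq (i %/ 3) (j %/ 3))%N => [ij|/Wz-> //].
case: ifP => // /negbFE/andP[/eqP i1 /eqP j2]; move: hj.
by rewrite (divn_eq i 3) (divn_eq j 3) i1 j2 -ij addn1 addn2 mulnC; apply: W12.
Qed.

Lemma eigen_neq (k : fieldType) (l m v : k) : l != m -> l * v = v * m -> v = 0.
Proof.
move=> lm /eqP; rewrite [v * m]mulrC -subr_eq0 -mulrBl mulf_eq0 subr_eq0 (negPf lm).
by move/eqP.
Qed.

Lemma third_flag (k : fieldType) (l m u v : k) : l != m ->
  (l - 1) * v = u * (m - 1) -> - l * v = u * - m -> v = 0.
Proof.
move=> lm; rewrite mulrN mulNr => h1 /oppr_inj h2.
have vu : v = u.
  by apply: (addrI ((l - 1) * v)); rewrite {2}h1 mulrBl mul1r subrK h2 mulrBr mulr1 subrK.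
by rewrite -vu in h2; exact: eigen_neq lm h2.
Qed.

Section TwoJordanBlocks.
Variable k : fieldType.

Definition jordan42 : 'M[k]_6 := mxl 6 6
  [:: [:: 0; 1]; [:: 0; 0; 1]; [:: 0; 0; 0; 1]; [::]; [:: 0; 0; 0; 0; 0; 1]; [::]].

Lemma jordan42_nilpotent n : (3 < n)%N -> jordan42 ^+ n = 0.
Proof.
move=> n4; apply: (exprn_eq0_le n4); apply: (@mxl_nilpotent _ _ _ [:: 0; 1; 2; 3; 0; 1]%N) => //.
by move=> [|[|[|[|[|[|//]]]]]] [|[|[|[|[|[|//]]]]]] _ _.
Qed.

(** Rows [0] and [4] are the images of the two generators of the module with Jordan
    blocks of sizes four and two, and they determine all others. *)
Lemma jordan42_commutant (f : 'M[k]_6) : jordan42 *m f = f *m jordan42 ->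
  let W i j := f (inord i) (inord j) in
  f = mxl 6 6 [:: [:: W 0%N 0%N; W 0%N 1%N; W 0%N 2%N; W 0%N 3%N; W 0%N 4%N; W 0%N 5%N];
                  [:: 0; W 0%N 0%N; W 0%N 1%N; W 0%N 2%N; 0; W 0%N 4%N];
                  [:: 0; 0; W 0%N 0%N; W 0%N 1%N; 0; 0];
                  [:: 0; 0; 0; W 0%N 0%N; 0; 0];
                  [:: 0; 0; W 4%N 2%N; W 4%N 3%N; W 4%N 4%N; W 4%N 5%N];
                  [:: 0; 0; 0; W 4%N 2%N; 0; W 4%N 4%N]].
Proof.
move=> H W.
have fE : f = mxl 6 6 (mkseq (fun i => mkseq (W i) 6) 6) by exact: mxl_entries.
clearbody W.
have : forall i j, (i < 6)%N -> (j < 6)%N ->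
   (jordan42 *m f) (inord i) (inord j) = (f *m jordan42) (inord i) (inord j).
  by move=> i j _ _; rewrite H.
rewrite fE /jordan42 => E.
have E' i j (hi : (i < 6)%N) (hj : (j < 6)%N) := E i j hi hj.
have {}E' : forall i j, (i < 6)%N -> (j < 6)%N -> nth 0 [:: W 1%N j; W 2%N j; W 3%N j; 0; W 5%N j; 0] i
   = nth 0 [:: 0; W i 0%N; W i 1%N; W i 2%N; 0; W i 4%N] j.
  move=> i j hi hj; move: (E' i j hi hj); rewrite !mxl_mulE //.
  by move: i j hi hj => [|[|[|[|[|[|//]]]]]] [|[|[|[|[|[|//]]]]]] _ _ /=; simp01.
apply: matrix_inord_eq => i j hi hj; rewrite !mxlE // => {E H fE}.
have W10 := E' 0%N 0%N isT isT; have W14 := E' 0%N 4%N isT isT.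
have W20 := E' 1%N 0%N isT isT; have W24 := E' 1%N 4%N isT isT.
have W30 := E' 2%N 0%N isT isT; have W34 := E' 2%N 4%N isT isT.
have W50 := E' 4%N 0%N isT isT; have W54 := E' 4%N 4%N isT isT.
have W51 := E' 5%N 2%N isT isT; have W52 := E' 5%N 3%N isT isT.
have W40 := E' 4%N 1%N isT isT; have W41 := E' 4%N 2%N isT isT.
rewrite /= in W10 W14 W20 W24 W30 W34 W50 W54 W51 W52 W40 W41.
have E1 j' (h : (j' < 6)%N) := E' 0%N j' isT h.
have E2 j' (h : (j' < 6)%N) := E' 1%N j' isT h.
have E3 j' (h : (j' < 6)%N) := E' 2%N j' isT h.
have E5 j' (h : (j' < 6)%N) := E' 4%N j' isT h.
rewrite /= in E1 E2 E3 E5.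
move: i j hi hj => [|[|[|[|[|[|//]]]]]] [|[|[|[|[|[|//]]]]]] _ _ //=;
 rewrite ?E3 ?E2 ?E1 ?E5 //= ?E2 ?E1 //= ?E1 //= -?W40 -?W41 //.
Qed.

End TwoJordanBlocks.

(** * Representations of a category with two objects *)

Section TwoObjects.
Variables (k : closedFieldType) (C : finEICat) (x y : ob C).
Hypotheses (hxy : x != y) (hob : forall z : ob C, z = x \/ z = y)
  (hyx : #|mor y x| = 0%N).
Variable alpha : mor x y.
Hypothesis htrans : forall a b : mor x y, exists h : endo y, b = ccomp h a.
Local Notation A := (catalg k C).

Lemma no_yx (f : mor y x) : False.
Proof. by have := fintype0 f; apply; exact: hyx. Qed.

Section BlockRep.
Variables (dV dW : nat) (rV : endo x -> 'M[k]_dV) (rW : endo y -> 'M[k]_dW)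
  (rE : mor x y -> 'M[k]_(dV, dW)).

Definition block_rep (m : allmor C) : 'M[k]_(dV + dW) :=
  \sum_(g : mor x x) (m == Mor g)%:R *: block_mx (rV g) 0 0 0
  + \sum_(h : mor y y) (m == Mor h)%:R *: block_mx 0 0 0 (rW h)
  + \sum_(f : mor x y) (m == Mor f)%:R *: block_mx 0 (rE f) 0 0.

Lemma Mor_neq (z w z' w' : ob C) (f : mor z w) (g : mor z' w') :
  (z != z') || (w != w') -> (Mor f == Mor g) = false.
Proof.
move=> ne; apply/eqP => e.
have e1 : z = z' := congr1 (fun m => (tag m).1) e.
have e2 : w = w' := congr1 (fun m => (tag m).2) e.
by rewrite e1 e2 !eqxx in ne.
Qed.

Lemma big_Mor (d : nat) (z w : ob C) (F : mor z w -> 'M[k]_d) (f : mor z w) :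
  \sum_(g : mor z w) (Mor f == Mor g)%:R *: F g = F f.
Proof.
rewrite (bigD1 f) //= eqxx scale1r big1 ?addr0 // => g gf.
by rewrite (inj_eq (@Mor_inj _ _ _)) eq_sym (negPf gf) scale0r.
Qed.

Lemma big_Mor0 (d : nat) (z w z' w' : ob C) (F : mor z w -> 'M[k]_d)
  (f : mor z' w') : (z' != z) || (w' != w) ->
  \sum_(g : mor z w) (Mor f == Mor g)%:R *: F g = 0.
Proof. by move=> ne; rewrite big1 // => g _; rewrite Mor_neq // scale0r. Qed.

Lemma block_repx (g : endo x) : block_rep (Mor (g : mor x x)) = block_mx (rV g) 0 0 0.
Proof.
rewrite /block_rep (@big_Mor _ x x).
by rewrite !big_Mor0 ?addr0 ?hxy ?orbT.
Qed.

Lemma block_repy (h : endo y) : block_rep (Mor (h : mor y y)) = block_mx 0 0 0 (rW h).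
Proof.
rewrite /block_rep (@big_Mor _ y y).
by rewrite !big_Mor0 ?addr0 ?add0r // eq_sym hxy.
Qed.

Lemma block_repxy (f : mor x y) : block_rep (Mor f) = block_mx 0 (rE f) 0 0.
Proof.
rewrite /block_rep big_Mor.
by rewrite !big_Mor0 ?add0r // ?hxy // eq_sym hxy ?orbT.
Qed.

Lemma block_rep_is_rep :
  rV 1%g = 1%:M -> rW 1%g = 1%:M ->
  (forall g g' : endo x, rV g *m rV g' = rV (g' * g)%g) ->
  (forall h h' : endo y, rW h *m rW h' = rW (h' * h)%g) ->
  (forall (g : endo x) (f : mor x y), rV g *m rE f = rE (ccomp f g)) ->
  (forall (f : mor x y) (h : endo y), rE f *m rW h = rE (ccomp h f)) ->
  is_rep block_rep.
Proof.
move=> V1 W1 VM WM VE EW; split.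
- rewrite (bigD1 x) //= (bigD1 y) 1?eq_sym //= big1 ?addr0.
    rewrite (block_repx 1%g) (block_repy 1%g) V1 W1 add_block_mx !addr0 add0r.
    by rewrite -scalar_mx_block.
  by move=> z /andP[zx zy]; case: (hob z) => e; rewrite e eqxx in zx zy.
- move=> a b c f g.
  case: (hob a) => ea; case: (hob b) => eb; case: (hob c) => ec; subst a b c;
    try (by case: (no_yx f)); try (by case: (no_yx g)).
  + rewrite (block_repx f) (block_repx g) mulmx_block !mul0mx !mulmx0 !addr0.
    by rewrite VM (block_repx (ccomp g f)).
  + rewrite (block_repx f) (block_repxy g) mulmx_block !mul0mx !mulmx0 !addr0.
    by rewrite VE block_repxy.
  + rewrite (block_repy g) (block_repxy f) mulmx_block !mul0mx !mulmx0 !add0r.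
    by rewrite EW block_repxy.
  + rewrite (block_repy f) (block_repy g) mulmx_block !mul0mx !mulmx0 !add0r.
    by rewrite WM (block_repy (ccomp g f)).
- move=> a b b' c f g.
  case: (hob a) => ea; case: (hob b) => eb; case: (hob b') => eb'; case: (hob c) => ec;
    subst a b b' c; rewrite ?eqxx // => _;
    try (by case: (no_yx f)); try (by case: (no_yx g)).
  + by rewrite (block_repx f) (block_repy g) mulmx_block !mul0mx !mulmx0 !addr0 block_mx0.
  + by rewrite block_repxy (block_repx g) mulmx_block !mul0mx !mulmx0 !addr0 block_mx0.
  + by rewrite !block_repxy mulmx_block !mul0mx !mulmx0 !addr0 block_mx0.
  + by rewrite (block_repy f) (block_repx g) mulmx_block !mul0mx !mulmx0 !addr0 block_mx0.
  + by rewrite (block_repy f) block_repxy mulmx_block !mul0mx !mulmx0 !addr0 block_mx0.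
Qed.

End BlockRep.

(** A representation amounts to one of [endo x], one of [endo y] and the matrix
    [e] of [alpha]; compatibility with the pairs such that
    [ccomp h alpha = ccomp alpha g] makes the choice of [h] in [f = ccomp h alpha]
    irrelevant. The invariant of a map is one diagonal entry
    of its component at [x]. *)
Lemma infinite_rep_type_blocks (dV dW : nat) (i0 : 'I_dV)
  (rV : endo x -> 'M[k]_dV) (rW : endo y -> 'M[k]_dW) (e : k -> 'M[k]_(dV, dW)) :
  rV 1%g = 1%:M -> rW 1%g = 1%:M ->
  (forall g g' : endo x, rV g *m rV g' = rV (g' * g)%g) ->
  (forall h h' : endo y, rW h *m rW h' = rW (h' * h)%g) ->
  (forall l (h : endo y) (g : endo x), ccomp h alpha = ccomp alpha g ->
     e l *m rW h = rV g *m e l) ->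
  (forall l m fV fW, (forall g, rV g *m fV = fV *m rV g) ->
     (forall h, rW h *m fW = fW *m rW h) -> e l *m fW = fV *m e m ->
     (forall j, j != i0 -> fV j i0 = 0) /\ (l != m -> fV i0 i0 = 0)) ->
  ~ finite_rep_type A.
Proof.
move=> V1 W1 VM WM compat hom.
have exh f : exists h : endo y, f == ccomp h alpha.
  by have [h ->] := htrans alpha f; exists h.
pose hf f := xchoose (exh f).
have hfE f : f = ccomp (hf f) alpha by exact/eqP/(xchooseP (exh f)).
pose rE l f := e l *m rW (hf f).
have key l f (h : endo y) : f = ccomp h alpha -> rE l f = e l *m rW h.
  move=> fh; have := compat l ((hf f)^-1 * h)%g 1%g.
  have -> : ccomp ((hf f)^-1 * h)%g alpha = ccomp alpha (1%g : endo x).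
    transitivity (ccomp ((hf f)^-1 : endo y)%g (ccomp h alpha)).
      by rewrite ccompA.
    rewrite -fh {2}(hfE f) ccompA ccomp_idr.
    transitivity (ccomp ((hf f)^-1 * hf f)%g alpha) => //.
    by rewrite mulVg ccomp_idl.
  move=> /(_ erefl); rewrite V1 mul1mx -WM => e1.
  by rewrite /rE -{1}e1 -!mulmxA WM mulgV W1 mulmx1.
have rEa l : rE l alpha = e l.
  by rewrite (key l alpha 1%g) ?W1 ?mulmx1 ?ccomp_idl.
have VE l (g : endo x) f : rV g *m rE l f = rE l (ccomp f g).
  have [h' ah'] := htrans alpha (ccomp alpha g).
  rewrite (key l (ccomp f g) (hf f * h')%g); last first.
    transitivity (ccomp (hf f) (ccomp alpha g)); first by rewrite ccompA -hfE.
    by rewrite ah' ccompA.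
  by rewrite mulmxA -(compat _ h') // -mulmxA WM.
have EW l f (h : endo y) : rE l f *m rW h = rE l (ccomp h f).
  rewrite (key l (ccomp h f) (h * hf f)%g) -?WM ?mulmxA //.
  by rewrite {1}(hfE f) ccompA.
pose R l := block_rep rV rW (rE l).
have hR l : is_rep (R l) by apply: block_rep_is_rep.
have blk l m f : intertwines (R l) (R m) f -> exists fV fW,
   [/\ f = block_mx fV 0 0 fW, (forall g, rV g *m fV = fV *m rV g),
      (forall h, rW h *m fW = fW *m rW h) & e l *m fW = fV *m e m].
  move=> hf'; exists (ulsubmx f), (drsubmx f).
  have fE : f = block_mx (ulsubmx f) 0 0 (drsubmx f).
    have := hf' (Mor (1%g : endo x)); rewrite /R !block_repx V1.
    rewrite -{1 2}[f]submxK !mulmx_block !mul0mx !mulmx0 !mul1mx !mulmx1 !addr0.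
    by move=> /eq_block_mx[_ u d _]; rewrite -{1}[f]submxK u -d.
  split=> //.
  - move=> g; have := hf' (Mor (g : mor x x)); rewrite /R !block_repx.
    rewrite {1 2}fE !mulmx_block !mul0mx !mulmx0 !addr0.
    by move=> /eq_block_mx[].
  - move=> h; have := hf' (Mor (h : mor y y)); rewrite /R !block_repy.
    rewrite {1 2}fE !mulmx_block !mul0mx !mulmx0 !add0r.
    by move=> /eq_block_mx[].
  - have := hf' (Mor alpha); rewrite /R !block_repxy.
    rewrite {1 2}fE !mulmx_block !mul0mx !mulmx0 !add0r !addr0.
    by rewrite !rEa => /eq_block_mx[].
pose kappa (f : 'M[k]_(dV + dW)) := f (lshift dW i0) (lshift dW i0).
apply: (infinite_rep_type_criterion (kappa := kappa) hR).
- by move=> f g; rewrite /kappa mxE.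
- by rewrite /kappa mxE eqxx oner_neq0.
- move=> l m n f g /blk[fV [fW [-> _ _ _]]] /blk[gV [gW [-> gv gw ge]]].
  rewrite /kappa mulmx_block !mul0mx !addr0 !block_mxEul mxE.
  rewrite (bigD1 i0) //= big1 ?addr0 // => j ji.
  by have [h0 _] := hom _ _ _ _ gv gw ge; rewrite h0 // mulr0.
- move=> l m f lm /blk[fV [fW [-> fv fw fe]]].
  by rewrite /kappa block_mxEul; have [_ ->] := hom _ _ _ _ fv fw fe.
Qed.

(** * Families from characters and unipotent operators *)

(** Here [endo y] acts on the coordinates of the second space through the
    characters [psi], twisted by a unipotent matrix. Distinct characters force a
    map to respect the grading by characters, and the remaining conditions say
    that it commutes with the nilpotent parts and with the matrix of [alpha]. *)
Lemma infinite_rep_type_star (dV dW r qx qy : nat) (a : 'M[k]_dV.+1) (b : 'M[k]_dW.+1)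
  (thx : endo x -> nat) (thy : endo y -> nat) (cls : 'I_dW.+1 -> 'I_r)
  (psi : 'I_r -> endo y -> k) (e : k -> 'M[k]_(dV.+1, dW.+1)) (i0 : 'I_dV.+1) :
  (1 + a) ^+ qx = 1 -> (1 + b) ^+ qy = 1 ->
  (forall g h : endo x, thx (g * h)%g = thx g + thx h %[mod qx])%N ->
  (forall g h : endo y, thy (g * h)%g = thy g + thy h %[mod qy])%N ->
  (exists g, thx g = 1 %[mod qx])%N -> (exists h, thy h = 1 %[mod qy])%N ->
  (forall i j, cls i != cls j -> b i j = 0) ->
  (forall c, psi c 1%g = 1) -> (forall c (g h : endo y), psi c (g * h)%g = psi c g * psi c h) ->
  (forall c (h : endo y) (g : endo x), ccomp h alpha = ccomp alpha g -> psi c h = 1) ->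
  (forall c c', c != c' -> exists h : endo y, psi c (h ^+ qy)%g != psi c' (h ^+ qy)%g) ->
  (forall l, a *m e l = 0) -> (forall l, e l *m b = 0) ->
  (forall l m fV fW, a *m fV = fV *m a -> b *m fW = fW *m b ->
     (forall i j, cls i != cls j -> fW i j = 0) -> e l *m fW = fV *m e m ->
     (forall j, j != i0 -> fV j i0 = 0) /\ (l != m -> fV i0 i0 = 0)) ->
  ~ finite_rep_type A.
Proof.
move=> aq bq thxM thyM [g1 hg1] [h1 hh1] bcls psi1 psiM psiH1 psisep ae eb hom.
pose D h : 'M[k]_dW.+1 := diag_mx (\row_i psi (cls i) h).
have DM g h : D g *m D h = D (g * h)%g.
  rewrite mulmx_diag; congr diag_mx; apply/rowP => i; by rewrite !mxE psiM.
have Dcomm h (M : 'M_dW.+1) : (forall i j, cls i != cls j -> M i j = 0) ->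
    D h *m M = M *m D h.
  move=> Mcls; rewrite mul_diag_mx mul_mx_diag; apply/matrixP => i j; rewrite !mxE.
  case: (eqVneq (cls i) (cls j)) => [->|ne]; first by rewrite mulrC.
  by rewrite Mcls // mulr0 mul0r.
have D1 : D 1%g = 1%:M by apply/matrixP => i j; rewrite !mxE psi1.
have DbX h i : D h *m (1 + b) ^+ i = (1 + b) ^+ i *m D h.
  apply: (@commrX _ (D h) (1 + b) i); apply: commrD; first exact: commr1.
  exact: (Dcomm h b bcls).
have DC g h : D (g * h)%g = D (h * g)%g.
  by congr diag_mx; apply/rowP => i; rewrite !mxE !psiM mulrC.
apply: (@infinite_rep_type_blocks _ _ i0
  (fun g => (1 + a) ^+ thx g) (fun h => D h *m (1 + b) ^+ thy h) e).
- by rewrite (unipotent_congr aq (additive_mod_id thxM)).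
- by rewrite (unipotent_congr bq (additive_mod_id thyM)) D1 mul1mx.
- exact: (unipotentM aq thxM).
- move=> h h'; rewrite mulmxA -(mulmxA (D h)) -DbX mulmxA DM DC -mulmxA.
  by rewrite (unipotentM bq thyM).
- move=> l h g hg; rewrite unipotent_fixl //.
  have -> : D h = 1%:M by apply/matrixP => i j; rewrite !mxE (psiH1 _ _ _ hg).
  by rewrite mul1mx unipotent_fix.
- move=> l m fV fW hV hW hE.
  (* The powers [h ^+ qy] act through the characters alone, and still separate
     them. *)
  have Wcls i j : cls i != cls j -> fW i j = 0.
    move=> /psisep[h hne]; have := hW (h ^+ qy)%g.
    rewrite (unipotent_congr bq (j := 0)) ?expr0 ?mulmx1; last first.
      by rewrite (additive_modX thyM) modnMr mod0n.
    move=> /matrixP/(_ i j); rewrite mul_diag_mx mul_mx_diag !mxE mulrC.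
    move/eqP; rewrite -subr_eq0 -mulrBr mulf_eq0 subr_eq0 (negPf hne) orbF.
    by move/eqP.
  apply: (hom l m fV fW) => //; first exact: (unipotent_comm_inv aq hg1).
  apply: (unipotent_comm_inv bq hh1).
  have DV : D h1^-1%g *m D h1 = 1%:M by rewrite DM mulVg D1.
  have := congr1 (mulmx (D h1^-1%g)) (hW h1).
  rewrite !mulmxA DV mul1mx => ->.
  by rewrite (Dcomm h1^-1%g fW) // -(mulmxA fW) DV mulmx1.
Qed.

(** * Lines and flags with a parameter *)

(** Distinct characters of the quotient of [endo y] by the stabilizer of the orbit
    of [alpha], whose elements are the [h] with [ccomp h alpha = ccomp alpha g] for
    some [g]. *)
Definition character_system (r : nat) (psi : 'I_r -> endo y -> k) : Prop :=
  [/\ forall c, psi c 1%g = 1,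
      forall c (g h : endo y), psi c (g * h)%g = psi c g * psi c h,
      forall c (h : endo y) (g : endo x), ccomp h alpha = ccomp alpha g -> psi c h = 1
    & forall c c', c != c' -> exists h, psi c h != psi c' h].

(** A homomorphism onto the cyclic group of order [q], through representatives of
    its values. *)
Definition additive_mod (q : nat) (z : ob C) (th : endo z -> nat) : Prop :=
  (forall g h : endo z, th (g * h)%g = th g + th h %[mod q])%N /\
  (exists g, th g = 1 %[mod q])%N.

Lemma character_systemX r psi (c : 'I_r) (h : endo y) n :
  character_system psi -> psi c (h ^+ n)%g = psi c h ^+ n.
Proof.
move=> [p1 pM _ _]; elim: n => [|n IH]; first by rewrite expg0 expr0 p1.
by rewrite expgS exprS pM IH.
Qed.

(** The Frobenius map is injective, so that characters are still told apart by
    their [p]-th powers, on which a unipotent operator of order [p] has no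
    effect. *)
Lemma character_system_sep r psi p : @character_system r psi -> p \in [pchar k] ->
  forall c c', c != c' -> exists h : endo y, psi c (h ^+ p)%g != psi c' (h ^+ p)%g.
Proof.
move=> psiS pk c c' ne; have [_ _ _ sep] := psiS.
have [h hne] := sep c c' ne; exists h.
rewrite !(character_systemX _ _ _ psiS) -!(pFrobenius_autE pk).
by rewrite (inj_eq (fmorph_inj _)).
Qed.

Lemma additive_mod1 (z : ob C) : @additive_mod 1 z (fun=> 0%N).
Proof. by split=> [g h|]; [rewrite modn1|exists 1%g; rewrite !modn1]. Qed.

(** Four lines in a plane with varying cross ratio. *)
Lemma infinite_four_characters (psi : 'I_4 -> endo y -> k) :
  character_system psi -> ~ finite_rep_type A.
Proof.
move=> psiS; have [psi1 psiM psiH psiN] := psiS.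
have [th1 th1'] := additive_mod1 x; have [ty1 ty1'] := additive_mod1 y.
pose e (l : k) : 'M[k]_(2, 4) := mxl 2 4 [:: [:: 1; 0; 1; 1]; [:: 0; 1; 1; l]].
apply: (@infinite_rep_type_star 1 3 4 1 1 0 0
  _ _ id psi e ord0 _ _ th1 ty1 th1' ty1') => //.
- by rewrite addr0 expr1n.
- by rewrite addr0 expr1n.
- by move=> i j _; rewrite mxE.
- by move=> l; rewrite mul0mx.
- by move=> l; rewrite mulmx0.
move=> l m fV fW _ _ Wz hE.
pose W i := fW (inord i) (inord i); pose V i j := fV (inord i) (inord j).
have fWE : fW = mxl 4 4 [:: [:: W 0%N]; [:: 0; W 1%N]; [:: 0; 0; W 2%N]; [:: 0; 0; 0; W 3%N]].
  apply: matrix_inord_eq => i j hi hj; rewrite mxlE //.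
  case: (eqVneq i j) => [<-|ij].
    by move: i hi {hj} => [|[|[|[|//]]]] _.
  rewrite Wz; last by rewrite -val_eqE /= !inordK.
  by move: i j hi hj ij => [|[|[|[|//]]]] [|[|[|[|//]]]].
have fVE : fV = mxl 2 2 [:: [:: V 0 0; V 0 1]; [:: V 1 0; V 1 1]]%N.
  exact: mxl_entries.
rewrite fWE fVE in hE.
entry hE 0%N 0%N => e00; entry hE 1%N 0%N => e10; entry hE 0%N 1%N => e01.
entry hE 1%N 1%N => e11; entry hE 0%N 2%N => e02; entry hE 1%N 2%N => e12.
entry hE 0%N 3%N => e03; entry hE 1%N 3%N => e13.
rewrite -e10 -e01 ?(add0r, addr0, mul0r) in e02 e12 e03 e13.
apply: block_conclusion => [[|[|//]] _ _ //|lm].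
move: e13; rewrite -e12 e02 e03 => lE.
exact: eigen_neq lm lE.
Qed.

(** Four lines again, in the plane obtained from a space of dimension three by
    dividing out the image of an operator [a] of square zero: three of them are the
    kernels of the maps to the three characters, and the fourth is the image of
    the kernel of [a]. *)
Lemma infinite_three_characters_left p (psi : 'I_3 -> endo y -> k)
  (th : endo x -> nat) :
  p \in [pchar k] -> character_system psi -> additive_mod p th ->
  ~ finite_rep_type A.
Proof.
move=> pk psiS [thM th1]; have [psi1 psiM psiH psiN] := psiS.
have [ty1 ty1'] := additive_mod1 y.
pose a : 'M[k]_3 := mxl 3 3 [:: [::]; [:: 0; 0; 1]; [::]].
pose e (l : k) : 'M[k]_3 := mxl 3 3 [:: [:: 1; 1; 1]; [:: 0; 1; l]; [::]].
have a2 : a ^+ 2 = 0.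
  apply: (@mxl_nilpotent _ _ _ [:: 0; 0; 1]%N) => //.
  by move=> [|[|[|//]]] [|[|[|//]]] _ _ //.
have ap := exprn_eq0_le (prime_gt1 (pcharf_prime pk)) a2.
apply: (@infinite_rep_type_star 2 2 3 p 1 a 0
  _ _ id psi e ord0 _ _ thM ty1 th1 ty1') => //.
- exact: unipotent_pchar.
- by rewrite addr0 expr1n.
- by move=> i j _; rewrite mxE.
- move=> l; apply: matrix_inord_eq => i j hi hj; rewrite mxl_mulE // mxE.
  by move: i j hi hj => [|[|[|//]]] [|[|[|//]]] _ _ /=; simp01.
- by move=> l; rewrite mulmx0.
move=> l m fV fW aV _ Wz hE.
pose W i := fW (inord i) (inord i); pose V i j := fV (inord i) (inord j).
have fWE : fW = mxl 3 3 [:: [:: W 0%N]; [:: 0; W 1%N]; [:: 0; 0; W 2%N]].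
  apply: matrix_inord_eq => i j hi hj; rewrite mxlE //.
  case: (eqVneq i j) => [<-|ij].
    by move: i hi {hj} => [|[|[|//]]] _.
  rewrite Wz; last by rewrite -val_eqE /= !inordK.
  by move: i j hi hj ij => [|[|[|//]]] [|[|[|//]]].
have fVE := mxl_entries fV; rewrite -/V in fVE.
rewrite fVE in aV hE; rewrite fWE in hE.
entry aV 0%N 2%N => v01; entry aV 1%N 0%N => v20.
entry hE 0%N 0%N => e00; entry hE 1%N 0%N => e10; entry hE 0%N 1%N => e01.
entry hE 1%N 1%N => e11; entry hE 0%N 2%N => e02; entry hE 1%N 2%N => e12.
rewrite -?v01 -?e10 ?(add0r, addr0, mul0r) in e01 e11 e02 e12.
apply: block_conclusion => [[|[|[|//]]] _ _ //|lm].
move: e12; rewrite -e11 e01 e02 => lE.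
exact: eigen_neq lm lE.
Qed.

(** Three flags, each a line inside a plane, in a three-dimensional space: two
    of them opposite, the third one with a fixed line in a varying plane. For each
    character the line is the kernel of the map to its eigenspace, and the plane
    is the preimage of the image of [b]. *)
Lemma infinite_three_characters_right p (psi : 'I_3 -> endo y -> k)
  (th : endo y -> nat) :
  p \in [pchar k] -> character_system psi -> additive_mod p th ->
  ~ finite_rep_type A.
Proof.
move=> pk psiS [thM th1]; have [psi1 psiM psiH psiN] := psiS.
have [tx1 tx1'] := additive_mod1 x.
pose b : 'M[k]_9 := mxl 9 9 [:: [:: 0; 1]; [::]; [::]; [:: 0; 0; 0; 0; 1]; [::];
  [::]; [:: 0; 0; 0; 0; 0; 0; 0; 1]; [::]; [::]].
pose e (l : k) : 'M[k]_(3, 9) := mxl 3 9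
  [:: [:: 0; 0; 0; 0; 0; 1; 0; 0; 1];
      [:: 0; 1; 0; 0; 1; 0; 0; 1; l - 1];
      [:: 0; 0; 1; 0; 0; 0; 0; - 1; - l]].
pose cls (i : 'I_9) : 'I_3 := inord (i %/ 3).
have clsE i j : (i < 9)%N -> (j < 9)%N ->
    (cls (inord i) != cls (inord j)) = (i %/ 3 != j %/ 3)%N.
  by move=> hi hj; rewrite -val_eqE /= !inordK // ltn_divLR.
have b2 : b ^+ 2 = 0.
  apply: (@mxl_nilpotent _ _ _ [:: 0; 1; 1; 0; 1; 1; 0; 1; 1]%N) => //.
  by move=> [|[|[|[|[|[|[|[|[|//]]]]]]]]] [|[|[|[|[|[|[|[|[|//]]]]]]]]] _ _.
have bp := exprn_eq0_le (prime_gt1 (pcharf_prime pk)) b2.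
apply: (@infinite_rep_type_star 2 8 3 1 p 0 b
  _ _ cls psi e ord0 _ _ tx1 thM tx1' th1) => //.
- by rewrite addr0 expr1n.
- exact: unipotent_pchar.
- move=> i j; rewrite -(inord_val i) -(inord_val j) clsE //.
  rewrite mxlE //; move: (val i) (val j) (ltn_ord i) (ltn_ord j) => {i j}.
  by move=> [|[|[|[|[|[|[|[|[|//]]]]]]]]] [|[|[|[|[|[|[|[|[|//]]]]]]]]] _ _.
- exact: character_system_sep.
- by move=> l; rewrite mul0mx.
- move=> l; apply: matrix_inord_eq => i j hi hj; rewrite mxl_mulE // mxE.
  by move: i j hi hj => [|[|[|//]]] [|[|[|[|[|[|[|[|[|//]]]]]]]]] _ _ /=; simp01.
move=> l m fV fW _ bW Wcls hE.
pose W i j := fW (inord i) (inord j); pose V i j := fV (inord i) (inord j).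
have fWE := mxl_entries fW; rewrite -/W in fWE.
have Wz i j : (i < 9)%N -> (j < 9)%N -> (i %/ 3 != j %/ 3)%N -> W i j = 0.
  by move=> hi hj ij; apply: Wcls; rewrite clsE.
have W12 c : ((3 * c).+2 < 9)%N -> W (3 * c).+1 (3 * c).+2 = 0.
  rewrite fWE in bW; case: c => [|[|[|c]]]; last by rewrite !mulnS.
  + by move=> _; entry bW 0%N 2%N.
  + by move=> _; entry bW 3%N 5%N.
  + by move=> _; entry bW 6%N 8%N.
have fWE' := block3_form Wz W12; rewrite -/W in fWE'.
have fVE := mxl_entries fV; rewrite -/V in fVE.
rewrite fVE fWE' in hE.
entry hE 0%N 2%N => a0; entry hE 1%N 2%N => a1.
entry hE 0%N 1%N => a2; entry hE 1%N 1%N => a3; entry hE 2%N 1%N => a4.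
entry hE 1%N 5%N => b1; entry hE 2%N 5%N => b2'.
entry hE 1%N 4%N => b3; entry hE 2%N 4%N => b4.
entry hE 0%N 7%N => c0; entry hE 1%N 7%N => c1; entry hE 2%N 7%N => c2.
entry hE 0%N 8%N => d0; entry hE 1%N 8%N => d1; entry hE 2%N 8%N => d2.
rewrite -?a0 -?a1 -?a2 -?b1 -?b2' -?b4 ?(add0r, addr0, mul0r, subr0, oppr0, sub0r) in c0 c1 c2 d0 d1 d2.
rewrite c0 !mulr0 !addr0 in c1 c2.
apply: block_conclusion => [[|[|[|//]]] _ _ //|lm].
move: d1 d2; rewrite d0 -(oppr_inj c2) -c1.
exact: third_flag.
Qed.

(** Three flags again. The first one is now the filtration by the kernels of the
    powers of an operator [a] at [x] with Jordan blocks of sizes one, two and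
    three, on the space modulo the image of [a]; the block of size three
    is the reason for [2 < p]. *)
Lemma infinite_two_characters p (psi : 'I_2 -> endo y -> k)
  (thx : endo x -> nat) (thy : endo y -> nat) :
  p \in [pchar k] -> (2 < p)%N -> character_system psi ->
  additive_mod p thx -> additive_mod p thy -> ~ finite_rep_type A.
Proof.
move=> pk p2 psiS [txM tx1] [tyM ty1]; have [psi1 psiM psiH psiN] := psiS.
pose a : 'M[k]_6 := mxl 6 6 [:: [::]; [:: 0; 0; 0; 1]; [:: 0; 0; 0; 0; 1];
  [::]; [:: 0; 0; 0; 0; 0; 1]; [::]].
pose b : 'M[k]_6 := mxl 6 6 [:: [:: 0; 1]; [::]; [::]; [:: 0; 0; 0; 0; 1]; [::]; [::]].
pose e (l : k) : 'M[k]_6 := mxl 6 6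
  [:: [:: 0; 0; 1; 0; 0; 1]; [:: 0; 1; 0; 0; 1; l - 1]; [:: 0; 0; 0; 0; - 1; - l];
      [::]; [::]; [::]].
pose cls (i : 'I_6) : 'I_2 := inord (i %/ 3).
have clsE i j : (i < 6)%N -> (j < 6)%N ->
    (cls (inord i) != cls (inord j)) = (i %/ 3 != j %/ 3)%N.
  by move=> hi hj; rewrite -val_eqE /= !inordK // ltn_divLR.
have a3 : a ^+ 3 = 0.
  apply: (@mxl_nilpotent _ _ _ [:: 0; 0; 0; 1; 1; 2]%N) => //.
  by move=> [|[|[|[|[|[|//]]]]]] [|[|[|[|[|[|//]]]]]] _ _.
have b2 : b ^+ 2 = 0.
  apply: (@mxl_nilpotent _ _ _ [:: 0; 1; 1; 0; 1; 1]%N) => //.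
  by move=> [|[|[|[|[|[|//]]]]]] [|[|[|[|[|[|//]]]]]] _ _.
have ap := exprn_eq0_le p2 a3; have bp := exprn_eq0_le (ltnW p2) b2.
apply: (@infinite_rep_type_star 5 5 2 p p a b
  _ _ cls psi e ord0 _ _ txM tyM tx1 ty1) => //.
- exact: unipotent_pchar.
- exact: unipotent_pchar.
- move=> i j; rewrite -(inord_val i) -(inord_val j) clsE //.
  rewrite mxlE //; move: (val i) (val j) (ltn_ord i) (ltn_ord j) => {i j}.
  by move=> [|[|[|[|[|[|//]]]]]] [|[|[|[|[|[|//]]]]]] _ _.
- exact: character_system_sep.
- move=> l; apply: matrix_inord_eq => i j hi hj; rewrite mxl_mulE // mxE.
  by move: i j hi hj => [|[|[|[|[|[|//]]]]]] [|[|[|[|[|[|//]]]]]] _ _ /=; simp01.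
- move=> l; apply: matrix_inord_eq => i j hi hj; rewrite mxl_mulE // mxE.
  by move: i j hi hj => [|[|[|[|[|[|//]]]]]] [|[|[|[|[|[|//]]]]]] _ _ /=; simp01.
move=> l m fV fW aV bW Wcls hE.
pose W i j := fW (inord i) (inord j); pose V i j := fV (inord i) (inord j).
have fWE := mxl_entries fW; rewrite -/W in fWE.
have fVE := mxl_entries fV; rewrite -/V in fVE.
have Wz i j : (i < 6)%N -> (j < 6)%N -> (i %/ 3 != j %/ 3)%N -> W i j = 0.
  by move=> hi hj ij; apply: Wcls; rewrite clsE.
have W12 c : ((3 * c).+2 < 6)%N -> W (3 * c).+1 (3 * c).+2 = 0.
  rewrite fWE in bW; case: c => [|[|c]]; last by rewrite !mulnS.
  + by move=> _; entry bW 0%N 2%N.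
  + by move=> _; entry bW 3%N 5%N.
have fWE' := block3_form Wz W12; rewrite -/W in fWE'.
rewrite fVE in aV hE; rewrite fWE' in hE.
entry aV 0%N 3%N => v01; entry aV 0%N 4%N => v02.
entry aV 1%N 4%N => v34; entry aV 3%N 5%N => v34'.
entry aV 1%N 0%N => v30; entry aV 2%N 0%N => v40; entry aV 4%N 0%N => v50.
entry hE 1%N 2%N => b1; entry hE 2%N 2%N => b2'; entry hE 2%N 1%N => b4.
entry hE 0%N 4%N => c0; entry hE 1%N 4%N => c1; entry hE 2%N 4%N => c2.
entry hE 0%N 5%N => d0; entry hE 1%N 5%N => d1; entry hE 2%N 5%N => d2.
rewrite v34 in v34'.
rewrite -?b1 -?b2' -?b4 -?v01 -?v02 -?v34' ?(add0r, addr0, mul0r, subr0, oppr0, sub0r)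
  in c0 c1 c2 d0 d1 d2.
rewrite c0 !mulr0 !addr0 in c1 c2.
apply: block_conclusion => [[|[|[|[|[|[|//]]]]]] _ _ //|lm].
move: d1 d2; rewrite d0 -(oppr_inj c2) -c1.
exact: third_flag.
Qed.

(** * Families from a nontrivial action of elements of order p *)

(** A map [z0 |-> p b + q], [z1 |-> p b ^ 2 + l q b] into the module with Jordan
    blocks [p, p b, p b ^ 2, p b ^ 3] and [q, q b]: the degrees of the two blocks
    are shifted by one, so that the plane spanned by [p b] and [q], identified by
    [b] with the one spanned by [p b ^ 2] and [q b], contains four lines: the image
    of [b], the kernel of [b ^ 2], and the two lines spanned by the images of
    [z0] and [z1]. *)
Lemma infinite_invariant_lines p (th : endo y -> nat) :
  p \in [pchar k] -> (3 < p)%N -> additive_mod p th ->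
  (forall (h : endo y) (g : endo x), ccomp h alpha = ccomp alpha g ->
     th h = 0 %[mod p])%N ->
  ~ finite_rep_type A.
Proof.
move=> pk p4 [thM [h1 th1]] thK.
have bq := unipotent_pchar pk (jordan42_nilpotent k p4).
pose e (l : k) : 'M[k]_(2, 6) := mxl 2 6 [:: [:: 0; 1; 0; 0; 1]; [:: 0; 0; 1; 0; 0; l]].
have th0 : (th 1%g = 0 %[mod p])%N by apply: (thK _ 1%g); rewrite ccomp_idl ccomp_idr.
apply: (@infinite_rep_type_blocks 2 6 ord0
  (fun _ => 1%:M) (fun h => (1 + jordan42 k) ^+ th h) e) => //.
- by rewrite (unipotent_congr bq th0).
- by move=> g g'; rewrite mul1mx.
- exact: (unipotentM bq thM).
- move=> l h g hg; rewrite (unipotent_congr bq (thK h g hg)) expr0 mul1mx.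
  exact: mulmx1.
move=> l m fV fW _ hW hE.
have {hW} bW := unipotent_comm_inv bq th1 (hW h1).
have /= := jordan42_commutant bW; move=> fWE.
pose V i j := fV (inord i) (inord j).
have fVE : fV = mxl 2 2 (mkseq (fun i => mkseq (V i) 2) 2) by exact: mxl_entries.
rewrite fWE fVE in hE.
entry hE 0%N 1%N => e01; entry hE 0%N 4%N => e04; entry hE 1%N 1%N => e11.
entry hE 1%N 2%N => e12; entry hE 1%N 5%N => e15.
apply: block_conclusion => [[|[|//]] _ _ //|lm].
have lE : l * V 0 0 = V 0 0 * m by rewrite -{1}e04 e15 -e12 e01.
exact: eigen_neq lm lE.
Qed.

(** The map of [alpha] must now commute with the nilpotent operators at [x] and
    [y]. The same four lines occur for the module with Jordan blocks of sizes four
    and two at both objects: the images of its generators take the place of those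
    of [z0] and [z1]. *)
Lemma infinite_equivariant_maps p (thx : endo x -> nat) (th : endo y -> nat) :
  p \in [pchar k] -> (3 < p)%N -> additive_mod p thx -> additive_mod p th ->
  (forall (h : endo y) (g : endo x), ccomp h alpha = ccomp alpha g ->
     th h = thx g %[mod p])%N ->
  ~ finite_rep_type A.
Proof.
move=> pk p4 [txM [g1 tx1]] [thM [h1 th1]] thK.
have bq := unipotent_pchar pk (jordan42_nilpotent k p4).
pose e (l : k) : 'M[k]_6 := mxl 6 6
  [:: [:: 0; 1; 0; 0; 1]; [:: 0; 0; 1; 0; 0; 1]; [:: 0; 0; 0; 1]; [::];
      [:: 0; 0; 1; 0; 0; l]; [:: 0; 0; 0; 1]].
have ebe l : jordan42 k *m e l = e l *m jordan42 k.
  apply: matrix_inord_eq => i j hi hj; rewrite !mxl_mulE //.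
  by move: i j hi hj => [|[|[|[|[|[|//]]]]]] [|[|[|[|[|[|//]]]]]] _ _ /=; simp01.
have eX l i : (1 + jordan42 k) ^+ i *m e l = e l *m (1 + jordan42 k) ^+ i.
  elim: i => [|i IH]; first by rewrite !expr0 mul1mx; exact: esym (mulmx1 _).
  rewrite exprS -[_ * _]/(_ *m _) -mulmxA IH !mulmxA; congr (_ *m _).
  by rewrite mulmxDl mulmxDr mul1mx mulmx1 ebe.
apply: (@infinite_rep_type_blocks 6 6 ord0
  (fun g => (1 + jordan42 k) ^+ thx g) (fun h => (1 + jordan42 k) ^+ th h) e) => //.
- by rewrite (unipotent_congr bq (additive_mod_id txM)).
- by rewrite (unipotent_congr bq (additive_mod_id thM)).
- exact: (unipotentM bq txM).
- exact: (unipotentM bq thM).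
- by move=> l h g hg; rewrite (unipotent_congr bq (thK h g hg)) eX.
move=> l m fV fW hV hW hE.
have {hW} bW := unipotent_comm_inv bq th1 (hW h1).
have {hV} bV := unipotent_comm_inv bq tx1 (hV g1).
have /= := jordan42_commutant bW; move=> fWE.
have /= := jordan42_commutant bV.
move=> fVE.
have V0 j : (0 < j)%N -> (j < 6)%N -> fV (inord j) (inord 0) = 0.
  rewrite {1}fVE; move=> j0 j6; rewrite mxlE //.
  by move: j j0 j6 => [|[|[|[|[|[|//]]]]]].
rewrite fWE fVE in hE.
entry hE 0%N 1%N => e01; entry hE 0%N 4%N => e04.
entry hE 4%N 2%N => e12; entry hE 4%N 5%N => e15.
apply: block_conclusion => [//|lm].
have lE : l * fV (inord 0) (inord 0) = fV (inord 0) (inord 0) * m.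
  by rewrite -{1}e04 e15 -e12 e01.
exact: eigen_neq lm lE.
Qed.

End TwoObjects.

(** * Joint eigenspaces and characters of abelian groups *)

Section JointEigen.
Variable k : closedFieldType.

(** An element of one of the two groups acts as zero at the other object; for this
    reason the eigenvalue zero is admitted besides the roots of unity. *)
Lemma expn_eq_diagonalizable d (A : 'M[k]_d.+1) (N : nat) :
  N%:R != 0 :> k -> A ^+ N.+1 = A -> diagonalizable A.
Proof.
move=> N0 AN; apply/diagonalizableP.
pose q : {poly k} := 'X^(N.+1) - 'X.
have Nn0 : N != 0%N by apply: contraNneq N0 => ->.
have qE : q = 'X * ('X^N - 1) by rewrite mulrBr mulr1 -exprS.
have qd : separable_poly q.
  rewrite unlock; apply: Pdiv.ClosedField.root_coprimep => z.
  rewrite qE rootM rootX /root derivM derivX !derivE subr0 !hornerE hornerMn hornerXn.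
  rewrite ?hornerE => /orP[/eqP->|].
    by rewrite mul0r addr0 expr0n (negPf Nn0) sub0r oppr_eq0 oner_neq0.
  move=> /eqP zN; rewrite zN add0r mulrnAr -exprS prednK ?lt0n //.
  by move: zN => /eqP; rewrite subr_eq0 => /eqP ->.
have [r qr] := closed_field_poly_normal q.
have sq : size q = N.+2.
  by rewrite size_polyDl ?size_polyXn // size_polyN size_polyX ltnS ltnS lt0n.
have lq : lead_coef q = 1.
  by rewrite /lead_coef sq /q coefB coefXn coefX eqxx eqSS (negPf Nn0) subr0.
rewrite lq scale1r in qr; exists r; first by rewrite -separable_prod_XsubC -qr.
rewrite -qr; apply: mxminpoly_min.
by rewrite rmorphB /= rmorphXn /= !horner_mx_X AN subrr.
Qed.

(** Commuting diagonalizable matrices have a common basis of eigenvectors; grouping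
    its members by their families of eigenvalues gives the projectors. *)
Lemma joint_projectors (J : finType) d (f : J -> 'M[k]_d) (N : nat) :
  N%:R != 0 :> k -> (forall i j, f i *m f j = f j *m f i) ->
  (forall j, f j ^+ N.+1 = f j) ->
  exists (s : seq {ffun J -> k}) (E : {ffun J -> k} -> 'M[k]_d),
  [/\ uniq s, \sum_(t <- s) E t = 1%:M, forall t, (E t != 0) = (t \in s),
      forall t u, E t *m E u = if t == u then E t else 0
    & forall t j, f j *m E t = t j *: E t /\ E t *m f j = t j *: E t].
Proof.
case: d f => [|d] f N0 fC fN.
  exists [::], (fun=> 0); split=> //.
  - by apply/matrixP => -[].
  - by move=> t; rewrite eqxx.
  - by move=> t u; rewrite mul0mx if_same.
  - by move=> t j; rewrite mulmx0 mul0mx scaler0.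
have [P Pu /allP Pd] : codiagonalizable [seq f j | j <- enum J].
  apply/codiagonalizableP; split.
    by move=> A B /mapP[i _ ->] /mapP[j _ ->]; apply: fC.
  by move=> A /mapP[i _ ->]; apply: expn_eq_diagonalizable N0 (fN i).
have Dex j : exists D : 'rV_d.+1, P *m f j == diag_mx D *m P.
  have /Pd/diagonalizable_forPex[D0 /(simmxPp (stablemx_unit _ Pu)) e] : f j \in [seq f j | j <- enum J].
    by rewrite map_f ?mem_enum.
  by exists D0; rewrite e.
pose D j := xchoose (Dex j).
have fE j : f j = invmx P *m diag_mx (D j) *m P.
  by rewrite -mulmxA -(eqP (xchooseP (Dex j))) mulmxA mulVmx // mul1mx.
pose tp i : {ffun J -> k} := [ffun j => D j 0 i].
pose F (t : {ffun J -> k}) := diag_mx (\row_i (tp i == t)%:R : 'rV[k]_d.+1).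
pose E t := invmx P *m F t *m P.
have mulE (A B : 'M_d.+1) : invmx P *m A *m P *m (invmx P *m B *m P) = invmx P *m (A *m B) *m P.
  by rewrite !mulmxA mulmxK.
have EI (A B : 'M_d.+1) : invmx P *m A *m P = invmx P *m B *m P -> A = B.
  by move=> /(can_inj (mulmxK Pu))/(can_inj (mulKVmx Pu)).
exists (undup [seq tp i | i <- enum 'I_d.+1]), E; split.
- exact: undup_uniq.
- rewrite -mulmx_suml -mulmx_sumr (_ : \sum_(t <- _) F t = 1%:M) ?mulmx1 ?mulVmx //.
  apply/matrixP => i j; rewrite summxE [RHS]mxE.
  rewrite (eq_bigr (fun t => (i == j)%:R * (tp i == t)%:R)); last first.
    by move=> t _; rewrite !mxE mulr_natl; case: eqP => // <-.
  rewrite -mulr_sumr; case: (i == j); last by rewrite mul0r.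
  rewrite mul1r (bigD1_seq (tp i)) ?undup_uniq //= ?mem_undup ?map_f ?mem_enum //.
  by rewrite eqxx big1 ?addr0 // => t; rewrite eq_sym => /negPf->.
- move=> t; apply/idP/idP => [|].
    apply: contraNT; rewrite mem_undup => tn; apply/eqP.
    rewrite /E (_ : F t = 0) ?mulmx0 ?mul0mx //.
    apply/matrixP => i j; rewrite !mxE (_ : tp i == t = false) ?mul0rn //.
    by apply: contraNF tn => /eqP <-; rewrite map_f ?mem_enum.
  rewrite mem_undup => /mapP[i _ ->]; apply/eqP => E0.
  have : F (tp i) = 0 by apply: EI; rewrite mulmx0 mul0mx.
  by move/matrixP/(_ i i); rewrite !mxE !eqxx => /eqP; rewrite oner_eq0.
- move=> t u; rewrite mulE /F mulmx_diag; case: eqVneq => [->|tu].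
    congr (_ *m _ *m _); congr diag_mx; apply/rowP => i; rewrite !mxE.
    by case: eqP; rewrite ?mulr1 ?mulr0.
  rewrite (_ : diag_mx _ = 0) ?mulmx0 ?mul0mx //; apply/matrixP => i j; rewrite !mxE.
  case: (eqVneq (tp i) t) => [->|]; last by rewrite mul0r mul0rn.
  by rewrite (negPf tu) mulr0 mul0rn.
- have FD j t : diag_mx (D j) *m F t = t j *: F t /\ F t *m diag_mx (D j) = t j *: F t.
    have key i : D j 0 i * (tp i == t)%:R = t j * (tp i == t)%:R.
      by case: eqP => [<-|_]; rewrite ?ffunE ?mulr0.
    split; rewrite mulmx_diag; apply/matrixP => i l; rewrite !mxE [RHS]mulrnAr.
      by rewrite key.
    by rewrite mulrC key.
  move=> t j; rewrite fE !mulE; have [-> ->] := FD j t.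
  by rewrite -scalemxAr -scalemxAl.
Qed.

Lemma mxrank_sum_leq (I : Type) (r : seq I) m n (F : I -> 'M[k]_(m, n)) :
  (\rank (\sum_(i <- r) F i)%R <= \sum_(i <- r) \rank (F i))%N.
Proof.
elim: r => [|i r IH]; first by rewrite !big_nil mxrank0.
by rewrite !big_cons (leq_trans (mxrank_add _ _)) // leq_add2l.
Qed.

(** The joint eigenspaces of the regular representation of an abelian group are
    lines, since it is generated by one vector; hence there are as many
    characters as group elements. *)
Lemma abelian_characters (gT : finGroupType) :
  abelian [set: gT] -> #|gT|%:R != 0 :> k ->
  exists psi : 'I_#|gT| -> gT -> k,
  [/\ forall c, psi c 1%g = 1,
      forall c g h, psi c (g * h)%g = psi c g * psi c h
    & forall c c', c != c' -> exists g, psi c g != psi c' g].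
Proof.
move=> /centsP ab n0.
have mulC (g h : gT) : (g * h = h * g)%g by apply: ab; rewrite inE.
pose f g : 'M[k]_#|gT| := \matrix_(i, j) ((enum_val i * g)%g == enum_val j)%:R.
have fdelta g h : delta_mx 0 (enum_rank g) *m f h = delta_mx 0 (enum_rank (g * h)%g) :> 'rV_#|gT|.
  rewrite -rowE; apply/rowP => j; rewrite !mxE enum_rankK.
  by rewrite -{2}(enum_valK j) (inj_eq enum_rank_inj) eq_sym.
have fM g h : f g *m f h = f (g * h)%g.
  apply/row_matrixP => i; rewrite !rowE mulmxA -(enum_valK i) !fdelta.
  by rewrite mulgA.
have f1 : f 1%g = 1%:M.
  by apply/row_matrixP => i; rewrite !rowE mulmx1 -{1}(enum_valK i) fdelta mulg1 enum_valK.
have fX g n : f g ^+ n.+1 = f (g ^+ n.+1)%g.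
  elim: n => [|n IH]; first by rewrite expr1 expg1.
  by rewrite exprS IH [in RHS]expgS -fM.
have fN g : f g ^+ #|gT|.+1 = f g.
  rewrite fX expgS (_ : g ^+ #|gT| = 1)%g ?mulg1 //.
  by apply/eqP; rewrite -order_dvdn -cardsT order_dvdG ?inE.
have fC g h : f g *m f h = f h *m f g by rewrite !fM mulC.
have [s [E [us sE Es EE fE]]] := joint_projectors n0 fC fN.
have rE t : (\rank (E t) <= 1)%N.
  pose u : 'rV[k]_#|gT| := delta_mx 0 (enum_rank 1%g).
  have -> : E t = (\col_i t (enum_val i)) *m (u *m E t).
    apply/row_matrixP => i; rewrite row_mul.
    have -> : row i (\col_i t (enum_val i)) = (t (enum_val i))%:M.
      by apply/rowP => j; rewrite !mxE !ord1.
    rewrite mul_scalar_mx scalemxAr -(fE t (enum_val i)).1 mulmxA fdelta mul1g.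
    by rewrite enum_valK rowE.
  by rewrite (leq_trans (mxrankM_maxl _ _)) // rank_leq_col.
have ns : (#|gT| <= size s)%N.
  rewrite -[X in (X <= _)%N](mxrank1 k) -sE (leq_trans (mxrank_sum_leq _ _)) //.
  by rewrite -sum1_size leq_sum.
have sP (c : 'I_#|gT|) : s`_c \in s by rewrite mem_nth // (leq_trans (ltn_ord c)).
have scI (t : {ffun gT -> k}) (a b : k) : t \in s -> a *: E t = b *: E t -> a = b.
  rewrite -Es => tE /eqP; rewrite -subr_eq0 -scalerBl scaler_eq0 (negPf tE) orbF.
  by rewrite subr_eq0 => /eqP.
exists (fun c g => s`_c g); split.
- by move=> c; apply: (scI _ _ _ (sP c)); rewrite -(fE _ _).1 f1 mul1mx scale1r.
- move=> c g h; apply: (scI _ _ _ (sP c)).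
  by rewrite -(fE _ _).1 -fM -mulmxA (fE _ _).1 -scalemxAr (fE _ _).1 scalerA mulrC.
- move=> c c' ne; apply: NNPP => no.
  have : s`_c = s`_c' by apply/ffunP => g; apply/eqP/negPn/negP => e; apply: no; exists g.
  move/eqP; rewrite nth_uniq ?(leq_trans (ltn_ord _)) //.
  by rewrite (inj_eq val_inj) (negPf ne).
Qed.

End JointEigen.

(** A cyclic Sylow subgroup not inside [K] gives a homomorphism onto the group
    of order [p] that kills [K]: the discrete logarithm of the [p]-part. *)
Lemma discrete_log_mod (gT : finGroupType) (p : nat) (K : {group gT}) :
  prime p -> abelian [set: gT] -> cyclic_Sylows p [set: gT] ->
  ~~ (Op' p [set: gT] \subset K) ->
  exists th : gT -> nat,
  [/\ forall g h, (th (g * h)%g = th g + th h %[mod p])%N,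
      exists g, (th g = 1 %[mod p])%N & forall g, g \in K -> (th g = 0 %[mod p])%N].
Proof.
move=> pp ab cyc nK.
have [P sP PK] : exists2 P : {group gT}, (p.-Sylow([set: gT]) P)%g & ~~ (P \subset K).
  apply: NNPP => no; case/negP: nK; rewrite gen_subG; apply/bigcupsP => P sP.
  by apply/negPn/negP => PK; apply: no; exists P.
have /cyclicP[w Pw] := cyc P sP.
have pw : (p.-elt w)%g by apply: (mem_p_elt (pHall_pgroup sP)); rewrite Pw cycle_id.
have dvp : (p %| #[w]%g)%N.
  have P1 : P :!=: 1%g by apply: contraNneq PK => ->; exact: sub1G.
  by have [_ + _] := pgroup_pdiv (pHall_pgroup sP) P1; rewrite orderE -Pw.
have mulC (g h : gT) : commute g h by apply: (centsP ab); rewrite inE.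
have ex g : exists i, (g.`_p == w ^+ i)%g.
  have : (g.`_p)%g \in P.
    rewrite (mem_normal_Hall sP) ?p_elt_constt ?inE //.
    by rewrite -sub_abelian_normal ?subsetT.
  by rewrite Pw => /cycleP[i ->]; exists i.
pose th g := xchoose (ex g).
have thE g : (g.`_p = w ^+ th g)%g by exact/eqP/(xchooseP (ex g)).
have modp i j : (w ^+ i = w ^+ j)%g -> (i = j %[mod p])%N.
  move/eqP; rewrite eq_expg_mod_order => /eqP ij.
  by rewrite -(modn_dvdm i dvp) -(modn_dvdm j dvp) ij.
exists th; split.
- by move=> g h; apply: modp; rewrite -thE (consttM _ (mulC g h)) !thE expgD.
- by exists w; apply: modp; rewrite -thE constt_p_elt.
- move=> g gK; rewrite mod0n; apply/eqP; rewrite -/(dvdn p (th g)).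
  apply: contraR PK => pth.
  have gpK : (w ^+ th g)%g \in K by rewrite -thE groupX.
  have co : coprime #[w]%g (th g).
    by rewrite (pnat_coprime pw) // p'natE.
  have /eqP wE : generator <[w]>%g (w ^+ th g)%g by rewrite generator_coprime.
  by rewrite Pw wE cycle_subG.
Qed.

(** * Sylow subgroups and stabilizers *)

Section SylowSubgroups.
Local Open Scope group_scope.
Variables (p : nat) (gT : finGroupType).
Hypothesis ab : abelian [set: gT].

(** An abelian group has a single Sylow subgroup for each prime. *)
Lemma Op'_abelian (P : {group gT}) : p.-Sylow([set: gT]) P -> Op' p [set: gT] = P.
Proof.
have nor (Q : {group gT}) : Q <| [set: gT] by rewrite -sub_abelian_normal ?subsetT.
move=> sP; apply/eqP; rewrite eqEsubset gen_subG; apply/andP; split.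
  apply/bigcupsP => Q sQ.
  by rewrite -(normal_Hall_pcore sQ (nor Q)) (normal_Hall_pcore sP (nor P)).
by apply: sub_gen; apply: (bigcup_sup P).
Qed.

Lemma mem_Op' (g : gT) : (g \in Op' p [set: gT]) = p.-elt g.
Proof.
have [P sP] := Sylow_exists p [set: gT].
rewrite (Op'_abelian sP) (mem_normal_Hall sP) ?inE //.
by rewrite -sub_abelian_normal ?subsetT.
Qed.

Lemma Op'_index (K : {group gT}) : Op' p [set: gT] \subset K ->
  p^'.-nat #|[set: gT] : K|.
Proof.
have [P sP] := Sylow_exists p [set: gT]; rewrite (Op'_abelian sP) => PK.
have nP : p^'.-nat #|[set: gT] : P| by case/and3P: sP.
apply: pnat_dvd nP; by rewrite -(Lagrange_index (subsetT K) PK) dvdn_mulr.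
Qed.

Lemma Op'_card : (#|Op' p [set: gT]| == 1%N) || (p <= #|Op' p [set: gT]|)%N.
Proof.
have [P sP] := Sylow_exists p [set: gT]; rewrite (Op'_abelian sP).
case: (eqVneq (P : {set gT}) 1) => [->|P1]; first by rewrite cards1.
by have [_ /dvdn_leq-> //] := pgroup_pdiv (pHall_pgroup sP) P1; rewrite orbT.
Qed.

Lemma Op'_card0 : p = 0%N -> Op' p [set: gT] = 1.
Proof.
move=> p0; have [P sP] := Sylow_exists p [set: gT]; rewrite (Op'_abelian sP).
by move: sP; rewrite p0 Sylow0E => /eqP.
Qed.

End SylowSubgroups.

Section Stabilizers.
Variables (C : finEICat) (x y : ob C) (alpha : mor x y).
Hypothesis htrans : forall a b : mor x y, exists h : endo y, b = ccomp h a.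
Hypotheses (hGab : abelian [set: endo x]) (hHab : abelian [set: endo y]).

Lemma compMl (h h' : endo y) (f : mor x y) : ccomp (h * h')%g f = ccomp h (ccomp h' f).
Proof. by rewrite ccompA. Qed.

Lemma compMr (f : mor x y) (g g' : endo x) : ccomp f (g * g')%g = ccomp (ccomp f g) g'.
Proof. by rewrite -ccompA. Qed.

Lemma comp1l (f : mor x y) : ccomp (1%g : endo y) f = f.
Proof. exact: ccomp_idl. Qed.

Lemma comp1r (f : mor x y) : ccomp f (1%g : endo x) = f.
Proof. exact: ccomp_idr. Qed.

Definition point_stab : {set endo y} := [set h : endo y | ccomp h alpha == alpha].

Lemma point_stab_group_set : group_set point_stab.
Proof.
apply/group_setP; split=> [|h h']; first by rewrite inE comp1l.
by rewrite !inE => /eqP h1 /eqP h2; rewrite compMl h2 h1.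
Qed.
Canonical point_stab_group := Group point_stab_group_set.

Lemma endoC (z : ob C) : abelian [set: endo z] -> forall g h : endo z, (g * h = h * g)%g.
Proof. by move=> /centsP ab g h; apply: ab; rewrite inE. Qed.

Lemma transporter_mul (h h' : endo y) (g g' : endo x) :
  ccomp h alpha = ccomp alpha g -> ccomp h' alpha = ccomp alpha g' ->
  ccomp (h * h')%g alpha = ccomp alpha (g * g')%g.
Proof.
by move=> e e'; rewrite compMl e' compMr -e ccompA.
Qed.

Lemma transporterX (h : endo y) (g : endo x) n :
  ccomp h alpha = ccomp alpha g -> ccomp (h ^+ n)%g alpha = ccomp alpha (g ^+ n)%g.
Proof.
move=> e; elim: n => [|n IH]; first by rewrite !expg0 comp1l comp1r.
by rewrite !expgS; exact: transporter_mul.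
Qed.

Lemma transporter_stab (h : endo y) (g : endo x) :
  ccomp h alpha = ccomp alpha g -> h \in stab_right_orbit alpha.
Proof.
move=> e; rewrite inE; apply/eqP/setP => b; apply/imsetP/imsetP => [[c]|[g' _ ->]].
  move=> /imsetP[g' _ ->] ->; exists (g * g')%g => //.
  by rewrite compMr -e ccompA.
exists (ccomp alpha (g^-1 * g')%g); first by apply/imsetP; exists (g^-1 * g')%g.
by rewrite compMr ccompA ccompA e -!compMr mulgA mulgV mul1g.
Qed.

Lemma stab_transporter (h : endo y) : h \in stab_right_orbit alpha ->
  exists g : endo x, ccomp h alpha = ccomp alpha g.
Proof.
rewrite inE => /eqP hS.
have : ccomp h alpha \in right_orbit alpha.
  rewrite -hS; apply/imsetP; exists alpha => //.
  by apply/imsetP; exists 1%g; rewrite ?comp1r.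
by move=> /imsetP[g _ ->]; exists g.
Qed.

Lemma norm_stab_right_orbit : [set: endo y] \subset 'N(stab_right_orbit alpha)%g.
Proof.
apply: (subset_trans _ (cent_sub _)); apply: (subset_trans hHab).
exact/centS/subsetT.
Qed.

Lemma trivial_left_iff (L : {set endo y}) :
  acts_trivially_left x L <-> L \subset point_stab.
Proof.
split=> [tr|/subsetP LK h /LK].
  by apply/subsetP => h hL; rewrite inE tr.
rewrite inE => /eqP hK f; have [h' ->] := htrans alpha f.
by rewrite -compMl (endoC hHab) compMl hK.
Qed.

Lemma trivial_right (L : {set endo x}) :
  (forall g, g \in L -> ccomp alpha g = alpha) -> acts_trivially_right y L.
Proof.
move=> tr g gL f; have [h ->] := htrans alpha f.
by rewrite -ccompA tr.
Qed.

(** Transitivity writes [alpha g] as [h alpha]; if [g] is a [p]-element and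
    [p]-elements of [endo y] fix [alpha], then [h] may be taken of order prime to
    [p], and a [p]-power of it fixes [alpha]. *)
Lemma trivial_left_right (p : nat) :
  Op' p [set: endo y] \subset point_stab ->
  acts_trivially_right y (Op' p [set: endo x]).
Proof.
move=> /subsetP PK; apply: trivial_right => g; rewrite mem_Op' // => pg.
have [h e] := htrans alpha (ccomp alpha g).
have hp : ccomp (h.`_p)%g alpha = alpha.
  by apply/eqP; have := PK (h.`_p)%g; rewrite mem_Op' // p_elt_constt inE; apply.
have e' : ccomp (h.`_p^')%g alpha = ccomp alpha g.
  by rewrite -[in LHS]hp -compMl (endoC hHab) consttC -e.
suff : (h.`_p^')%g \in point_stab by rewrite inE -e' => /eqP.
have hX : ((h.`_p^') ^+ #[g])%g \in point_stab.
  by rewrite inE (transporterX _ e') expg_order comp1r.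
have /eqP gen : generator <[(h.`_p^')%g]>%g ((h.`_p^') ^+ #[g])%g.
  rewrite generator_coprime coprime_sym (pnat_coprime pg) //.
  exact: p_elt_constt.
have : (<[((h.`_p^') ^+ #[g])%g]> \subset point_stab)%g by rewrite cycle_subG.
by rewrite -gen cycle_subG.
Qed.

End Stabilizers.

(** * Necessity of the conditions *)

Section Necessity.
Variables (k : closedFieldType) (p : nat) (C : finEICat) (x y : ob C).
Hypotheses (hp : has_char p k) (hxy : x != y) (hob : forall z : ob C, z = x \/ z = y)
  (hyx : #|mor y x| = 0%N).
Variable alpha : mor x y.
Hypotheses (hG : cyclic_Sylows p [set: endo x]) (hH : cyclic_Sylows p [set: endo y])
  (hp2 : p <> 2) (hp3 : p <> 3).
Hypothesis htrans : forall a b : mor x y, exists h : endo y, b = ccomp h a.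
Hypotheses (hGab : abelian [set: endo x]) (hHab : abelian [set: endo y]).
Local Notation A := (catalg k C).
Local Notation K := (point_stab alpha).
Local Notation H1 := (stab_right_orbit alpha).

Lemma pchar_of_Op' (z : ob C) : abelian [set: endo z] ->
  Op' p [set: endo z] <> 1%g -> p \in [pchar k].
Proof. by case: hp => [[p0 _] ab []|//]; apply: Op'_card0. Qed.

Lemma char_gt3 : p \in [pchar k] -> (3 < p)%N.
Proof.
move=> /pcharf_prime pp; move: hp2 hp3; have := prime_gt1 pp.
by case: p pp => [|[|[|[|q]]]].
Qed.

(** If the [p]-part of [endo y] moves [alpha], there is a homomorphism to the
    group of order [p] killing the stabilizer; whether it is trivial on the
    elements [h] with [h alpha = alpha g] decides which family exists. *)
Lemma finite_rep_type_trivial_action :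
  finite_rep_type A -> Op' p [set: endo y] \subset K.
Proof.
move=> fin; apply/negPn/negP => nK.
have pk : p \in [pchar k].
  apply: (pchar_of_Op' hHab) => e1; case/negP: nK.
  by rewrite e1 sub1G.
have pp := pcharf_prime pk.
have [th [thM th1 thK]] := discrete_log_mod pp hHab hH nK.
have thS (h h' : endo y) : ccomp h alpha = ccomp h' alpha -> (th h = th h' %[mod p])%N.
  move=> e; have hK : (h'^-1 * h)%g \in K.
    by rewrite inE compMl e -compMl mulVg comp1l.
  have := thM h' (h'^-1 * h)%g; rewrite mulKVg => ->.
  by rewrite -modnDmr thK // mod0n addn0.
have [tr|ntr] := classic (forall (h : endo y) (g : endo x),
    ccomp h alpha = ccomp alpha g -> th h = 0 %[mod p])%N.
  by apply: (infinite_invariant_lines hxy hob hyx htrans pk (char_gt3 pk) _ tr fin).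
have [h0 n0] := not_all_ex_not _ _ ntr; have [g0 n0'] := not_all_ex_not _ _ n0.
have [e0 th0] := imply_to_and _ _ n0'.
have ex (g : endo x) : exists h : endo y, ccomp alpha g == ccomp h alpha.
  by have [h ->] := htrans alpha (ccomp alpha g); exists h.
pose hf g := xchoose (ex g).
have hfE g : ccomp (hf g) alpha = ccomp alpha g by rewrite -(eqP (xchooseP (ex g))).
pose thx g := th (hf g).
have thxE h g : ccomp h alpha = ccomp alpha g -> (th h = thx g %[mod p])%N.
  by move=> e; apply: thS; rewrite hfE.
have thxM : additive_mod p thx.
  split=> [g g'|].
    rewrite -(thxE (hf g * hf g')%g) ?thM //.
    exact: transporter_mul.
  have nd : ~~ (p %| th h0)%N.
    by apply/negP => pd; apply: th0; rewrite mod0n; apply/eqP.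
  have [n hn] := additive_mod_unit thM pp nd.
  by exists (g0 ^+ n)%g; rewrite -(thxE (h0 ^+ n)%g) //; apply: transporterX.
by apply: (infinite_equivariant_maps hxy hob hyx htrans pk (char_gt3 pk) thxM _ thxE fin).
Qed.

Lemma exists_additive_mod (z : ob C) : p \in [pchar k] -> abelian [set: endo z] ->
  cyclic_Sylows p [set: endo z] -> #|Op' p [set: endo z]| <> 1%N ->
  exists th : endo z -> nat, additive_mod p th.
Proof.
move=> pk ab cyc n1.
have [|th [thM th1 _]] := @discrete_log_mod _ p 1%G (pcharf_prime pk) ab cyc.
  apply/negP => sub1; apply: n1.
  have -> : Op' p [set: endo z] = 1%g by apply/trivgP.
  exact: cards1.
by exists th.
Qed.

Lemma exists_character_system r : Op' p [set: endo y] \subset K ->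
  (r <= #|[set: endo y] : H1|%g)%N ->
  exists psi : 'I_r -> endo y -> k, character_system alpha psi.
Proof.
move=> trK; pose Q : finGroupType := coset_of H1.
have norH := norm_stab_right_orbit alpha hHab.
have QT : [set: Q] = ([set: endo y] / H1)%g.
  apply/eqP; rewrite eqEsubset subsetT andbT; apply/subsetP => q _.
  by have [h _ ->] := cosetP q; rewrite mem_quotient ?inE.
have cQ : #|Q| = #|[set: endo y] : H1|%g by rewrite -cardsT QT card_quotient.
have KH : K \subset H1.
  apply/subsetP => h; rewrite inE => /eqP e.
  by apply: (@transporter_stab _ _ _ _ _ 1%g); rewrite comp1r.
rewrite -cQ => rQ.
have n0 : #|Q|%:R != 0 :> k.
  have := Op'_index hHab (subset_trans trK KH : _ \subset stab_right_orbit_group alpha).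
  rewrite -cQ; case: hp => [[_ p0] _|pk pn].
    by rewrite ((pcharf0P k).1 p0) -lt0n; apply/card_gt0P; exists 1%g.
  by rewrite -(dvdn_pcharf pk) -p'natE // (pcharf_prime pk).
have abQ : abelian [set: Q] by rewrite QT quotient_abelian.
have [psi [psi1 psiM psiN]] := abelian_characters abQ n0.
exists (fun c h => psi (widen_ord rQ c) (coset H1 h)); split.
- by move=> c; rewrite morph1.
- by move=> c g h; rewrite morphM ?psiM // (subsetP norH) ?inE.
- move=> c h g e; rewrite (coset_id (transporter_stab e)).
  exact: psi1.
- move=> c c' ne; have [|q hq] := psiN (widen_ord rQ c) (widen_ord rQ c').
    by rewrite -val_eqE.
  by have [h _ hE] := cosetP q; exists h; rewrite -hE.
Qed.

Lemma necessity :
  let s := #|Op' p [set: endo x]| in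
  let t := #|Op' p [set: endo y]| in
  let n := #|[set: endo y] : H1|%g in
  finite_rep_type A ->
  [/\ acts_trivially_right y (Op' p [set: endo x]),
      acts_trivially_left x (Op' p [set: endo y])
    & [\/ [/\ p <= s, p <= t & n = 1],
          ((s = 1 /\ p <= t) \/ (t = 1 /\ p <= s)) /\ n <= 2
        | [/\ s = 1, t = 1 & n <= 3]]]%N.
Proof.
move=> s t n fin; have trK := finite_rep_type_trivial_action fin.
split.
- exact: (trivial_left_right htrans hGab hHab trK).
- by apply/(trivial_left_iff alpha htrans hHab).
have chars r := @exists_character_system r trK.
have n3 : (n <= 3)%N.
  rewrite leqNgt; apply/negP => n4; have [psi psiS] := chars 4 n4.
  exact: (infinite_four_characters hxy hob hyx htrans psiS fin).
have n0 : (0 < n)%N by rewrite indexg_gt0.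
have pkx : s <> 1%N -> p \in [pchar k].
  by move=> s1; apply: (pchar_of_Op' hGab) => e1; apply: s1; rewrite /s e1 cards1.
have pky : t <> 1%N -> p \in [pchar k].
  by move=> s1; apply: (pchar_of_Op' hHab) => e1; apply: s1; rewrite /t e1 cards1.
have n2 : s <> 1%N \/ t <> 1%N -> (n <= 2)%N.
  move=> st; rewrite leqNgt; apply/negP => n2; have [psi psiS] := chars 3 n2.
  case: st => [s1|t1].
    have [th thS] := exists_additive_mod (pkx s1) hGab hG s1.
    exact: (infinite_three_characters_left hxy hob hyx htrans (pkx s1) psiS thS fin).
  have [th thS] := exists_additive_mod (pky t1) hHab hH t1.
  exact: (infinite_three_characters_right hxy hob hyx htrans (pky t1) psiS thS fin).
have n1 : s <> 1%N -> t <> 1%N -> n = 1%N.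
  move=> s1 t1; apply/eqP; rewrite eqn_leq n0 andbT leqNgt; apply/negP => n1.
  have [psi psiS] := chars 2 n1; have pk := pkx s1.
  have [thx thxS] := exists_additive_mod pk hGab hG s1.
  have [thy thyS] := exists_additive_mod pk hHab hH t1.
  exact: (infinite_two_characters hxy hob hyx htrans pk (ltnW (char_gt3 pk))
            psiS thxS thyS fin).
have ps : s <> 1%N -> (p <= s)%N by move=> /eqP/negPf s1; have := Op'_card p hGab; rewrite -/s s1.
have pt : t <> 1%N -> (p <= t)%N by move=> /eqP/negPf t1; have := Op'_card p hHab; rewrite -/t t1.
have [s1|/eqP s1] := eqVneq s 1%N; have [t1|/eqP t1] := eqVneq t 1%N.
- by constructor 3.
- by constructor 2; split; [left; split=> //; exact: pt|apply: n2; right].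
- by constructor 2; split; [right; split=> //; exact: ps|apply: n2; left].
- by constructor 1; split; [exact: ps|exact: pt|exact: n1].
Qed.

End Necessity.

(** * Stars with nilpotent loops and systems of chains *)

Section LinearForms.
Variable k : fieldType.

(** Linear forms on the row space of [A] extend to the whole space. *)
Lemma factor_right m d q (A : 'M[k]_(m, d)) (B : 'M[k]_(m, q)) :
  (forall u : 'rV_m, u *m A = 0 -> u *m B = 0) -> exists X, A *m X = B.
Proof.
move=> AB; have : (B^T <= A^T)%MS.
  rewrite submxE; apply/eqP.
  have kA : kermx A *m A = 0 by rewrite mulmx_ker.
  have kB : kermx A *m B = 0.
    by apply/row_matrixP => i; rewrite row_mul row0 AB // -row_mul kA row0.
  have /sub_kermxP/submxP[Y YE] : (cokermx A^T)^T *m A = 0.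
    by apply: trmx_inj; rewrite trmx_mul trmxK mulmx_coker trmx0.
  by apply: trmx_inj; rewrite trmx_mul trmxK YE -mulmxA kB mulmx0 trmx0.
by move=> /submxP[X XE]; exists X^T; apply: trmx_inj; rewrite trmx_mul trmxK.
Qed.

Lemma separating_form m d (L : 'M[k]_(m, d)) (v : 'rV[k]_d) :
  ~~ (v <= L)%MS -> exists h : 'cV[k]_d, L *m h = 0 /\ v *m h = 1%:M.
Proof.
rewrite submxE; have := mulmx_coker L; move: (cokermx L) => D LD.
move=> /rV0Pn[j vj].
exists (((v *m D) 0 j)^-1 *: (D *m delta_mx j 0)); split.
  by rewrite -scalemxAr mulmxA LD mul0mx scaler0.
rewrite -scalemxAr mulmxA -colE; apply/matrixP => a b.
by rewrite !ord1 [RHS]mxE eqxx [LHS]mxE [X in _ * X]mxE mulVf.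
Qed.

Lemma submx_form m m' d (K : 'M[k]_(m, d)) (L : 'M[k]_(m', d)) (h : 'cV[k]_d) :
  (K <= L)%MS -> L *m h = 0 -> K *m h = 0.
Proof. by move=> /submxP[D ->] Lh; rewrite -mulmxA Lh mulmx0. Qed.

Lemma nat_minimal (P : nat -> Prop) : (exists n, P n) ->
  exists n, P n /\ forall m, (m < n)%N -> ~ P m.
Proof.
move=> [n Pn]; apply: NNPP => no; suff H m : forall i, (i < m)%N -> ~ P i.
  exact: (H n.+1 n).
elim: m => // m IH i; rewrite ltnS leq_eqVlt => /orP[/eqP->|]; last exact: IH.
by move=> Pm; apply: no; exists m.
Qed.

End LinearForms.

Section StarData.
Variables (k : fieldType) (d : nat) (N : nat).
Variables (n e E0 : 'M[k]_d) (Ec : 'I_3 -> 'M[k]_d).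
Local Notation "n ^^ i" := (iter i (mulmx n) 1%:M) (at level 30).

(** The image of [E0] is the center of a star and those of the [Ec c] are the ends
    of its legs, a missing leg being given by [Ec c = 0]; [n] collects the loops
    and [e] the arrows. The star may sit inside a larger representation: by
    [star_E0e] and [star_eEc], nothing else is reached from the center or leads to
    the ends of the legs. *)
Record star_data : Prop := StarData {
  star_E0 : E0 *m E0 = E0;
  star_Ec : forall c c', Ec c *m Ec c' = if c == c' then Ec c else 0;
  star_E0c : forall c, E0 *m Ec c = 0;
  star_Ec0 : forall c, Ec c *m E0 = 0;
  star_nE0 : n *m E0 = E0 *m n;
  star_nEc : forall c, n *m Ec c = Ec c *m n;
  star_nN : n ^^ N = 0;
  star_ne : n *m e = 0;
  star_en : e *m n = 0;
  star_E0e : E0 *m e = \sum_c E0 *m e *m Ec c;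
  star_eEc : forall c, e *m Ec c = E0 *m e *m Ec c;
  star_eE0 : e *m E0 = 0;
  star_Ece : forall c, Ec c *m e = 0
}.

(** Up to two chains [z i], [z i *m n], and so on, in the center and one in each
    leg, of lengths [l]; a chain of length zero is absent. Since [e] vanishes on the
    image of [n], only the first vector of a central chain can survive, and since
    its image is killed by [n], that image is the last vector of the chains of
    some legs, recorded by [M]. The form [f i] is dual to the last vector, and its
    composites with powers of [n] to the earlier ones, so that the span of the
    forms is stable for the same reason as the span of the vectors. *)
Record chain_system (l : 'I_2 + 'I_3 -> nat) (z : 'I_2 + 'I_3 -> 'rV[k]_d)
  (f : 'I_2 + 'I_3 -> 'cV[k]_d) (M : 'I_2 -> 'I_3 -> bool) : Prop := ChainSystem {
  chain_zE : forall i, z i *m (if i is inr c then Ec c else E0) = z i;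
  chain_Ef : forall i, (if i is inr c then Ec c else E0) *m f i = f i;
  chain_zn : forall i, z i *m n ^^ (l i) = 0;
  chain_nf : forall i, n ^^ (l i) *m f i = 0;
  chain_zf : forall i j, (0 < l i)%N -> (0 < l j)%N ->
    z i *m n ^^ (l j).-1 *m f j = (i == j)%:R%:M;
  chain_ze : forall q c, (0 < l (inl q))%N -> z (inl q) *m e *m Ec c =
    if (0 < l (inr c))%N then (M q c)%:R *: (z (inr c) *m n ^^ (l (inr c)).-1) else 0;
  chain_ef : forall c, (0 < l (inr c))%N -> E0 *m e *m f (inr c) =
    \sum_(q | (0 < l (inl q))%N) (M q c)%:R *: (n ^^ (l (inl q)).-1 *m f (inl q));
  chain_ex : exists i, (0 < l i)%N
}.

Lemma mxiterS i : n ^^ i.+1 = n *m n ^^ i. Proof. by []. Qed.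

Lemma mxiterD i j : n ^^ (i + j) = n ^^ i *m n ^^ j.
Proof. by elim: i => [|i IH] /=; rewrite ?mul1mx // IH mulmxA. Qed.

Lemma mxiterSr i : n ^^ i.+1 = n ^^ i *m n.
Proof. by rewrite -addn1 mxiterD /= mulmx1. Qed.

Hypothesis sd : star_data.

Lemma mxiter_comm (F : 'M[k]_d) i : n *m F = F *m n -> n ^^ i *m F = F *m n ^^ i.
Proof.
move=> nF; elim: i => [|i IH]; first by rewrite mul1mx mulmx1.
by rewrite mxiterS -mulmxA IH mulmxA nF -mulmxA.
Qed.

Lemma mxiter_ge i : (N <= i)%N -> n ^^ i = 0.
Proof. by move=> Ni; rewrite -(subnK Ni) mxiterD (star_nN sd) mulmx0. Qed.

Lemma lt_nilp (z : 'rV[k]_d) i : z *m n ^^ i != 0 -> (i < N)%N.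
Proof. by rewrite ltnNge; apply: contraNN => /mxiter_ge->; rewrite mulmx0. Qed.

(** A system of chains is determined by the first vectors [v q] of the central
    chains and the forms [h q] dual to them. The form dual to the last vector of a
    central chain is found by solving for it, which is possible when [h q] vanishes
    on the vectors killed before the end of the chain; the form belonging to a leg
    exists when the corresponding combination of the [h q] vanishes on the vectors
    that the leg sends deeper than the [v q] it meets. *)
Lemma chain_system_intro (iq : 'I_2 -> nat) (v : 'I_2 -> 'rV[k]_d)
  (h : 'I_2 -> 'cV[k]_d) (jc : 'I_3 -> nat) (M : 'I_2 -> 'I_3 -> bool) :
  (exists q, (0 < iq q)%N) ->
  (forall q, (0 < iq q)%N -> [/\ v q *m E0 = v q, v q *m n ^^ (iq q) = 0, E0 *m h q = h q,
     n *m h q = 0 & forall u : 'rV_d, u *m E0 = u -> u *m n ^^ (iq q).-1 = 0 -> u *m h q = 0]) ->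
  (forall q q', (0 < iq q)%N -> (0 < iq q')%N -> v q *m h q' = (q == q')%:R%:M) ->
  (forall q c, (0 < iq q)%N -> jc c = 0%N -> v q *m e *m Ec c = 0) ->
  (forall c, (0 < jc c)%N -> exists (u w' : 'rV[k]_d) q, [/\ (0 < iq q)%N, M q c = true, u = w' *m n ^^ (jc c).-1,
     forall q, (0 < iq q)%N -> v q *m e *m Ec c = (M q c)%:R *: u
     & forall u w' : 'rV[k]_d, u *m E0 *m e *m Ec c = w' *m n ^^ (jc c) ->
         u *m (\sum_(q | (0 < iq q)%N) (M q c)%:R *: h q) = 0]) ->
  exists l z f, chain_system l z f M.
Proof.
move=> exq hv dual j0 leg.
have nE0 i : n ^^ i *m E0 = E0 *m n ^^ i by apply: mxiter_comm; apply: (star_nE0 sd).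
have nEc c i : n ^^ i *m Ec c = Ec c *m n ^^ i by apply: mxiter_comm; apply: (star_nEc sd).
have exf q : exists f : 'cV[k]_d, (0 < iq q)%N ->
    E0 *m f = f /\ n ^^ (iq q).-1 *m f = h q.
  case: (posnP (iq q)) => [->|q0]; first by exists 0.
  have [vE vn Eh nh hk] := hv q q0.
  have [f0 f0E] : exists X, n ^^ (iq q).-1 *m X = h q.
    apply: factor_right => u un; rewrite -Eh mulmxA; apply: hk.
      by rewrite -mulmxA (star_E0 sd).
    by rewrite -mulmxA -nE0 mulmxA un mul0mx.
  exists (E0 *m f0) => _; split; first by rewrite mulmxA (star_E0 sd).
  by rewrite mulmxA nE0 -mulmxA f0E.
have exw c : exists wg : 'rV[k]_d * 'cV[k]_d, (0 < jc c)%N ->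
   [/\ wg.1 *m Ec c = wg.1, Ec c *m wg.2 = wg.2, wg.1 *m n ^^ (jc c) = 0,
       n ^^ (jc c) *m wg.2 = 0
     & [/\ wg.1 *m n ^^ (jc c).-1 *m wg.2 = 1%:M,
       forall q, (0 < iq q)%N -> v q *m e *m Ec c = (M q c)%:R *: (wg.1 *m n ^^ (jc c).-1)
     & E0 *m e *m wg.2 = \sum_(q | (0 < iq q)%N) (M q c)%:R *: h q]].
  case: (posnP (jc c)) => [->|c0]; first by exists (0, 0).
  have [u [w' [q [q0 Mq uE vu hL]]]] := leg c c0.
  pose H := \sum_(q | (0 < iq q)%N) (M q c)%:R *: h q; rewrite -/H in hL *.
  have EH : E0 *m H = H.
    by rewrite mulmx_sumr; apply: eq_bigr => r r0; rewrite -scalemxAr; have [_ _ ->] := hv r r0.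
  have uq : u = v q *m e *m Ec c by rewrite vu // Mq scale1r.
  have uEc : u *m Ec c = u by rewrite uq -mulmxA (star_Ec sd) eqxx.
  have un : u *m n = 0.
    by rewrite uq -mulmxA -(star_nEc sd) mulmxA -(mulmxA (v q)) (star_en sd) mulmx0 mul0mx.
  have [g0 g0E] : exists X, col_mx (E0 *m e *m Ec c) (n ^^ (jc c)) *m X = col_mx H (0 : 'cV_d).
    apply: factor_right => ab; rewrite -[ab]hsubmxK !mul_row_col mulmx0 addr0.
    move=> /eqP; rewrite addr_eq0 => /eqP ab0; apply: (hL _ (- rsubmx ab)).
    by rewrite mulNmx -ab0 !mulmxA.
  move: g0E; rewrite mul_col_mx => /eq_col_mx[g1 g2].
  have wn1 : w' *m Ec c *m n ^^ (jc c).-1 = u by rewrite -mulmxA -nEc mulmxA -uE uEc.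
  have eg : E0 *m e *m (Ec c *m g0) = H by rewrite mulmxA.
  exists (w' *m Ec c, Ec c *m g0) => _ /=; split.
  - by rewrite -mulmxA (star_Ec sd) eqxx.
  - by rewrite mulmxA (star_Ec sd) eqxx.
  - by rewrite -(prednK c0) mxiterSr mulmxA wn1.
  - by rewrite mulmxA nEc -mulmxA g2 mulmx0.
  split=> //; last by move=> r r0; rewrite wn1 vu.
  have [vE _ _ _ _] := hv q q0.
  rewrite wn1 uq -mulmxA (mulmxA (Ec c)) (star_Ec sd) eqxx -{1}vE.
  rewrite -!mulmxA (mulmxA E0) eg mulmx_sumr (bigD1 q) //= Mq scale1r dual // eqxx.
  by rewrite big1 ?addr0 // => r /andP[r0 rq]; rewrite -scalemxAr dual // eq_sym (negPf rq) scale_scalar_mx mulr0 raddf0.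
have [F FP] := fin_all_exists exf; have [wg wgP] := fin_all_exists exw.
pose l i := match i with inl q => iq q | inr c => jc c end.
pose z i := if (0 < l i)%N then match i with inl q => v q | inr c => (wg c).1 end else 0.
pose f i := if (0 < l i)%N then match i with inl q => F q | inr c => (wg c).2 end else 0.
have zl q : (0 < iq q)%N -> z (inl q) = v q by rewrite /z /= => ->.
have zr c : (0 < jc c)%N -> z (inr c) = (wg c).1 by rewrite /z /= => ->.
have fl q : (0 < iq q)%N -> f (inl q) = F q by rewrite /f /= => ->.
have fr c : (0 < jc c)%N -> f (inr c) = (wg c).2 by rewrite /f /= => ->.
have z0 i : l i = 0%N -> z i = 0 by rewrite /z => ->.
have f0 i : l i = 0%N -> f i = 0 by rewrite /f => ->.
have zE i : z i *m (if i is inr c then Ec c else E0) = z i.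
  case: (posnP (l i)) => [/z0->|]; first by rewrite mul0mx.
  case: i => [q|c] /= l0; first by rewrite zl //; have [] := hv q l0.
  by rewrite zr //; have [] := wgP c l0.
have Ef i : (if i is inr c then Ec c else E0) *m f i = f i.
  case: (posnP (l i)) => [/f0->|]; first by rewrite mulmx0.
  case: i => [q|c] /= l0; first by rewrite fl //; have [] := FP q l0.
  by rewrite fr //; have [] := wgP c l0.
exists l, z, f; split=> //.
- move=> i; case: (posnP (l i)) => [/z0->|]; first by rewrite mul0mx.
  case: i => [q|c] /= l0; first by rewrite zl //; have [] := hv q l0.
  by rewrite zr //; have [] := wgP c l0.
- move=> i; case: (posnP (l i)) => [/f0->|]; first by rewrite mulmx0.
  case: i => [q|c] /= l0; last by rewrite fr //; have [] := wgP c l0.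
  have [_ Fh] := FP q l0; have [_ _ _ nh _] := hv q l0.
  by rewrite fl // -(prednK l0) mxiterS -mulmxA Fh.
- move=> [q|c] [q'|c'] /= l0 l0'.
  + rewrite zl // fl // -mulmxA; have [_ ->] := FP q' l0'.
    by rewrite dual // (inj_eq (@inl_inj _ _)).
  + rewrite -[z (inl q)]zE -[f (inr c')]Ef /= -mulmxA (mulmxA _ (Ec c')) nEc.
    by rewrite -!mulmxA (mulmxA E0) (star_E0c sd) mul0mx !mulmx0 raddf0.
  + rewrite -[z (inr c)]zE -[f (inl q')]Ef /= -mulmxA (mulmxA _ E0) nE0.
    by rewrite -!mulmxA (mulmxA (Ec c)) (star_Ec0 sd) mul0mx !mulmx0 raddf0.
  + case: (eqVneq c c') => [<-|cc'].
      rewrite zr // fr // eqxx; have [_ _ _ _ [zf _ _]] := wgP c l0.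
      exact: zf.
    rewrite (inj_eq (@inr_inj _ _)) (negPf cc').
    rewrite -[z (inr c)]zE -[f (inr c')]Ef /= -mulmxA (mulmxA _ (Ec c')) nEc.
    by rewrite -!mulmxA (mulmxA (Ec c)) (star_Ec sd) (negPf cc') mul0mx !mulmx0 raddf0.
- move=> q c /= l0; rewrite zl //; case: ifP => [l0'|].
    by rewrite zr //; have [_ _ _ _ [_ -> ]] := wgP c l0'.
  by rewrite lt0n => /negbFE/eqP c0; apply: j0.
- move=> c /= l0; rewrite fr //; have [_ _ _ _ [_ _ ->]] := wgP c l0.
  by apply: eq_bigr => q q0; rewrite fl //; have [_ ->] := FP q q0.
- by have [q q0] := exq; exists (inl q).
Qed.

(** * Systems with one chain at the center *)

Local Notation exists_chains :=
  (exists l z f M, chain_system l z f M).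

Lemma ord3_cases (c : 'I_3) : [\/ c = ord0, c = inord 1 | c = ord_max].
Proof.
case: c => [[|[|[|//]]] hc]; [constructor 1|constructor 2|constructor 3];
by apply/val_inj; rewrite /= ?inordK.
Qed.

(** The image of [v] in the leg [c] is the last vector of a chain of length [j], and
    [h] vanishes on the vectors sent deeper; these are the conditions under which
    the leg splits off together with [v]. *)
Definition leg_ok (c : 'I_3) (v : 'rV[k]_d) (h : 'cV[k]_d) (j : nat) : Prop :=
  (j = 0%N -> v *m (E0 *m e *m Ec c) = 0) /\
  ((0 < j)%N -> (exists w' : 'rV_d, v *m (E0 *m e *m Ec c) = w' *m n ^^ j.-1) /\
     forall u w' : 'rV_d, u *m (E0 *m e *m Ec c) = w' *m n ^^ j -> u *m h = 0).

Lemma chains_of_one_vector i (v : 'rV[k]_d) (h : 'cV[k]_d) (jc : 'I_3 -> nat) :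
  (0 < i)%N -> v *m E0 = v -> v *m n ^^ i = 0 -> E0 *m h = h -> n *m h = 0 ->
  (forall u : 'rV_d, u *m E0 = u -> u *m n ^^ i.-1 = 0 -> u *m h = 0) ->
  v *m h = 1%:M -> (forall c, leg_ok c v h (jc c)) -> exists_chains.
Proof.
move=> i0 vE vn Eh nh hk vh leg.
pose iq (q : 'I_2) := if q == ord0 then i else 0%N.
have iqP q : (0 < iq q)%N -> q = ord0 /\ iq q = i by rewrite /iq; case: eqP.
have ve c : v *m e *m Ec c = v *m (E0 *m e *m Ec c) by rewrite !mulmxA vE.
have sumH : \sum_(q | (0 < iq q)%N) (true : bool)%:R *: h = h.
  rewrite (big_pred1 ord0) ?scale1r // => q.
  by rewrite /iq /=; case: (q == ord0); rewrite ?i0.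
suff [l [z [f lzf]]] : exists l z f, chain_system l z f (fun _ _ => true).
  by exists l, z, f, (fun _ _ => true).
apply: (@chain_system_intro iq (fun=> v) (fun=> h) jc).
- by exists ord0.
- by move=> q /iqP[_ ->].
- by move=> q q' /iqP[-> _] /iqP[-> _].
- by move=> q c _ c0; rewrite ve; apply: (leg c).1.
- move=> c c0; have [[w' w'E] hL] := (leg c).2 c0.
  exists (v *m e *m Ec c), w', ord0; split=> //.
  + by rewrite ve.
  + by move=> q _; rewrite scale1r.
  + by move=> u w uw; rewrite sumH; apply: (hL _ w); rewrite -uw !mulmxA.
Qed.

Lemma mxiter_E0 i : n ^^ i *m E0 = E0 *m n ^^ i.
Proof. by apply: mxiter_comm; apply: (star_nE0 sd). Qed.

Lemma mxiter_Ec c i : n ^^ i *m Ec c = Ec c *m n ^^ i.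
Proof. by apply: mxiter_comm; apply: (star_nEc sd). Qed.

Lemma nilp_leg c : n *m (E0 *m e *m Ec c) = 0.
Proof. by rewrite !mulmxA (star_nE0 sd) -(mulmxA E0) (star_ne sd) mulmx0 mul0mx. Qed.

Lemma E0_leg c : E0 *m (E0 *m e *m Ec c) = E0 *m e *m Ec c.
Proof. by rewrite !mulmxA (star_E0 sd). Qed.

(** The vectors sent by a leg deeper than [v] form a subspace that does not contain
    [v]. *)
Lemma leg_form c (v : 'rV[k]_d) : v *m E0 = v -> v != 0 ->
  exists j h, [/\ E0 *m h = h, v *m h = 1%:M & leg_ok c v h j].
Proof.
move=> vE v0; set e' := E0 *m e *m Ec c.
have [ve|ve] := eqVneq (v *m e') 0.
  have [|h [_ vh]] := @separating_form k 1 d (0 : 'rV_d) v.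
    by apply: contraNN v0 => /submxP[D ->]; rewrite mulmx0.
  exists 0%N, (E0 *m h); split=> //; first by rewrite mulmxA (star_E0 sd).
  by rewrite mulmxA vE.
have [j [vj jmin]] : exists j, ~~ (v *m e' <= n ^^ j)%MS /\
    forall i, (i < j)%N -> ~ ~~ (v *m e' <= n ^^ i)%MS.
  by apply: nat_minimal; exists N; rewrite (star_nN sd) submx0.
have j0 : (0 < j)%N by case: j vj {jmin} => //; rewrite submx1.
have /negP/negPn/submxP[w' w'E] := jmin j.-1 (ltac:(by rewrite prednK)).
have [|h [Lh vh]] := @separating_form k d d (kermx (e' *m cokermx (n ^^ j))) v.
  by apply: contraNN vj => /sub_kermxP; rewrite submxE mulmxA => /eqP.
exists j, (E0 *m h); split; [by rewrite mulmxA (star_E0 sd)|by rewrite mulmxA vE|].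
split=> [j0'|_]; first by rewrite j0' in j0.
split; first by exists w'.
move=> u w uw; rewrite mulmxA.
have /submxP[D ->] : (u *m E0 <= kermx (e' *m cokermx (n ^^ j)))%MS.
  apply/sub_kermxP; rewrite (mulmxA (u *m E0)) -(mulmxA u) (E0_leg c : E0 *m e' = e') uw.
  apply/eqP.
  by rewrite -submxE submxMl.
by rewrite -mulmxA Lh mulmx0.
Qed.

Lemma leg_ok_ker c v h j (u : 'rV[k]_d) : leg_ok c v h j ->
  v *m (E0 *m e *m Ec c) != 0 -> u *m (E0 *m e *m Ec c) = 0 -> u *m h = 0.
Proof.
move=> [l0 lj] ve ue; case: (posnP j) => [/l0/eqP|/lj[_ hL]]; first by rewrite (negPf ve).
by apply: (hL u 0); rewrite mul0mx.
Qed.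

Lemma leg_ok0 c v h : v *m (E0 *m e *m Ec c) = 0 -> leg_ok c v h 0.
Proof. by []. Qed.

(** A cyclic submodule of maximal length over an algebra generated by one
    nilpotent operator is a direct summand. *)
Lemma max_order (E : 'M[k]_d) : n *m E = E *m n -> E *m E = E -> E != 0 ->
  exists i (v : 'rV[k]_d) (f : 'cV[k]_d),
  [/\ (0 < i)%N, E *m n ^^ i = 0, v *m E = v, E *m f = f & v *m n ^^ i.-1 *m f = 1%:M].
Proof.
move=> nE EE En0.
have [i [Ei imin]] : exists i, E *m n ^^ i = 0 /\ forall j, (j < i)%N -> E *m n ^^ j <> 0.
  by apply: nat_minimal; exists N; rewrite (star_nN sd) mulmx0.
have i0 : (0 < i)%N by case: i Ei {imin} => // /eqP; rewrite mulmx1 (negPf En0).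
have /eqP := imin i.-1 (ltac:(by rewrite prednK)); move/matrix0Pn => [a [b ab]].
exists i, (row a E), (((E *m n ^^ i.-1) a b)^-1 *: (E *m delta_mx b 0)); split=> //.
- by rewrite -row_mul EE.
- by rewrite -scalemxAr mulmxA EE.
rewrite -row_mul -scalemxAr mulmxA -row_mul -mulmxA (mxiter_comm _ nE) mulmxA EE.
rewrite -colE; apply/matrixP => r s; rewrite !ord1 [RHS]mxE eqxx.
by rewrite [LHS]mxE [X in _ * X]mxE [X in _ * X]mxE mulVf.
Qed.

Lemma chains_no_leg : E0 != 0 -> E0 *m e = 0 -> exists_chains.
Proof.
move=> E0n Ee.
have [i [v [f [i0 Ei vE Ef vf]]]] := max_order (star_nE0 sd) (star_E0 sd) E0n.
have Eni j : E0 *m (n ^^ j *m f) = n ^^ j *m f by rewrite mulmxA -mxiter_E0 -mulmxA Ef.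
apply: (@chains_of_one_vector i v (n ^^ i.-1 *m f) (fun=> 0%N)) => //.
- by rewrite -vE -mulmxA Ei mulmx0.
- by rewrite mulmxA -mxiterS prednK // -Eni mulmxA Ei mul0mx.
- by move=> u uE ui; rewrite mulmxA ui mul0mx.
- by rewrite mulmxA.
- by move=> c; apply: leg_ok0; rewrite Ee mul0mx mulmx0.
Qed.

(** Two filtrations of the center are compared: among the vectors not killed by
    the leg take one of least order under [n]. The form given by its depth in the
    leg then vanishes on all vectors of smaller order. *)
Lemma chains_one_leg : E0 != 0 -> (forall c, c != ord0 -> Ec c = 0) -> exists_chains.
Proof.
move=> E0n Ec0; have [|Ee] := eqVneq (E0 *m e) 0; first exact: chains_no_leg.
have EeE : E0 *m e *m Ec ord0 = E0 *m e.
  rewrite [RHS](star_E0e sd) (bigD1 ord0) //= big1 ?addr0 // => c c0.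
  by rewrite Ec0 ?mulmx0.
have [i [[v [vE vi ve]] imin]] : exists i,
    (exists v : 'rV_d, [/\ v *m E0 = v, v *m n ^^ i = 0 & v *m e != 0]) /\
    forall j, (j < i)%N ->
      ~ (exists v : 'rV_d, [/\ v *m E0 = v, v *m n ^^ j = 0 & v *m e != 0]).
  apply: nat_minimal; exists N.
  have /matrix0Pn[a [b ab]] := Ee; exists (row a E0); split.
  - by rewrite -row_mul (star_E0 sd).
  - by rewrite (star_nN sd) mulmx0.
  - by rewrite -row_mul; apply/rV0Pn; exists b; rewrite mxE.
have i0 : (0 < i)%N.
  case: i vi {imin} => // /eqP; rewrite mulmx1 => /eqP v0.
  by rewrite v0 mul0mx eqxx in ve.
have ve' : v *m (E0 *m e *m Ec ord0) = v *m e by rewrite EeE mulmxA vE.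
have v0 : v != 0 by apply: contraNneq ve => ->; rewrite mul0mx.
have [j [h [Eh vh lok]]] := leg_form ord0 vE v0.
have hker (u : 'rV_d) : u *m (E0 *m e *m Ec ord0) = 0 -> u *m h = 0.
  by apply: (leg_ok_ker lok); rewrite ve'.
apply: (@chains_of_one_vector i v h (fun c => if c == ord0 then j else 0%N)) => //.
- apply/row_matrixP => r; rewrite row_mul row0; apply: hker.
  by rewrite -row_mul nilp_leg row0.
- move=> u uE ui; apply: hker; rewrite EeE mulmxA uE; apply/eqP/negPn/negP => ue.
  by apply: (imin i.-1); [rewrite prednK|exists u].
- move=> c; case: eqVneq => [->//|c0]; apply: leg_ok0.
  by rewrite Ec0 // mulmx0 mulmx0.
Qed.

(** Two filtrations, given by the depths in the two legs: take a vector in the last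
    nonzero step of the first one. Every form satisfies the condition for the
    first leg, and the form given by the depth of the vector in the second leg
    satisfies the other. *)
Lemma chains_two_legs : E0 != 0 -> E0 *m n = 0 -> Ec ord_max = 0 -> exists_chains.
Proof.
move=> E0n En Ec2.
pose c1 : 'I_3 := inord 1.
have cP (c : 'I_3) : [\/ c = ord0, c = c1 | c = ord_max] := ord3_cases c.
have [v [j0 [vE v0 j00 j0P]]] : exists (v : 'rV[k]_d) j0,
    [/\ v *m E0 = v, v != 0, (j0 = 0%N -> v *m (E0 *m e *m Ec ord0) = 0)
      & ((0 < j0)%N -> (exists w' : 'rV_d, v *m (E0 *m e *m Ec ord0) = w' *m n ^^ j0.-1) /\
     forall u w' : 'rV_d, u *m (E0 *m e *m Ec ord0) = w' *m n ^^ j0 -> u *m E0 = 0)].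
  have [[v [vE v0 ve]]|no] := classic (exists v : 'rV[k]_d,
      [/\ v *m E0 = v, v != 0 & v *m (E0 *m e *m Ec ord0) = 0]).
    by exists v, 0%N.
  have [j [jP jmin]] : exists j, (forall u w' : 'rV_d,
       u *m (E0 *m e *m Ec ord0) = w' *m n ^^ j -> u *m E0 = 0) /\
     forall i, (i < j)%N -> ~ (forall u w' : 'rV_d,
       u *m (E0 *m e *m Ec ord0) = w' *m n ^^ i -> u *m E0 = 0).
    apply: nat_minimal; exists N => u w'; rewrite (star_nN sd) mulmx0 => ue.
    apply/eqP/negPn/negP => uE; apply: no; exists (u *m E0); split=> //.
      by rewrite -mulmxA (star_E0 sd).
    by rewrite -mulmxA E0_leg.
  have j0 : (0 < j)%N.
    case: j jP {jmin} => // jP; case/eqP: E0n; apply/row_matrixP => i.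
    rewrite rowE row0; apply: (jP _ (delta_mx 0 i *m (E0 *m e *m Ec ord0))).
    by rewrite mulmx1.
  have := jmin j.-1 (ltac:(by rewrite prednK)) => nP.
  have [u nu] := not_all_ex_not _ _ nP; have [w' nw] := not_all_ex_not _ _ nu.
  have [uw /eqP uE] := imply_to_and _ _ nw.
  exists (u *m E0), j; split=> //.
  - by rewrite -mulmxA (star_E0 sd).
  - by move=> jz; rewrite jz in j0.
  - by move=> _; split=> //; exists w'; rewrite -mulmxA E0_leg.
have [j1 [h [Eh vh lok]]] := leg_form c1 vE v0.
have c1n : (c1 == ord0) = false by rewrite -val_eqE /= inordK.
apply: (@chains_of_one_vector 1 v h (fun c => if c == ord0 then j0 else if c == c1 then j1 else 0%N)) => //.
- by rewrite /= mulmx1 -vE -mulmxA En mulmx0.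
- by rewrite -Eh mulmxA (star_nE0 sd) En mul0mx.
- by move=> u _ /=; rewrite mulmx1 => ->; rewrite mul0mx.
- move=> c; case: (cP c) => ->.
  + rewrite eqxx; split=> // /j0P[w' hL]; split=> // u w uw.
    by rewrite -Eh mulmxA (hL u w uw) mul0mx.
  + by rewrite c1n eqxx.
  + have -> : (ord_max == ord0 :> 'I_3) = false by [].
    have -> : (ord_max == c1) = false by rewrite -val_eqE /= inordK.
    by apply: leg_ok0; rewrite Ec2 !mulmx0.
Qed.

(** * Kernels of the legs and pairs of chains *)

Section KernelCases.
Hypothesis Ecn : forall c, Ec c *m n = 0.
Local Notation leg c := (E0 *m e *m Ec c).
Local Notation ker c := (kermx (leg c) *m E0).

(** Without loops at the ends of the legs, a leg amounts to its kernel, a subspace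
    of the center. *)
Lemma leg_deep0 c (u w : 'rV[k]_d) j : (0 < j)%N ->
  u *m leg c = w *m n ^^ j -> u *m leg c = 0.
Proof.
move=> j0 uw; rewrite -[leg c](_ : leg c *m Ec c = _); last first.
  by rewrite -mulmxA (star_Ec sd) eqxx.
rewrite mulmxA uw -(prednK j0) mxiterSr -!mulmxA (star_nEc sd) Ecn.
by rewrite !mulmx0.
Qed.

Lemma ker_P c (u : 'rV[k]_d) : (u <= ker c)%MS <-> u *m E0 = u /\ u *m leg c = 0.
Proof.
split=> [/submxP[D ->]|[uE ul]].
  split; first by rewrite -!mulmxA (star_E0 sd).
  by rewrite -(mulmxA D) -(mulmxA (kermx _) E0) E0_leg mulmx_ker mulmx0.
have /submxP[D uD] : (u <= kermx (leg c))%MS by apply/sub_kermxP.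
by rewrite -uE uD -mulmxA submxMl.
Qed.

Lemma ker_form c (h : 'cV[k]_d) (u : 'rV[k]_d) : ker c *m h = 0 -> u *m E0 = u -> u *m leg c = 0 ->
  u *m h = 0.
Proof.
move=> ch uE ul; have /submxP[D ->] : (u <= ker c)%MS by apply/ker_P.
by rewrite -mulmxA ch mulmx0.
Qed.

Lemma ker_leg c (h : 'cV[k]_d) : E0 *m h = h -> ker c *m h = 0 ->
  forall u : 'rV[k]_d, u *m leg c = 0 -> u *m h = 0.
Proof.
move=> Eh ch u ul; rewrite -Eh mulmxA; apply: (ker_form ch).
  by rewrite -mulmxA (star_E0 sd).
by rewrite -mulmxA E0_leg.
Qed.

Lemma leg_ok1 c v h : (forall u : 'rV_d, u *m leg c = 0 -> u *m h = 0) ->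
  leg_ok c v h 1.
Proof.
move=> hk; split=> // _; split; first by exists (v *m leg c); rewrite mulmx1.
by move=> u w uw; apply/hk/(leg_deep0 (j := 1) _ uw).
Qed.

Lemma ker_E0 c : ker c *m E0 = ker c.
Proof. by rewrite -mulmxA (star_E0 sd). Qed.

Lemma radical_ker c : (E0 *m n <= ker c)%MS.
Proof.
apply/row_subP => i; apply/ker_P; split.
  by rewrite -row_mul -mulmxA (star_nE0 sd) mulmxA (star_E0 sd).
by rewrite -row_mul -mulmxA nilp_leg mulmx0 row0.
Qed.

Lemma form_E0 (L : 'M[k]_d) (h : 'cV[k]_d) : L *m E0 = L -> L *m h = 0 -> L *m (E0 *m h) = 0.
Proof. by move=> LE Lh; rewrite mulmxA LE. Qed.

(** The summands with a plane at the center. The last leg kills [v], the first one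
    kills [v1] and the middle one identifies both vectors; [j2] tells whether the
    last leg is present. *)
Lemma chains_of_two_vectors i i1 (v v1 : 'rV[k]_d) (h h1 : 'cV[k]_d) (j2 : bool) :
  (0 < i)%N -> (0 < i1)%N ->
  [/\ v *m E0 = v, v *m n ^^ i = 0, E0 *m h = h, n *m h = 0 &
    forall u : 'rV_d, u *m E0 = u -> u *m n ^^ i.-1 = 0 -> u *m h = 0] ->
  [/\ v1 *m E0 = v1, v1 *m n ^^ i1 = 0, E0 *m h1 = h1, n *m h1 = 0 &
    forall u : 'rV_d, u *m E0 = u -> u *m n ^^ i1.-1 = 0 -> u *m h1 = 0] ->
  v *m h = 1%:M -> v1 *m h1 = 1%:M -> v *m h1 = 0 ->
  v1 *m leg ord0 = 0 -> ker ord0 *m h = 0 ->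
  (v - v1) *m leg (inord 1) = 0 -> ker (inord 1) *m (h + h1) = 0 ->
  v *m leg ord_max = 0 -> (if j2 then ker ord_max *m h1 = 0 else v1 *m leg ord_max = 0) ->
  exists_chains.
Proof.
move=> i0 i10 P P1 vh vh1 vh10 v1l lh vl lhh1 vl2 l2.
have v1h : v1 *m h = 0.
  by apply: (ker_form lh) v1l; case: P1.
pose iq (q : 'I_2) := if q == ord0 then i else i1.
pose vq (q : 'I_2) := if q == ord0 then v else v1.
pose hq (q : 'I_2) := if q == ord0 then h else h1.
pose jc (c : 'I_3) := if c == ord_max then (j2 : nat) else 1%N.
pose M (q : 'I_2) (c : 'I_3) := if q == ord0 then c != ord_max else c != ord0.
have iq0 q : (0 < iq q)%N by rewrite /iq; case: ifP.
have qP (q : 'I_2) : q = ord0 \/ q = ord_max.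
  by case: q => [[|[|//]] hc]; [left|right]; apply/val_inj.
have cP := ord3_cases.
have c1n : (inord 1 == ord0 :> 'I_3) = false by rewrite -val_eqE /= inordK.
have c1m : (inord 1 == ord_max :> 'I_3) = false by rewrite -val_eqE /= inordK.
have ve q c : vq q *m e *m Ec c = vq q *m leg c.
  by rewrite !mulmxA; congr (_ *m _ *m _); rewrite /vq; case: ifP => _; [case: P|case: P1].
have Eh : E0 *m h = h by case: P.
have Eh1 : E0 *m h1 = h1 by case: P1.
have v12 : v *m leg (inord 1) = v1 *m leg (inord 1).
  by apply/eqP; rewrite -subr_eq0 -mulmxBl vl.
have sumE c : \sum_(q | (0 < iq q)%N) (M q c)%:R *: hq q =
    (c != ord_max)%:R *: h + (c != ord0)%:R *: h1.
  rewrite (eq_bigl xpredT); last by move=> q; rewrite iq0.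
  by rewrite !big_ord_recl big_ord0 addr0.
suff [l [z [f lzf]]] : exists l z f, chain_system l z f M by exists l, z, f, M.
apply: (@chain_system_intro iq vq hq jc).
- by exists ord0.
- by move=> q _; case: (qP q) => ->.
- by move=> q q' _ _; case: (qP q) => ->; case: (qP q') => ->; rewrite /= ?raddf0.
- move=> q c _; rewrite /jc; case: eqP => // -> j20; rewrite ve.
  by case: (qP q) => -> //=; move: l2; case: (j2) j20.
- move=> c c0; have jc1 : jc c = 1%N by move: c0; rewrite /jc; case: eqP => //; case: (j2).
  rewrite jc1; case: (cP c) => cE; rewrite cE in c0 *.
  + exists (v *m leg ord0), (v *m leg ord0), ord0; split=> //; first by rewrite mulmx1.
      by move=> q _; rewrite ve; case: (qP q) => ->; rewrite /= ?scale1r ?scale0r.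
    move=> u w uw; rewrite sumE scale1r scale0r addr0.
    by apply: (ker_leg Eh lh); apply: (leg_deep0 (j := 1) _ (w := w)); rewrite // -uw !mulmxA.
  + exists (v *m leg (inord 1)), (v *m leg (inord 1)), ord0; split=> //.
    * by rewrite /M /= c1m.
    * by rewrite mulmx1.
    * move=> q _; rewrite ve; case: (qP q) => ->; rewrite /M /= ?c1m ?c1n scale1r //.
    move=> u w uw; rewrite sumE c1m c1n !scale1r.
    apply: (ker_leg _ lhh1); first by rewrite mulmxDr Eh Eh1.
    by apply: (leg_deep0 (j := 1) _ (w := w)); rewrite // -uw !mulmxA.
  + exists (v1 *m leg ord_max), (v1 *m leg ord_max), ord_max; split=> //.
    * by rewrite mulmx1.
    * by move=> q _; rewrite ve; case: (qP q) => ->; rewrite /= ?scale1r ?scale0r.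
    move=> u w uw; rewrite sumE scale1r scale0r add0r.
    move: c0 l2; rewrite /jc eqxx; case: (j2) => // _ l2.
    by apply: (ker_leg Eh1 l2); apply: (leg_deep0 (j := 1) _ (w := w)); rewrite // -uw !mulmxA.
Qed.

(** The values zero on [K0] and [- H] on [K1] agree on the intersection. *)
Lemma complementary_form (K0 K1 : 'M[k]_d) (H : 'cV[k]_d) :
  (forall u : 'rV_d, (u <= K0)%MS -> (u <= K1)%MS -> u *m H = 0) ->
  exists h : 'cV[k]_d, K0 *m h = 0 /\ K1 *m (h + H) = 0.
Proof.
move=> HK; have [h hE] : exists X, col_mx K0 K1 *m X = col_mx 0 (- (K1 *m H)).
  apply: factor_right => ab; rewrite -[ab]hsubmxK !mul_row_col mulmx0 add0r => /eqP.
  rewrite addrC addr_eq0 => /eqP ab0; rewrite mulmxN mulmxA HK ?oppr0 ?submxMl //.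
  by rewrite ab0 -mulNmx submxMl.
exists h; move: hE; rewrite mul_col_mx => /eq_col_mx[-> K1h]; split=> //.
by rewrite mulmxDr K1h addNr.
Qed.

(** Modulo the image of [n], the center carries the filtration by order and the
    kernels of the two legs. A vector of least order in the intersection of the
    kernels, or outside their sum, splits off. Otherwise the kernels are
    complementary modulo the image of [n]. A vector [v] of least order outside this
    image is then the sum of vectors of the two kernels; the component in the first
    kernel, corrected by the image of [n] to have least order, either has order at
    most that of [v] and splits off, or starts a second chain beside [v]. *)
Lemma chains_left_and_two_legs : E0 != 0 -> Ec ord_max = 0 -> exists_chains.
Proof.
move=> E0n Ec2; pose c1 : 'I_3 := inord 1.
have cP (c : 'I_3) : [\/ c = ord0, c = c1 | c = ord_max] := ord3_cases c.
have c1n : (c1 == ord0) = false by rewrite -val_eqE /= inordK.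
have leg2 : leg ord_max = 0 by rewrite Ec2 mulmx0.
have radE : E0 *m n *m E0 = E0 *m n.
  by rewrite -mulmxA (star_nE0 sd) mulmxA (star_E0 sd).
have nform (h : 'cV_d) : E0 *m h = h -> E0 *m n *m h = 0 -> n *m h = 0.
  by move=> Eh nh; rewrite -Eh mulmxA (star_nE0 sd).
have radker c (h : 'cV[k]_d) : ker c *m h = 0 -> E0 *m n *m h = 0.
  exact: submx_form (radical_ker c).
have mulE0 (h : 'cV[k]_d) : E0 *m (E0 *m h) = E0 *m h by rewrite mulmxA (star_E0 sd).
have pos (P : 'rV[k]_d -> Prop) i : ~ P 0 ->
    (exists u : 'rV[k]_d, [/\ u *m E0 = u, u *m n ^^ i = 0 & P u]) -> (0 < i)%N.
  by move=> P0 [u [_ ui Pu]]; case: i ui => //; rewrite mulmx1 => u0; rewrite u0 in Pu.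
pose lowers i := kermx (n ^^ i) *m E0.
have lowersP i (u : 'rV_d) : (u <= lowers i)%MS <-> u *m E0 = u /\ u *m n ^^ i = 0.
  split=> [/submxP[D ->]|[uE ui]].
    split; first by rewrite /lowers -!mulmxA (star_E0 sd).
    rewrite -(mulmxA D) /lowers -(mulmxA (kermx _) E0) -mxiter_E0.
    by rewrite (mulmxA (kermx _)) mulmx_ker mul0mx mulmx0.
  have /submxP[D uD] : (u <= kermx (n ^^ i))%MS by apply/sub_kermxP.
  by rewrite -uE uD -mulmxA submxMl.
have lowersE i : lowers i *m E0 = lowers i by rewrite -mulmxA (star_E0 sd).
have lform i (h : 'cV[k]_d) : lowers i *m h = 0 ->
    forall u : 'rV_d, u *m E0 = u -> u *m n ^^ i = 0 -> u *m h = 0.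
  move=> lh u uE ui; have /submxP[D ->] : (u <= lowers i)%MS by apply/lowersP.
  by rewrite -mulmxA lh mulmx0.
have ex_min (P : 'rV[k]_d -> Prop) : (exists u : 'rV[k]_d, u *m E0 = u /\ P u) ->
    exists i, (exists u : 'rV[k]_d, [/\ u *m E0 = u, u *m n ^^ i = 0 & P u]) /\
    forall j, (j < i)%N -> ~ exists u : 'rV[k]_d, [/\ u *m E0 = u, u *m n ^^ j = 0 & P u].
  move=> [u [uE Pu]]; apply: nat_minimal; exists N, u.
  by rewrite (star_nN sd) mulmx0.
(* A vector in both kernels, of least order outside the image of [n], starts a
   chain that no leg meets. *)
have [ex1|no1] := classic (exists u : 'rV[k]_d, u *m E0 = u /\
    [/\ (u <= ker ord0)%MS, (u <= ker c1)%MS & ~~ (u <= E0 *m n)%MS]).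
  have [i [exv imin]] := ex_min _ ex1.
  have i0 : (0 < i)%N by apply: (pos _ _ _ exv) => -[_ _]; rewrite sub0mx.
  have [v [vE vi [v0 v1 vn]]] := exv.
  have [|h [Lh vh]] := @separating_form k _ _ (E0 *m n + lowers i.-1)%MS v.
    apply/negP => /sub_addsmxP[[a b] /= vab].
    apply: (imin i.-1); first by rewrite prednK.
    have bl : (b *m lowers i.-1 <= lowers i.-1)%MS by apply: submxMl.
    have [bE bi] := (lowersP _ _).1 bl.
    have bv : b *m lowers i.-1 = v - a *m (E0 *m n) by rewrite vab [X in X - _]addrC addrK.
    have rk c : (a *m (E0 *m n) <= ker c)%MS by apply: (submx_trans (submxMl _ _) (radical_ker c)).
    exists (b *m lowers i.-1); split=> //; split.
    - by rewrite bv addmx_sub ?eqmx_opp.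
    - by rewrite bv addmx_sub ?eqmx_opp.
    - by apply: contraNN vn => bn; rewrite vab addmx_sub ?submxMl.
  have Lh1 : E0 *m n *m h = 0.
    by apply: submx_form Lh; rewrite addsmxSl.
  have Lh2 : lowers i.-1 *m h = 0.
    by apply: submx_form Lh; rewrite addsmxSr.
  apply: (@chains_of_one_vector i v (E0 *m h) (fun=> 0%N)) => //.
  - by apply: nform => //; apply: form_E0.
  - by apply: lform; apply: form_E0.
  - by rewrite mulmxA vE.
  - move=> c; apply: leg_ok0; case: (cP c) => ->; last by rewrite leg2 mulmx0.
      by have [] := (ker_P _ _).1 v0.
    by have [] := (ker_P _ _).1 v1.
have int (u : 'rV[k]_d) : (u <= ker ord0)%MS -> (u <= ker c1)%MS -> (u <= E0 *m n)%MS.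
  move=> u0 u1; apply/negPn/negP => un; apply: no1; exists u; split=> //.
  by have [] := (ker_P _ _).1 u0.
(* A vector of least order outside the sum of the kernels is met by both legs,
   and one form serves for both. *)
have [ex2|no2] := classic (exists u : 'rV[k]_d, u *m E0 = u /\ ~~ (u <= ker ord0 + ker c1)%MS).
  have [i [exv imin]] := ex_min _ ex2.
  have i0 : (0 < i)%N by apply: (pos _ _ _ exv) => /negP; rewrite sub0mx.
  have [v [vE vi vn]] := exv.
  have [h [Lh vh]] := separating_form vn.
  have Lh0 : ker ord0 *m h = 0.
    by apply: submx_form Lh; rewrite addsmxSl.
  have Lh1 : ker c1 *m h = 0.
    by apply: submx_form Lh; rewrite addsmxSr.
  have sumform (h' : 'cV[k]_d) (u : 'rV_d) : ker ord0 *m h' = 0 -> ker c1 *m h' = 0 ->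
      (u <= ker ord0 + ker c1)%MS -> u *m h' = 0.
    by move=> h0 h1 /sub_addsmxP[[a b] /= ->]; rewrite mulmxDl -!(mulmxA _ (ker _)) h0 h1 !mulmx0 addr0.
  have kform c : ker c *m h = 0 -> forall u : 'rV_d, u *m leg c = 0 -> u *m (E0 *m h) = 0.
    by move=> ch; apply: ker_leg => //; apply: form_E0 ch; apply: ker_E0.
  apply: (@chains_of_one_vector i v (E0 *m h)
     (fun c => if c == ord_max then 0%N else 1%N)) => //.
  - by apply: nform => //; apply: form_E0 => //; apply: (radker ord0).
  - move=> u uE ui; apply: sumform; [exact: form_E0 (ker_E0 _) Lh0|exact: form_E0 (ker_E0 _) Lh1|].
    apply/negPn/negP => un; apply: (imin i.-1); first by rewrite prednK.
    by exists u.
  - by rewrite mulmxA vE.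
  - move=> c; case: (cP c) => ->.
    + exact/leg_ok1/kform.
    + rewrite (_ : (c1 == ord_max) = false); last by rewrite -val_eqE /= inordK.
      exact/leg_ok1/kform.
    + by apply: leg_ok0; rewrite leg2 mulmx0.
have sumV (u : 'rV[k]_d) : u *m E0 = u -> (u <= ker ord0 + ker c1)%MS.
  by move=> uE; apply/negPn/negP => un; apply: no2; exists u.
have ex3 : exists u : 'rV[k]_d, u *m E0 = u /\ ~~ (u <= E0 *m n)%MS.
  apply: NNPP => no; have E0rad : (E0 <= E0 *m n)%MS.
    apply/row_subP => r; apply/negPn/negP => rn; apply: no; exists (row r E0).
    by rewrite -row_mul (star_E0 sd).
  have E0radm m : (E0 <= E0 *m n ^^ m)%MS.
    elim: m => [|m IH]; first by rewrite mulmx1.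
    by rewrite mxiterS mulmxA (submx_trans IH) // submxMr.
  by case/negP: E0n; have := E0radm N; rewrite (star_nN sd) mulmx0 submx0.
have [i [[v [vE vi vn]] imin]] := ex_min _ ex3.
have i0 : (0 < i)%N.
  apply: (pos (fun u => ~~ (u <= E0 *m n)%MS) i); last by exists v.
  by rewrite sub0mx.
have low (u : 'rV_d) : u *m E0 = u -> u *m n ^^ i.-1 = 0 -> (u <= E0 *m n)%MS.
  move=> uE ui; apply/negPn/negP => un; apply: (imin i.-1); first by rewrite prednK.
  by exists u.
have radform (h : 'cV[k]_d) (u : 'rV_d) : E0 *m n *m h = 0 -> (u <= E0 *m n)%MS -> u *m h = 0.
  by move=> nh un; apply: submx_form un nh.
(* A vector of least order lying in one kernel is met by the other leg only. *)
have single c c' (u : 'rV[k]_d) : c != c' -> c != ord_max -> c' != ord_max ->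
    u *m E0 = u -> u *m n ^^ i = 0 -> ~~ (u <= E0 *m n)%MS -> (u <= ker c)%MS -> exists_chains.
  move=> cc' cm c'm uE ui un uc.
  have uc' : ~~ (u <= ker c')%MS.
    apply: contraNN un => uc'; case: (cP c) cc' cm uc => ->; case: (cP c') c'm uc' => ->;
    rewrite ?eqxx //= => _ u1 _ _ u2; exact: int.
  have [h [Lh uh]] := separating_form uc'.
  have rh : E0 *m n *m (E0 *m h) = 0 by apply: form_E0 radE (radker c' _ Lh).
  apply: (@chains_of_one_vector i u (E0 *m h)
     (fun b => if b == c' then 1%N else 0%N)) => //.
  - exact: nform.
  - by move=> w wE wi; apply: radform rh (low _ wE wi).
  - by rewrite mulmxA uE.
  - move=> b; case: eqVneq => [->|bc'].
      by apply/leg_ok1/ker_leg => //; apply: form_E0 Lh; apply: ker_E0.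
    apply: leg_ok0; have [->|bm] := eqVneq b ord_max; first by rewrite leg2 mulmx0.
    have -> : b = c.
      case: (cP b) bc' bm => ->; case: (cP c) cc' cm {uc} => ->; case: (cP c') c'm {uc' Lh rh} => ->;
      by rewrite ?eqxx.
    by have [] := (ker_P _ _).1 uc.
have c1m : c1 != ord_max by rewrite -val_eqE /= inordK.
have [v0|v0] := boolP (v <= ker ord0)%MS.
  by apply: (single ord0 c1 v) => //; rewrite eq_sym c1n.
have [v1|v1] := boolP (v <= ker c1)%MS.
  by apply: (single c1 ord0 v) => //; rewrite c1n.
have /sub_addsmxP[[b0 b1] /= vb] := sumV v vE.
set a0 := b0 *m ker ord0 in vb; set a1 := b1 *m ker c1 in vb.
have a0k : (a0 <= ker ord0)%MS by apply: submxMl.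
have a1k : (a1 <= ker c1)%MS by apply: submxMl.
have [a0E _] := (ker_P _ _).1 a0k.
(* [w] is of least order in the coset of the first component [a0] modulo the
   image of [n]. *)
have [i1 [[w [wE wi1 [y wa0]]] i1min]] := ex_min (fun w => exists y, w = a0 + y *m (E0 *m n))
  (ex_intro _ a0 (conj a0E (ex_intro _ 0 (esym (etrans (congr1 _ (mul0mx _ _)) (addr0 _)))))).
have wk : (w <= ker ord0)%MS.
  by rewrite wa0 addmx_sub // (submx_trans (submxMl _ _)) // radical_ker.
have a0rad : ~~ (a0 <= E0 *m n)%MS.
  apply: contraNN v1 => a0n; rewrite vb addmx_sub //.
  exact: submx_trans a0n (radical_ker _).
have wrad : ~~ (w <= E0 *m n)%MS.
  apply: contraNN a0rad => wn.
  have -> : a0 = w - y *m (E0 *m n) by rewrite wa0 addrK.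
  by rewrite addmx_sub ?eqmx_opp ?submxMl.
have [i1i|ii1] := leqP i1 i.
  apply: (single ord0 c1 w) => //; first by rewrite eq_sym c1n.
  by rewrite -(subnKC i1i) mxiterD mulmxA wi1 mul0mx.
have i10 : (0 < i1)%N by apply: leq_ltn_trans ii1.
have [|H [LH wH]] := @separating_form k _ _ (E0 *m n + lowers i1.-1)%MS w.
  apply/negP => /sub_addsmxP[[a b] /= wab].
  apply: (i1min i1.-1); first by rewrite prednK.
  have bl : (b *m lowers i1.-1 <= lowers i1.-1)%MS by apply: submxMl.
  have [bE bi] := (lowersP _ _).1 bl.
  exists (b *m lowers i1.-1); split=> //; exists (y - a).
  by rewrite mulmxBl addrA -wa0 wab [X in X - _]addrC addrK.
have LH1 : E0 *m n *m H = 0.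
  by apply: submx_form LH; rewrite addsmxSl.
have LH2 : lowers i1.-1 *m H = 0.
  by apply: submx_form LH; rewrite addsmxSr.
pose h1 := E0 *m H; have Eh1 : E0 *m h1 = h1 by apply: mulE0.
have rad1 : E0 *m n *m h1 = 0 by apply: form_E0.
have low1 : lowers i1.-1 *m h1 = 0 by apply: form_E0.
have wh1 : w *m h1 = 1%:M by rewrite mulmxA wE.
have vh1 : v *m h1 = 0.
  apply: (lform i1.-1) => //; rewrite -(@subnKC i i1.-1) ?mxiterD ?mulmxA ?vi ?mul0mx //.
  by rewrite -ltnS prednK.
have [h0 [K0h K1h]] := @complementary_form (ker ord0) (ker c1) h1
  (fun u u0 u1 => radform h1 u rad1 (int u u0 u1)).
pose h := E0 *m h0; have Eh : E0 *m h = h by apply: mulE0.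
have K0h' : ker ord0 *m h = 0 by apply: form_E0 (ker_E0 _) K0h.
have K1h' : ker c1 *m (h + h1) = 0 by rewrite mulmxDr (mulmxA (ker c1)) ker_E0 -mulmxDr.
have wh : w *m h = 0 by apply: (ker_form K0h') => //; have [] := (ker_P _ _).1 wk.
have vwk : (v - w <= ker c1)%MS.
  have -> : v - w = a1 - y *m (E0 *m n) by rewrite vb wa0 [a0 + a1]addrC opprD addrA addrK.
  rewrite addmx_sub ?eqmx_opp //.
  exact: submx_trans (submxMl _ _) (radical_ker _).
have vh : v *m h = 1%:M.
  have /submxP[D vw] := vwk.
  have : (v - w) *m (h + h1) = 0 by rewrite vw -mulmxA K1h' mulmx0.
  rewrite mulmxBl !mulmxDr vh1 wh wh1 addr0 add0r => /eqP; rewrite subr_eq0 => /eqP ->.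
  by [].
have low0 (u : 'rV_d) : u *m E0 = u -> u *m n ^^ i.-1 = 0 -> u *m h = 0.
  by move=> uE ui; apply: radform (low u uE ui); apply: radker K0h'.
apply: (@chains_of_two_vectors i i1 v w h h1 false) => //.
- by split=> //; apply: nform => //; apply: radker K0h'.
- by split=> //; [apply: nform|apply: lform].
- by have [] := (ker_P _ _).1 wk.
- by have [] := (ker_P _ _).1 vwk.
- by rewrite leg2 mulmx0.
- by rewrite leg2 mulmx0.
Qed.

(** Three subspaces, the kernels of the legs. A vector in two of them, or in one and
    outside the sum of the other two, or outside the sum of all three, splits off.
    Otherwise any two of the kernels are complementary, and a nonzero vector of
    the third together with its component in the first spans the center of a
    summand. *)
Lemma chains_three_legs : E0 != 0 -> E0 *m n = 0 -> exists_chains.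
Proof.
move=> E0n En; pose c1 : 'I_3 := inord 1.
have mulE0 (h : 'cV[k]_d) : E0 *m (E0 *m h) = E0 *m h by rewrite mulmxA (star_E0 sd).
have nform (h : 'cV[k]_d) : E0 *m h = h -> n *m h = 0.
  by move=> <-; rewrite mulmxA (star_nE0 sd) En mul0mx.
have vn1 (v : 'rV[k]_d) : v *m E0 = v -> v *m n ^^ 1 = 0.
  by move=> <-; rewrite /= mulmx1 -mulmxA En mulmx0.
have low0 (u : 'rV[k]_d) (h : 'cV[k]_d) : u *m n ^^ (1%N).-1 = 0 -> u *m h = 0.
  by rewrite mulmx1 => ->; rewrite mul0mx.
have single (v : 'rV[k]_d) (h : 'cV[k]_d) : v *m E0 = v -> v *m h = 1%:M ->
    (forall c, v *m leg c != 0 -> ker c *m h = 0) -> exists_chains.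
  move=> vE vh hk; apply: (@chains_of_one_vector 1 v (E0 *m h)
     (fun c => if v *m leg c == 0 then 0%N else 1%N)) => //.
  - exact: vn1.
  - exact: nform.
  - by move=> u _; apply: low0.
  - by rewrite mulmxA vE.
  - move=> c; case: eqVneq => [vc|vc]; first exact: leg_ok0.
    by apply/leg_ok1/ker_leg => //; apply: form_E0 (ker_E0 _) (hk c vc).
have inE0 c (u : 'rV[k]_d) : (u <= ker c)%MS -> u *m E0 = u /\ u *m leg c = 0.
  by move=> /ker_P.
have killed := @submx_form k d d d.
have pair c c' c'' (v : 'rV[k]_d) : (forall b, [\/ b = c, b = c' | b = c'']) ->
    (v <= ker c)%MS -> (v <= ker c')%MS -> v != 0 -> exists_chains.
  move=> cP /inE0[vE vc] /inE0[_ vc'] v0; have [v''|v''] := eqVneq (v *m leg c'') 0.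
    have [j [h [_ vh _]]] := leg_form c'' vE v0.
    by apply: (single v h) => // b; case: (cP b) => ->; rewrite ?vc ?vc' ?v'' eqxx.
  have [|h [Lh vh]] := @separating_form k _ _ (ker c'') v.
    by apply: contraNN v'' => /inE0[_ ->].
  by apply: (single v h) => // b; case: (cP b) => ->; rewrite ?vc ?vc' ?eqxx.
have over c c' c'' (v : 'rV[k]_d) : (forall b, [\/ b = c, b = c' | b = c'']) ->
    (v <= ker c)%MS -> ~~ (v <= ker c' + ker c'')%MS -> exists_chains.
  move=> cP /inE0[vE vc] /separating_form[h [Lh vh]].
  apply: (single v h) => // b; case: (cP b) => -> bn; first by rewrite vc eqxx in bn.
    by apply: killed Lh; rewrite addsmxSl.
  by apply: killed Lh; rewrite addsmxSr.
have cP (c : 'I_3) : [\/ c = ord0, c = c1 | c = ord_max] := ord3_cases c.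
have cP1 (c : 'I_3) : [\/ c = c1, c = ord0 | c = ord_max].
  by case: (cP c) => ->; [constructor 2|constructor 1|constructor 3].
have cP2 (c : 'I_3) : [\/ c = ord_max, c = ord0 | c = c1].
  by case: (cP c) => ->; [constructor 2|constructor 3|constructor 1].
have cP3 (c : 'I_3) : [\/ c = ord0, c = ord_max | c = c1].
  by case: (cP c) => ->; [constructor 1|constructor 3|constructor 2].
have cP4 (c : 'I_3) : [\/ c = c1, c = ord_max | c = ord0].
  by case: (cP c) => ->; [constructor 3|constructor 1|constructor 2].
have [//|nochain] := classic exists_chains.
have disj c c' c'' (v : 'rV[k]_d) : (forall b, [\/ b = c, b = c' | b = c'']) ->
    (v <= ker c)%MS -> (v <= ker c')%MS -> v = 0.
  move=> bP vc vc'; apply/eqP/negPn/negP => v0; apply: nochain; exact: (pair c c' c'' v).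
have inside c c' c'' (v : 'rV[k]_d) : (forall b, [\/ b = c, b = c' | b = c'']) ->
    (v <= ker c)%MS -> (v <= ker c' + ker c'')%MS.
  move=> bP vc; apply/negPn/negP => vn; apply: nochain; exact: (over c c' c'' v).
have all3 (v : 'rV[k]_d) : v *m E0 = v -> (v <= ker ord0 + ker c1 + ker ord_max)%MS.
  move=> vE; apply/negPn/negP => /separating_form[h [Lh vh]]; apply: nochain.
  apply: (single v h) => // b _; apply: killed Lh; case: (cP b) => ->.
  - by rewrite (submx_trans (addsmxSl _ (ker c1))) // addsmxSl.
  - by rewrite (submx_trans (addsmxSr (ker ord0) _)) // addsmxSl.
  - by rewrite addsmxSr.
have [v [vm v0]] : exists v : 'rV[k]_d, (v <= ker ord_max)%MS /\ v != 0.
  apply: NNPP => no; case/eqP: E0n; apply/row_matrixP => r; rewrite row0.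
  have z0 (u : 'rV[k]_d) : (u <= ker ord_max)%MS -> u = 0.
    by move=> um; apply/eqP/negPn/negP => u0; apply: no; exists u.
  have zero c c' (u : 'rV[k]_d) : (forall b, [\/ b = c, b = c' | b = ord_max]) ->
      (u <= ker c)%MS -> u = 0.
    move=> bP uc; apply: (disj c c' ord_max) => //.
    have /sub_addsmxP[[a b] /= ->] := inside _ _ _ _ bP uc.
    by rewrite (z0 (b *m _)) ?submxMl // addr0 submxMl.
  have /sub_addsmxP[[a b] /= ->] : (row r E0 <= ker ord0 + ker c1 + ker ord_max)%MS.
    by apply: all3; rewrite -row_mul (star_E0 sd).
  rewrite (z0 (b *m _)) ?submxMl // addr0.
  have /sub_addsmxP[[a' b'] /= ->] : (a *m (ker ord0 + ker c1)%MS <= ker ord0 + ker c1)%MS.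
    exact: submxMl.
  have -> : a' *m ker ord0 = 0 by apply: (zero ord0 c1 _ cP); apply: submxMl.
  have -> : b' *m ker c1 = 0 by apply: (zero c1 ord0 _ cP1); apply: submxMl.
  by rewrite addr0.
have /sub_addsmxP[[b0 b1] /= vb] := inside ord_max ord0 c1 v cP2 vm.
set a0 := b0 *m ker ord0 in vb; set a1 := b1 *m ker c1 in vb.
have a0k : (a0 <= ker ord0)%MS by apply: submxMl.
have a1k : (a1 <= ker c1)%MS by apply: submxMl.
have a00 : a0 != 0.
  apply: contraNneq v0 => a00; apply/eqP; apply: (disj c1 ord_max ord0) => //.
  by rewrite vb a00 add0r.
have [|H [LH aH]] := @separating_form k _ _ (ker ord_max) a0.
  by apply: contraNN a00 => am; apply/eqP; apply: (disj ord0 ord_max c1).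
have [vE vl] := inE0 _ _ vm; have [a0E a0l] := inE0 _ _ a0k.
pose h1 := E0 *m H; have Eh1 : E0 *m h1 = h1 by apply: mulE0.
have mh1 : ker ord_max *m h1 = 0 by apply: form_E0 (ker_E0 _) LH.
have [h0 [K0h K1h]] := @complementary_form (ker ord0) (ker c1) h1
  (fun u u0 u1 => etrans (congr1 (mulmx^~ h1) (disj ord0 c1 ord_max u cP u0 u1)) (mul0mx _ _)).
pose h := E0 *m h0; have Eh : E0 *m h = h by apply: mulE0.
have K0h' : ker ord0 *m h = 0 by apply: form_E0 (ker_E0 _) K0h.
have K1h' : ker c1 *m (h + h1) = 0 by rewrite mulmxDr (mulmxA (ker c1)) ker_E0 -mulmxDr.
have ah1 : a0 *m h1 = 1%:M by rewrite mulmxA a0E.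
have ah : a0 *m h = 0 by apply: (ker_form K0h').
have vh1 : v *m h1 = 0 by apply: (ker_form mh1).
have va : (v - a0 <= ker c1)%MS by rewrite vb addrC addKr.
have vh : v *m h = 1%:M.
  have /submxP[D vw] := va.
  have : (v - a0) *m (h + h1) = 0 by rewrite vw -mulmxA K1h' mulmx0.
  by rewrite mulmxBl !mulmxDr vh1 ah ah1 addr0 add0r => /eqP; rewrite subr_eq0 => /eqP.
apply: (@chains_of_two_vectors 1 1 v a0 h h1 true) => //.
- by split=> //; [apply: vn1|apply: nform|move=> u _; apply: low0].
- by split=> //; [apply: vn1|apply: nform|move=> u _; apply: low0].
- by have [] := inE0 _ _ va.
Qed.

End KernelCases.

(** * Bases made of chains *)

Lemma chains_no_center : E0 = 0 -> Ec ord0 != 0 ->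
  exists_chains.
Proof.
move=> E00 En0.
have EE : Ec ord0 *m Ec ord0 = Ec ord0 by rewrite (star_Ec sd).
have [i [v [g [i0 Ei vE Eg vg]]]] := max_order (star_nEc sd ord0) EE En0.
pose l (j : 'I_2 + 'I_3) := if j == inr ord0 then i else 0%N.
pose z (j : 'I_2 + 'I_3) := if j == inr ord0 then v else 0.
pose f (j : 'I_2 + 'I_3) := if j == inr ord0 then g else 0.
have lP j : (0 < l j)%N -> j = inr ord0 by rewrite /l; case: eqP.
exists l, z, f, (fun _ _ => true); split.
- by move=> j; rewrite /z; case: eqP => [->|] //; rewrite mul0mx.
- by move=> j; rewrite /f; case: eqP => [->|] //; rewrite mulmx0.
- by move=> j; rewrite /z /l; case: eqP => [_|]; rewrite ?mul0mx // -vE -mulmxA Ei mulmx0.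
- move=> j; rewrite /f /l; case: eqP => [_|]; rewrite ?mulmx0 //.
  by rewrite -Eg mulmxA mxiter_Ec Ei mul0mx.
- by move=> j j' /lP-> /lP->; rewrite /z /f /l eqxx.
- by move=> q c /lP.
- move=> c _; rewrite E00 !mul0mx big1 // => q /lP //.
- by exists (inr ord0); rewrite /l eqxx.
Qed.
Section ChainBasis.
Variable C : finCat.
Variables (R : allmor C -> 'M[k]_d) (hR : is_rep R).
Hypothesis ind : indecomposable (repmod hR).
Variables (J : finType) (ap : J -> catalg k C) (anu aeps : catalg k C).
Local Notation T5 := ('I_2 + 'I_3)%type.
Let gens (j : J + bool) := match j with inl j => ap j | inr b => if b then anu else aeps end.
Hypothesis gen : generates gens.
Hypothesis Rnu : rep_alg R anu = n.
Hypothesis Reps : rep_alg R aeps = e.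
Let E (i : T5) := if i is inr c then Ec c else E0.
Variable lam : T5 -> J -> k.
Hypothesis Elam : forall i j, E i *m rep_alg R (ap j) = lam i j *: E i /\
  rep_alg R (ap j) *m E i = lam i j *: E i.
Variable S : seq k.
Hypotheses (S0 : 0 \in S) (S1 : 1 \in S) (Slam : forall i j, lam i j \in S).

(** The span of the chains is a nonzero summand of an indecomposable module, hence
    all of it; in the basis of the chains the generators have entries zero, one,
    or an eigenvalue. Positions along the chains order the pairing of vectors and
    forms into a unitriangular matrix. *)
Lemma bounded_basis l z f M : chain_system l z f M ->
  exists r R' (hR' : @is_rep k C r R'),
   [/\ (r <= 5 * N)%N, lmod_iso (repmod hR) (repmod hR')
     & forall j i i', rep_alg R' (gens j) i i' \in S].
Proof.
move=> cs; have [zE Ef zn nf zf ze ef [i0 i0l]] := cs.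
pose I : finType := {i : T5 & 'I_(l i)}.
pose s (u : I) := z (tag u) *m n ^^ (tagged u).
pose t (u : I) := n ^^ (l (tag u) - (tagged u).+1) *m f (tag u).
have lpos (u : I) : (0 < l (tag u))%N by apply: leq_ltn_trans (ltn_ord (tagged u)).
have zdeep i m : (l i <= m)%N -> z i *m n ^^ m = 0.
  by move=> lm; rewrite -(subnKC lm) mxiterD mulmxA zn mul0mx.
have fdeep i m : (l i <= m)%N -> n ^^ m *m f i = 0.
  by move=> lm; rewrite -(subnK lm) mxiterD -mulmxA nf mulmx0.
have nE i m : n ^^ m *m E i = E i *m n ^^ m by case: i => [q|c]; [exact: mxiter_E0 m|exact: mxiter_Ec c m].
have st1 u : s u *m t u = 1%:M.
  rewrite /s /t mulmxA -(mulmxA (z _)) -mxiterD addnBA ?ltn_ord // subnS addKn.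
  by rewrite zf ?lpos // eqxx.
have st0 (u v : I) : u != v -> (tagged v <= tagged u)%N -> s u *m t v = 0.
  move=> uv; rewrite leq_eqVlt => /orP[/eqP e1|lt]; rewrite /s /t mulmxA -(mulmxA (z _)) -mxiterD.
    rewrite -e1 addnBA ?ltn_ord // subnS addKn zf ?lpos // (_ : _ == _ = false) ?raddf0 //.
    apply: contraNF uv => /eqP tuv.
    case: u v e1 tuv => [iu pu] [iv pv] /= e1 tuv; subst iv.
    by rewrite eq_Tagged /= -val_eqE /= e1.
  rewrite -mulmxA fdeep ?mulmx0 // -{1}(subnKC (ltn_ord (tagged v))) leq_add2r.
  exact: lt.
have bigI m1 m2 (F : forall i, 'I_(l i) -> 'M[k]_(m1, m2)) :
    \sum_(v : I) F (tag v) (tagged v) = \sum_i \sum_(m < l i) F i m.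
  by rewrite (sig_big_dep xpredT (fun _ => xpredT) F).
have pick m1 m2 (g : T5 -> nat -> 'M[k]_(m1, m2)) i m0 :
    \sum_(v : I) ((tag v == i) && (tagged v == m0 :> nat))%:R *: g (tag v) (tagged v)
    = if (m0 < l i)%N then g i m0 else 0.
  rewrite (bigI _ _ (fun j m => ((j == i) && (m == m0 :> nat))%:R *: g j m)).
  rewrite (bigD1 i) //= [X in _ + X]big1 ?addr0; last first.
    by move=> j /negPf ji; rewrite big1 // => m _; rewrite ji scale0r.
  case: ltnP => h; last first.
    rewrite big1 // => m _; rewrite eqxx; case: eqP => [mm|_]; last by rewrite scale0r.
    by have := ltn_ord m; rewrite mm ltnNge h.
  rewrite (bigD1 (Ordinal h)) //= !eqxx scale1r big1 ?addr0 // => m.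
  by rewrite -val_eqE /= => /negPf->; rewrite ?andbF /= scale0r.
have diag m1 m2 (g : I -> 'M[k]_(m1, m2)) (b : k) u :
    \sum_v ((u == v)%:R * b) *: g v = b *: g u.
  rewrite (bigD1 u) //= eqxx mul1r big1 ?addr0 // => v vu.
  by rewrite eq_sym (negPf vu) mul0r scale0r.
pose cf (j : J + bool) (u v : I) : k := match j with
  | inl j => (u == v)%:R * lam (tag u) j
  | inr true => ((tag v == tag u) && (tagged v == (tagged u).+1 :> nat))%:R
  | inr false => if (tag u, tag v) is (inl q, inr c) then
      [&& tagged u == 0 :> nat, tagged v == (l (tag v)).-1 :> nat & M q c]%N%:R else 0
  end.
pose ct (j : J + bool) (u v : I) : k := match j with
  | inl j => (u == v)%:R * lam (tag u) j
  | inr true => ((tag v == tag u) && ((tagged v).+1 == tagged u :> nat))%:R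
  | inr false => if (tag u, tag v) is (inr c, inl q) then
      [&& tagged v == 0 :> nat, tagged u == (l (tag u)).-1 :> nat & M q c]%N%:R else 0
  end.
have zE' i : z i *m E i = z i by case: i (zE i).
have Ef' i : E i *m f i = f i by case: i (Ef i).
have hs j u : s u *m rep_alg R (gens j) = \sum_v cf j u v *: s v.
  case: j => [j|[]] /=.
  - rewrite diag /s -{1}(zE' (tag u)) -(mulmxA (z _)) -nE mulmxA -mulmxA.
    by rewrite (Elam _ _).1 -scalemxAr -mulmxA nE mulmxA zE'.
  - rewrite Rnu (pick _ _ (fun i m => z i *m n ^^ m) (tag u) (tagged u).+1) /s.
    rewrite -mulmxA -mxiterSr; case: ltnP => // h.
    exact: zdeep.
  - rewrite Reps; case: u => [[q|c] [m hm]]; rewrite /s /=; last first.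
      rewrite big1 => [|v _]; last by rewrite scale0r.
      by rewrite -(zE' (inr c)) -(mulmxA (z _)) -nE -!mulmxA (star_Ece sd) !mulmx0.
    rewrite (bigI _ _ (fun i p => (match i with inl _ => 0 | inr c =>
         [&& m == 0, p == (l i).-1 :> nat & M q c]%N%:R end) *: (z i *m n ^^ p))).
    rewrite big_sumType /= [X in X + _]big1 ?add0r; last first.
      by move=> r _; rewrite big1 // => p _; rewrite scale0r.
    case: m hm => [|m] hm /=; last first.
      rewrite -mulmxA -mxiterS mxiterSr -mulmxA (star_ne sd) !mulmx0.
      by rewrite big1 // => c _; rewrite big1 // => p _; rewrite scale0r.
    rewrite mulmx1 -{1}(zE' (inl q)) /= -mulmxA (star_E0e sd) mulmx_sumr.
    apply: eq_bigr => c _; rewrite !mulmxA (zE' (inl q)) ze //.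
    case: ifP => l0; last first.
      by rewrite big1 // => p _; have := leq_ltn_trans (leq0n _) (ltn_ord p); rewrite l0.
    have hl : ((l (inr c)).-1 < l (inr c))%N by rewrite prednK.
    rewrite (bigD1 (Ordinal hl)) //= eqxx /= big1 ?addr0 // => p.
    by rewrite -val_eqE /= => /negPf->; rewrite scale0r.
have ht j u : rep_alg R (gens j) *m t u = \sum_v ct j u v *: t v.
  case: j => [j|[]] /=.
  - rewrite diag /t -{1}(Ef' (tag u)) (mulmxA (n ^^ _)) nE !mulmxA.
    by rewrite (Elam _ _).2 -!scalemxAl -(nE _ _) -!mulmxA Ef'.
  - rewrite Rnu /t mulmxA -mxiterS subnSK ?ltn_ord //; case: u => [i [[|m] hm]] /=.
      by rewrite subn0 nf big1 // => v _; rewrite andbF scale0r.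
    rewrite (pick _ _ (fun i p => n ^^ (l i - p.+1) *m f i) i m).
    by rewrite (ltnW hm).
  - rewrite Reps; case: u => [[q|c] [m hm]]; rewrite /t /=.
      rewrite big1 => [|v _]; last by rewrite scale0r.
      by rewrite -(Ef' (inl q)) (mulmxA (n ^^ _)) nE !mulmxA (star_eE0 sd) !mul0mx.
    rewrite (bigI _ _ (fun i p => (match i with inr _ => 0 | inl q =>
         [&& p == 0 :> nat, m == (l (inr c)).-1 & M q c]%N%:R end) *:
           (n ^^ (l i - p.+1) *m f i))).
    rewrite big_sumType /= [X in _ + X]big1 ?addr0; last first.
      by move=> r _; rewrite big1 // => p _; rewrite scale0r.
    case: (eqVneq m (l (inr c)).-1) => [me|mn]; last first.
      rewrite [RHS]big1 => [|q _]; last by rewrite big1 // => p _; rewrite andbF scale0r.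
      have : (0 < l (inr c) - m.+1)%N.
        rewrite subn_gt0 ltn_neqAle hm andbT; apply: contraNneq mn => <-.
        by [].
      case: (l (inr c) - m.+1)%N => // a _.
      by rewrite mxiterS !mulmxA (star_en sd) !mul0mx.
    have -> : (l (inr c) - m.+1 = 0)%N by rewrite me prednK ?subnn //; apply: leq_ltn_trans hm.
    rewrite mul1mx -(Ef' (inr c)) /= mulmxA (star_eEc sd) -mulmxA (Ef' (inr c)) ef; last first.
      exact: leq_ltn_trans hm.
    rewrite big_mkcond; apply: eq_bigr => q _; case: ifP => l0; last first.
      by rewrite big1 // => p _; have := leq_ltn_trans (leq0n _) (ltn_ord p); rewrite l0.
    rewrite (bigD1 (Ordinal l0)) //= subn1 big1 ?addr0 // => p.
    by rewrite -val_eqE /= => /negPf->; rewrite scale0r.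
have [R' [hR' [iso eR']]] := split_basis (Tagged (fun i => 'I_(l i)) (Ordinal i0l) : I) gen ind
  st1 st0 hs ht.
exists #|I|, R', hR'; split=> //; last first.
  move=> j p p'; rewrite eR' mxE /cf; case: j => [j|[]].
  - by case: eqP => _; rewrite ?mul1r ?mul0r.
  - by case: (_ && _).
  - case: (enum_val p) => [[q|c] m]; case: (enum_val p') => [[q'|c'] m'] //=.
    by case: [&& _, _ & _].
rewrite card_tagged sumnE big_map big_enum /=.
have lN i : (l i <= N)%N.
  case: (posnP (l i)) => [->//|li]; have := zf i i li li; rewrite eqxx => zf1.
  rewrite -(prednK li); apply: (@lt_nilp (z i)).
  apply: contraTneq isT => z0; move: zf1; rewrite z0 mul0mx => /matrixP/(_ 0 0).
  by rewrite !mxE eqxx => /eqP; rewrite eq_sym oner_eq0.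
apply: (leq_trans (n := \sum_(i : T5) N)).
  by apply: leq_sum => i _; rewrite card_ord.
by rewrite sum_nat_const card_sum !card_ord.
Qed.
End ChainBasis.

End StarData.

(** * Sufficiency of the conditions *)

Lemma mxiterE (k : fieldType) d (n : 'M[k]_d) i : iter i (mulmx n) 1%:M = n ^+ i.
Proof. by elim: i => [|i IH] //=; rewrite IH exprS. Qed.

(** The Frobenius map is additive on commuting matrices. *)
Lemma unipotent_nilpotent (k : fieldType) (p d m : nat) (U : 'M[k]_d) :
  p \in [pchar k] -> U ^+ (p ^ m) = 1 -> (U - 1) ^+ (p ^ m) = 0.
Proof.
case: d U => [|d] U pk UN; first by apply/matrixP => -[].
have pM : p \in [pchar 'M[k]_d.+1] by rewrite pchar_lalg.
have -> : (U - 1) ^+ (p ^ m) = U ^+ (p ^ m) - 1.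
  elim: m {UN} => [|m IH]; first by rewrite !expr1.
  rewrite expnSr !exprM IH -!(pFrobenius_autE pM) pFrobenius_autB_comm ?pFrobenius_aut1 //.
  exact: commr1.
by rewrite UN subrr.
Qed.

(** A matrix commuting with a family preserves its joint eigenspaces. *)
Lemma joint_projector_comm (k : fieldType) (J : finType) d (f : J -> 'M[k]_d)
  (s : seq {ffun J -> k}) (E : {ffun J -> k} -> 'M[k]_d) (M : 'M[k]_d) :
  uniq s -> \sum_(t <- s) E t = 1%:M -> (forall t, (E t != 0) = (t \in s)) ->
  (forall t j, f j *m E t = t j *: E t /\ E t *m f j = t j *: E t) ->
  (forall j, M *m f j = f j *m M) -> forall t, M *m E t = E t *m M.
Proof.
move=> us sE Es fE Mf t.
have off r u : r != u -> E r *m M *m E u = 0.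
  move=> ru; have [j rj] : exists j, r j != u j.
    apply: NNPP => no; case/eqP: ru; apply/ffunP => j; apply/eqP/negPn/negP => rj.
    by apply: no; exists j.
  have : r j *: (E r *m M *m E u) = u j *: (E r *m M *m E u).
    rewrite !scalemxAl -(fE r j).2 -(mulmxA _ (f j)) -Mf !mulmxA.
    by rewrite -(mulmxA _ (f j)) (fE u j).1 -!scalemxAr -!scalemxAl.
  move/eqP; rewrite -subr_eq0 -scalerBl scaler_eq0 subr_eq0 (negPf rj) /=.
  by move/eqP.
have [ts|] := boolP (t \in s); last first.
  by rewrite -Es negbK => /eqP ->; rewrite mulmx0 mul0mx.
transitivity (E t *m M *m E t).
  rewrite -[M *m E t]mul1mx -sE mulmx_suml (bigD1_seq t) //= big1 ?addr0 ?mulmxA //.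
  by move=> r rt; rewrite mulmxA off.
rewrite -[E t *m M in RHS]mulmx1 -sE mulmx_sumr (bigD1_seq t) //= big1 ?addr0 //.
by move=> r rt; rewrite off // eq_sym.
Qed.

Section Sufficiency.
Variables (k : closedFieldType) (p : nat) (C : finEICat) (x y : ob C).
Hypotheses (hp : has_char p k) (hxy : x != y) (hob : forall z : ob C, z = x \/ z = y)
  (hyx : #|mor y x| = 0%N).
Variable alpha : mor x y.
Hypothesis htrans : forall a b : mor x y, exists h : endo y, b = ccomp h a.
Hypotheses (hGab : abelian [set: endo x]) (hHab : abelian [set: endo y]).
Hypotheses (trG : acts_trivially_right y (Op' p [set: endo x]))
  (trH : acts_trivially_left x (Op' p [set: endo y])).
Local Notation A := (catalg k C).
Local Notation H1 := (stab_right_orbit alpha).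
Variables (u : endo x) (w : endo y).
Hypotheses (hu : Op' p [set: endo x] = <[u]>%g) (hw : Op' p [set: endo y] = <[w]>%g).

Definition p'part (j : endo x + endo y) : A := match j with
  | inl g => kmor k ((g.`_p^')%g : mor x x)
  | inr h => kmor k ((h.`_p^')%g : mor y y)
  end.
(** Both loops in one operator: it acts as [u - 1] at [x] and as [w - 1] at [y]. *)
Definition nil_gen : A := kmor k (u : mor x x) + kmor k (w : mor y y) - 1.
Definition algebra_gens (j : (endo x + endo y) + bool) : A :=
  match j with inl j => p'part j | inr b => if b then nil_gen else kmor k alpha end.

Lemma kmorM (z : ob C) (g h : endo z) :
  kmor k (g : mor z z) * kmor k (h : mor z z) = kmor k ((g * h)%g : mor z z).
Proof. exact: kmor_mul. Qed.

Lemma one_kmor : (1 : A) = kmor k ((1%g : endo x) : mor x x) + kmor k ((1%g : endo y) : mor y y).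
Proof.
have -> : (1 : A) = \sum_(z : ob C) kmor k (idmor z) by [].
rewrite (bigD1 x) //= (bigD1 y) 1?eq_sym //= big1 ?addr0 // => z /andP[zx zy].
by case: (hob z) => e; rewrite e eqxx in zx zy.
Qed.

Lemma algebra_gens_generate : generates algebra_gens.
Proof.
move=> P Pg P1 PD PM.
have PN a : P a -> P (- a).
  move=> Pa; have P0 : P 0 by have := PD (-1) 1 1 P1 P1; rewrite scaleN1r addNr.
  by have := PD (-1) a 0 Pa P0; rewrite scaleN1r addr0.
have Padd a b : P a -> P b -> P (a + b) by move=> Pa Pb; have := PD 1 a b Pa Pb; rewrite scale1r.
have Pidx : P (kmor k ((1%g : endo x) : mor x x)).
  by have := Pg (inl (inl 1%g)); rewrite /= constt1.
have Pidy : P (kmor k ((1%g : endo y) : mor y y)).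
  by have := Pg (inl (inr 1%g)); rewrite /= constt1.
have Pu : P (kmor k (u : mor x x)).
  have := Padd _ _ (PM _ _ (Pg (inr true)) Pidx) Pidx.
  by rewrite /= /nil_gen mulrBl mul1r subrK mulrDl kmorM mulg1 kmor_mul0 ?addr0.
have Pw : P (kmor k (w : mor y y)).
  have := Padd _ _ (PM _ _ (Pg (inr true)) Pidy) Pidy.
  by rewrite /= /nil_gen mulrBl mul1r subrK mulrDl kmorM mulg1 kmor_mul0 ?add0r // eq_sym.
have PX (z : ob C) (g : endo z) i : P (kmor k ((1%g : endo z) : mor z z)) ->
    P (kmor k (g : mor z z)) -> P (kmor k ((g ^+ i)%g : mor z z)).
  by move=> Pz Pgz; elim: i => [|i IH]; rewrite ?expg0 // expgS -kmorM; apply: PM.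
have Px (g : endo x) : P (kmor k (g : mor x x)).
  rewrite -(consttC p g) -kmorM; apply: PM; last exact: (Pg (inl (inl g))).
  have : (g.`_p)%g \in Op' p [set: endo x] by rewrite mem_Op' // p_elt_constt.
  by rewrite hu => /cycleP[i ->]; apply: PX.
have Py (h : endo y) : P (kmor k (h : mor y y)).
  rewrite -(consttC p h) -kmorM; apply: PM; last exact: (Pg (inl (inr h))).
  have : (h.`_p)%g \in Op' p [set: endo y] by rewrite mem_Op' // p_elt_constt.
  by rewrite hw => /cycleP[i ->]; apply: PX.
have Pm (m : allmor C) : P (kmor k (tagged m)).
  case: m => -[a b] /= m.
  case: (hob a) => ea; case: (hob b) => eb; subst a b => //.
  - have [h mE] := htrans alpha m.
    have := PM _ _ (Py h) (Pg (inr false)); rewrite /= kmor_mul.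
    by rewrite mE.
  - by case: (no_yx hyx m).
move=> a; rewrite (catalg_sum_kmor a).
elim: (index_enum _) => [|m r IH]; first by rewrite big_nil -(addNr 1); apply: Padd; [apply: PN|].
by rewrite big_cons; apply: PD.
Qed.

Definition ord_p' : nat := (#|[set: endo x]|`_p^' * #|[set: endo y]|`_p^')%N.

Lemma ord_p'_neq0 : ord_p'%:R != 0 :> k.
Proof.
case: hp => [[_ p0]|pk].
  by rewrite ((pcharf0P k).1 p0) -lt0n muln_gt0 !part_gt0.
rewrite -(dvdn_pcharf pk) -p'natE ?(pcharf_prime pk) //.
by rewrite pnatM !part_pnat.
Qed.

Lemma constt_ord (gT : finGroupType) (g : gT) : ((g.`_p^') ^+ (#|[set: gT]|`_p^'))%g = 1%g.
Proof.
apply/eqP; rewrite -order_dvdn order_constt partn_dvd ?cardG_gt0 //.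
by rewrite order_dvdG ?inE.
Qed.

Section Rep.
Variables (d : nat) (R : allmor C -> 'M[k]_d) (hR : is_rep R).
Let f (j : endo x + endo y) : 'M[k]_d := rep_alg R (p'part j).
Let nu := rep_alg R nil_gen.
Let e := rep_alg R (kmor k alpha).
Let Rx := f (inl 1%g).
Let Ry := f (inr 1%g).

Lemma p'part_comm i j : p'part i * p'part j = p'part j * p'part i.
Proof.
case: i j => [g|h] [g'|h'] /=.
- by rewrite !kmorM (endoC hGab (g.`_p^')%g).
- by rewrite !kmor_mul0 // eq_sym.
- by rewrite !kmor_mul0 // eq_sym.
- by rewrite !kmorM (endoC hHab (h.`_p^')%g).
Qed.

Lemma rep_p'part_comm i j : f i *m f j = f j *m f i.
Proof. by rewrite /f -!rep_algM // p'part_comm. Qed.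

Lemma rep_algX (a : A) i : rep_alg R a ^+ i.+1 = rep_alg R (a ^+ i.+1).
Proof.
elim: i => [|i IH]; first by rewrite !expr1.
by rewrite exprS IH [in RHS]exprSr rep_algM.
Qed.

Lemma kmorX (z : ob C) (g : endo z) i :
  kmor k (g : mor z z) ^+ i.+1 = kmor k ((g ^+ i.+1)%g : mor z z).
Proof.
elim: i => [|i IH]; first by rewrite expr1 expg1.
by rewrite exprS IH kmorM -expgS.
Qed.

Lemma rep_p'part_pow j : f j ^+ ord_p'.+1 = f j.
Proof.
rewrite /f rep_algX; congr rep_alg; case: j => [g|h] /=; rewrite kmorX expgSr.
  by rewrite /ord_p' expgM constt_ord expg1n mul1g.
by rewrite /ord_p' mulnC expgM constt_ord expg1n mul1g.
Qed.

Lemma rep_idx_add_idy : Rx + Ry = 1%:M.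
Proof.
rewrite -(rep_alg1 hR) one_kmor rep_algD /Rx /Ry /f /=.
by rewrite !constt1.
Qed.

Lemma rep_nil_gen_comm j : nu *m f j = f j *m nu.
Proof.
rewrite /nu /f -!rep_algM //; congr rep_alg.
rewrite /nil_gen mulrBl mulrBr mul1r mulr1 mulrDl mulrDr; case: j => [g|h] /=.
  by rewrite !kmorM (endoC hGab u) !kmor_mul0 // eq_sym.
by rewrite !kmorM (endoC hHab w) !kmor_mul0 // eq_sym.
Qed.

Lemma kmor_alpha_u : kmor k alpha * kmor k (u : mor x x) = kmor k alpha.
Proof. by rewrite kmor_mul trG // hu cycle_id. Qed.

Lemma kmor_w_alpha : kmor k (w : mor y y) * kmor k alpha = kmor k alpha.
Proof. by rewrite kmor_mul trH // hw cycle_id. Qed.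

Lemma rep_nil_gen_alpha : nu *m e = 0.
Proof.
rewrite -rep_algM // /nil_gen mulrBr mulr1 mulrDr kmor_alpha_u kmor_mul0 1?eq_sym //.
by rewrite addr0 subrr rep_alg0.
Qed.

Lemma rep_alpha_nil_gen : e *m nu = 0.
Proof.
rewrite -rep_algM // /nil_gen mulrBl mul1r mulrDl kmor_w_alpha kmor_mul0 1?eq_sym //.
by rewrite add0r subrr rep_alg0.
Qed.

Lemma rep_idx_alpha : Rx *m e = e.
Proof. by rewrite -rep_algM //= constt1 kmor_mul ccomp_idr. Qed.

Lemma rep_alpha_idy : e *m Ry = e.
Proof. by rewrite -rep_algM //= constt1 kmor_mul ccomp_idl. Qed.

Lemma rep_idx_p'part_y h : Rx *m f (inr h) = 0.
Proof. by rewrite -rep_algM //= kmor_mul0 ?rep_alg0. Qed.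

Lemma rep_idy_p'part_x g : Ry *m f (inl g) = 0.
Proof. by rewrite -rep_algM //= kmor_mul0 ?rep_alg0 // eq_sym. Qed.

Lemma rep_p'part_yM h h' : f (inr (h * h')%g) = f (inr h) *m f (inr h').
Proof.
rewrite /f -rep_algM //= kmorM -consttM; last exact: (endoC hHab).
by rewrite (endoC hHab h' h).
Qed.

(** Elements of [p]-power order act trivially, so a relation [h alpha = alpha g]
    passes to the parts of order prime to [p]. *)
Lemma rep_p'part_transport (h : endo y) (g : endo x) :
  ccomp h alpha = ccomp alpha g -> f (inl g) *m e = e *m f (inr h).
Proof.
move=> hg; rewrite -!rep_algM //= !kmor_mul; congr (rep_alg R (kmor k _)).
have -> : ccomp alpha (g.`_p^')%g = ccomp alpha g.
  have gp : (g.`_p)%g \in Op' p [set: endo x] by rewrite mem_Op' // p_elt_constt.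
  by rewrite -{2}(consttC p g) compMr (trG gp).
have -> : ccomp (h.`_p^')%g alpha = ccomp h alpha.
  have gp : (h.`_p)%g \in Op' p [set: endo y] by rewrite mem_Op' // p_elt_constt.
  by rewrite -[in RHS](consttC p h) compMl (trH gp).
by rewrite hg.
Qed.

Lemma rep_nil_gen_nilpotent : iter (#[u]%g * #[w]%g)%N (mulmx nu) 1%:M = 0.
Proof.
rewrite mxiterE.
have [pp|p0] : p \in [pchar k] \/ p = 0%N by case: hp => [[]|]; [right|left].
  have [m Nm] : exists m, (#[u]%g * #[w]%g = p ^ m)%N.
    have uw : p.-nat (#[u]%g * #[w]%g)%N.
      rewrite pnatM; apply/andP; split.
        by rewrite -/(p_elt p u) -mem_Op' // hu cycle_id.
      by rewrite -/(p_elt p w) -mem_Op' // hw cycle_id.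
    by exists (logn p (#[u]%g * #[w]%g)%N); rewrite -p_part part_pnat_id.
  rewrite Nm; pose U := rep_alg R (kmor k (u : mor x x) + kmor k (w : mor y y)).
  have -> : nu = U - 1 by rewrite /nu rep_algD rep_algN rep_alg1.
  apply: (unipotent_nilpotent pp); rewrite -Nm.
  have UX i : (kmor k (u : mor x x) + kmor k (w : mor y y)) ^+ i =
     kmor k ((u ^+ i)%g : mor x x) + kmor k ((w ^+ i)%g : mor y y).
    elim: i => [|i IH]; first by rewrite expr0 one_kmor.
    rewrite exprS IH mulrDl !mulrDr !kmorM -!expgS.
    by rewrite !(kmor_mul0 k) ?addr0 ?add0r // eq_sym.
  have N0 : (0 < #[u]%g * #[w]%g)%N by rewrite muln_gt0 !order_gt0.
  rewrite -(prednK N0) /U rep_algX UX (prednK N0) expgM expg_order expg1n.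
  by rewrite mulnC expgM expg_order expg1n -one_kmor rep_alg1.
have u1 : u = 1%g by apply/set1gP; rewrite -(Op'_card0 hGab p0) hu cycle_id.
have w1 : w = 1%g by apply/set1gP; rewrite -(Op'_card0 hHab p0) hw cycle_id.
rewrite /nu /nil_gen u1 w1 -one_kmor subrr rep_alg0 !order1.
exact: expr1.
Qed.

Hypothesis ind : indecomposable (repmod hR).

Lemma indecomposable_id_neq0 : (1%:M : 'M[k]_d) != 0.
Proof.
case: (ind) => [[v v0] _]; apply: contraNneq v0 => e0; apply/eqP.
by rewrite -[LHS](mulmx1 (v : 'rV_d)) e0 mulmx0.
Qed.

Lemma rep_idx_idem : Rx *m Rx = Rx.
Proof. by rewrite /Rx /f -rep_algM //= kmorM constt1 mulg1. Qed.

(** Groups of order at most three are cyclic. *)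
Lemma stab_generator : (#|[set: endo y] : H1|%g <= 3)%N ->
  exists h0 : endo y, (h0 ^+ #|[set: endo y] : H1|)%g \in H1 /\
    forall h : endo y, exists h1 i, h1 \in H1 /\ h = (h1 * h0 ^+ i)%g.
Proof.
move=> n3.
have norH := norm_stab_right_orbit alpha hHab.
have cQ : #|([set: endo y] / H1)%g| = #|[set: endo y] : H1|%g by rewrite card_quotient.
have cyc : cyclic ([set: endo y] / H1)%g.
  move: n3; rewrite -cQ; have := cardG_gt0 ([set: endo y] / H1)%G.
  case cE : #|_| => [|[|[|[|m]]]] // _ _.
  - have /card1_trivg -> : #|([set: endo y] / H1)%g| = 1%N by [].
    exact: cyclic1.
  - by apply: prime_cyclic; rewrite cE.
  - by apply: prime_cyclic; rewrite cE.
have /cyclicP[q qE] := cyc.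
have [h0 h0N h0E] := cosetP q; exists h0; split=> [|h].
  apply: coset_idr; first by rewrite groupX.
  by rewrite morphX //= -h0E -cQ qE -orderE expg_order.
have : coset H1 h \in <[q]>%g by rewrite -qE mem_quotient ?inE.
case/cycleP => i hi; exists (h * h0 ^- i)%g, i; split; last by rewrite mulgKV.
have hN : h \in 'N(H1)%g by rewrite (subsetP norH) ?inE.
apply: coset_idr; first by rewrite groupM ?groupV ?groupX.
by rewrite morphM ?groupV ?groupX // morphV ?groupX // morphX //= -h0E -hi mulgV.
Qed.

(** If the space at [x] is zero, a single eigenspace at [y] splits off. Otherwise a
    character [chi] occurring at [x] is the center of a star whose legs are the
    characters reached from it by [e]: these agree on [H1], and they are determined
    by their values at a generator of the quotient by [H1], which is a root of a
    polynomial of degree the index of [H1]. *)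
Lemma sufficiency_rep (S : seq k) :
  0 \in S -> 1 \in S -> (forall c : k, c ^+ ord_p'.+1 = c -> c \in S) ->
  (#|[set: endo y] : H1|%g <= 3)%N ->
  [\/ #|[set: endo y] : H1|%g = 1%N,
      (u = 1%g \/ w = 1%g) /\ (#|[set: endo y] : H1|%g <= 2)%N
    | u = 1%g /\ w = 1%g] ->
  exists r R' (hR' : @is_rep k C r R'),
   [/\ (r <= 5 * (#[u]%g * #[w]%g))%N, lmod_iso (repmod hR) (repmod hR')
     & forall j i i', rep_alg R' (algebra_gens j) i i' \in S].
Proof.
move=> S0 S1 SX n3 cond.
have [s [E [us sE Es EE fE]]] := joint_projectors ord_p'_neq0 rep_p'part_comm rep_p'part_pow.
have scI (t : {ffun endo x + endo y -> k}) (a b : k) : t \in s -> a *: E t = b *: E t -> a = b.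
  rewrite -Es => tE /eqP; rewrite -subr_eq0 -scalerBl scaler_eq0 (negPf tE) orbF.
  by rewrite subr_eq0 => /eqP.
have tX t j : t \in s -> t j ^+ ord_p'.+1 = t j.
  move=> ts; apply: (scI _ _ _ ts).
  have fX i : f j ^+ i *m E t = t j ^+ i *: E t.
    elim: i => [|i IH]; first by rewrite !expr0 scale1r; exact: mul1mx.
    by rewrite !exprS -mulmxA IH -scalemxAr (fE _ _).1 scalerA mulrC.
  by rewrite -fX rep_p'part_pow (fE _ _).1.
have tS t j : t \in s -> t j \in S by move=> ts; apply/SX/tX.
have nuE t : nu *m E t = E t *m nu := joint_projector_comm us sE Es fE rep_nil_gen_comm t.
have xtype t : t \in s -> t (inl 1%g) != 0 ->
    [/\ Rx *m E t = E t, E t *m Rx = E t & forall h, t (inr h) = 0].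
  move=> ts t1; have t11 : t (inl 1%g) = 1.
    apply: (mulfI t1); rewrite mulr1; apply: (scI _ _ _ ts).
    by rewrite -(fE _ _).1 -/Rx -{1}rep_idx_idem -mulmxA (fE _ _).1 -scalemxAr (fE _ _).1 scalerA.
  have RE : Rx *m E t = E t by rewrite (fE _ _).1 t11 scale1r.
  have ER : E t *m Rx = E t by rewrite (fE _ _).2 t11 scale1r.
  split=> // h; apply: (scI _ _ _ ts).
  by rewrite -(fE _ _).2 -ER -mulmxA rep_idx_p'part_y mulmx0 scale0r.
have ytype t : t \in s -> t (inl 1%g) = 0 ->
    [/\ Rx *m E t = 0, E t *m Rx = 0, t (inr 1%g) = 1 & forall g, t (inl g) = 0].
  move=> ts t1; have RE : Rx *m E t = 0 by rewrite (fE _ _).1 t1 scale0r.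
  have ER : E t *m Rx = 0 by rewrite (fE _ _).2 t1 scale0r.
  have ERy : E t *m Ry = E t by rewrite -[RHS]mulmx1 -rep_idx_add_idy mulmxDr ER add0r.
  split=> //; first by apply: (scI _ _ _ ts); rewrite -(fE _ _).2 -/Ry ERy scale1r.
  move=> g; apply: (scI _ _ _ ts).
  by rewrite -(fE _ _).2 -ERy -mulmxA rep_idy_p'part_x mulmx0 scale0r.
pose t0 : {ffun endo x + endo y -> k} := [ffun=> 0].
pose Ec ps (c : 'I_3) := if (c < size ps)%N then E (nth t0 ps c) else 0.
have EcP (P : 'M[k]_d -> Prop) ps (c : 'I_3) : P 0 ->
    (forall psi, psi \in ps -> P (E psi)) -> P (Ec ps c).
  by move=> P0 Pp; rewrite /Ec; case: ltnP => // h; apply/Pp/mem_nth.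
have finish E0 (t : {ffun endo x + endo y -> k}) ps :
    (forall j, t j \in S) ->
    (forall j, E0 *m f j = t j *: E0 /\ f j *m E0 = t j *: E0) ->
    {subset ps <= s} -> uniq ps -> (size ps <= 3)%N ->
    E0 *m E0 = E0 -> nu *m E0 = E0 *m nu -> e *m E0 = 0 ->
    E0 *m e = \sum_(psi <- ps) E0 *m e *m E psi ->
    (forall psi, psi \in ps -> [/\ E0 *m E psi = 0, E psi *m E0 = 0,
       e *m E psi = E0 *m e *m E psi & E psi *m e = 0]) ->
    (star_data (#[u]%g * #[w]%g) nu e E0 (Ec ps) ->
     exists l z g M, chain_system nu e E0 (Ec ps) l z g M) ->
    exists r R' (hR' : @is_rep k C r R'),
     [/\ (r <= 5 * (#[u]%g * #[w]%g))%N, lmod_iso (repmod hR) (repmod hR')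
       & forall j i i', rep_alg R' (algebra_gens j) i i' \in S].
  move=> tS0 tE pss ups ps3 E00 nuE0 eE0 E0e psE chains.
  have sd : star_data (#[u]%g * #[w]%g) nu e E0 (Ec ps).
    split=> //.
    - move=> c c'; case: eqVneq => [<-|cc'].
        by apply: (EcP (fun X => X *m X = X)) => [|psi _]; rewrite ?mul0mx // EE eqxx.
      rewrite /Ec; case: ltnP => h; last by rewrite mul0mx.
      case: ltnP => h'; last by rewrite mulmx0.
      by rewrite EE nth_uniq // (inj_eq val_inj) (negPf cc').
    - by move=> c; apply: (EcP (fun X => E0 *m X = 0)) => [|psi /psE[]]; rewrite ?mulmx0.
    - by move=> c; apply: (EcP (fun X => X *m E0 = 0)) => [|psi /psE[]]; rewrite ?mul0mx.
    - by move=> c; apply: (EcP (fun X => nu *m X = X *m nu)) => [|psi _]; rewrite ?mulmx0 ?mul0mx ?nuE.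
    - exact: rep_nil_gen_nilpotent.
    - exact: rep_nil_gen_alpha.
    - exact: rep_alpha_nil_gen.
    - rewrite [LHS]E0e (big_nth t0) big_mkord.
      rewrite (big_ord_widen _ (fun c => E0 *m e *m E (nth t0 ps c)) ps3).
      rewrite big_mkcond; apply: eq_bigr => c _; rewrite /Ec; case: ifP => // _.
      by rewrite mulmx0.
    - by move=> c; apply: (EcP (fun X => e *m X = E0 *m e *m X)) => [|psi /psE[]]; rewrite ?mulmx0.
    - by move=> c; apply: (EcP (fun X => X *m e = 0)) => [|psi /psE[]]; rewrite ?mul0mx.
  have [l [z [g [M cs]]]] := chains sd.
  pose lam (i : 'I_2 + 'I_3) j := if i is inr c then
    if (c < size ps)%N then (nth t0 ps c) j else 0 else t j.
  apply: (bounded_basis sd ind algebra_gens_generate erefl erefl (lam := lam) _ S0 S1 _ cs).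
  - move=> [q|c] j /=; first exact: tE.
    rewrite /Ec; case: ifP => _; first by have [-> ->] := fE (nth t0 ps c) j.
    by rewrite mul0mx mulmx0 scaler0.
  - move=> [q|c] j /=; first exact: tS0.
    by case: ltnP => // h; apply/tS/pss/mem_nth.
have [[chi [chis chi1]]|nox] := classic (exists t, t \in s /\ t (inl 1%g) != 0); last first.
  have y1 t : t \in s -> t (inl 1%g) = 0.
    by move=> ts; apply/eqP/negPn/negP => t1; apply: nox; exists t.
  have Rx0 : Rx = 0.
    rewrite -[Rx]mulmx1 -sE mulmx_sumr big_seq big1 // => t ts.
    by have [] := ytype t ts (y1 t ts).
  have e0 : e = 0 by rewrite -rep_idx_alpha -/Rx Rx0 mul0mx.
  have [psi psis] : exists t, t \in s.
    case: (s) sE => [|t s'] sE'; last by exists t; rewrite mem_head.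
    by have := indecomposable_id_neq0; rewrite -sE' big_nil eqxx.
  apply: (finish 0 t0 [:: psi]) => //; rewrite ?mulmx0 ?mul0mx //.
  - by move=> j; rewrite ffunE.
  - by move=> j; rewrite mul0mx mulmx0 scaler0.
  - by move=> t; rewrite inE => /eqP ->.
  - by rewrite big1 // => t _; rewrite mul0mx.
  - by move=> t _; rewrite e0 !mulmx0 !mul0mx.
  - by move=> sd; apply: (chains_no_center sd); rewrite // /Ec Es.
have [RE ER chiy] := xtype chi chis chi1.
(* Eigenvalues on the two sides of a nonzero block of [e] agree on every pair
   [(h, g)] compatible with [alpha]. *)
have compat t psi h g : ccomp h alpha = ccomp alpha g -> E t *m e *m E psi != 0 ->
    psi (inr h) = t (inl g).
  move=> hg n0; apply/eqP; rewrite -subr_eq0.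
  have : psi (inr h) *: (E t *m e *m E psi) = t (inl g) *: (E t *m e *m E psi).
    rewrite !scalemxAl -(fE t (inl g)).2 -(mulmxA _ (f (inl g))) (rep_p'part_transport hg).
    by rewrite -!scalemxAl scalemxAr -(fE psi (inr h)).1 !mulmxA.
  by move/eqP; rewrite -subr_eq0 -scalerBl scaler_eq0 (negPf n0) orbF.
have psi_s t psi : E t *m e *m E psi != 0 ->
    [/\ t \in s, psi \in s, t (inl 1%g) != 0 & psi (inl 1%g) = 0].
  move=> n0; have ts : t \in s by rewrite -Es; apply: contraNneq n0 => ->; rewrite !mul0mx.
  have ps : psi \in s by rewrite -Es; apply: contraNneq n0 => ->; rewrite mulmx0.
  split=> //.
    apply: contraNneq n0 => /(ytype t ts)[_ ERt _ _].
    by rewrite -rep_idx_alpha -/Rx mulmxA ERt !mul0mx.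
  apply/eqP; apply: contraNT n0 => /(xtype psi ps)[RE' _ _].
  by rewrite -rep_alpha_idy -/Ry -RE' -!mulmxA (mulmxA Ry) rep_idy_p'part_x mul0mx !mulmx0.
(* By transitivity every [g] occurs in such a pair, so that a character at [y] is
   reached from one character at [x] only. *)
have chi_uniq t psi : E chi *m e *m E psi != 0 -> E t *m e *m E psi != 0 -> t = chi.
  move=> n0 n0'; apply/ffunP => -[g|h].
    have [h hg] := htrans alpha (ccomp alpha g).
    by rewrite -(compat t psi h g) ?(compat chi psi h g) //; rewrite hg.
  have [ts _ t1 _] := psi_s t psi n0'; have [_ _ ->] := xtype t ts t1.
  by rewrite chiy.
pose ps := [seq psi <- s | E chi *m e *m E psi != 0].
have ups : uniq ps by apply: filter_uniq.
have psP psi : psi \in ps -> E chi *m e *m E psi != 0 by rewrite mem_filter => /andP[].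
have [h0 [h0n h0P]] := stab_generator n3.
have size_ps : (size ps <= #|[set: endo y] : H1|%g)%N.
  have psiM psi a b : psi \in s -> psi (inr (a * b)%g) = psi (inr a) * psi (inr b).
    move=> pss; apply: (scI _ _ _ pss).
    by rewrite -(fE _ _).1 rep_p'part_yM -mulmxA (fE _ _).1 -scalemxAr (fE _ _).1 scalerA mulrC.
  have psiX psi a i : psi \in ps -> psi (inr (a ^+ i)%g) = psi (inr a) ^+ i.
    move=> /psP/psi_s[_ pss _ p1]; have [_ _ p11 _] := ytype psi pss p1.
    by elim: i => [|i IH]; rewrite ?expg0 ?expr0 // expgS psiM // IH exprS.
  have [g0 g0E] := stab_transporter h0n.
  pose c := chi (inl g0); pose q : {poly k} := 'X^#|[set: endo y] : H1|%g - c%:P.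
  have n0 : (0 < #|[set: endo y] : H1|%g)%N by rewrite indexg_gt0.
  have sq : size q = #|[set: endo y] : H1|%g.+1 by rewrite size_XnsubC.
  have q0 : q != 0 by rewrite -size_poly_eq0 sq.
  rewrite -ltnS -sq -(size_map (fun psi : {ffun _} => psi (inr h0))).
  apply: max_poly_roots => //.
    apply/allP => _ /mapP[psi pps ->]; rewrite /root hornerD hornerN hornerC hornerXn.
    by rewrite -psiX // (compat chi psi _ _ g0E (psP _ pps)) subrr.
  rewrite map_inj_in_uniq // => psi psi' pps pps' e0; apply/ffunP => -[g|h].
    have [_ pss _ p1] := psi_s _ _ (psP _ pps); have [_ _ _ ->] := ytype psi pss p1.
    by have [_ pss' _ p1'] := psi_s _ _ (psP _ pps'); have [_ _ _ ->] := ytype psi' pss' p1'.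
  have [h1 [i [/stab_transporter[g1 g1E] ->]]] := h0P h.
  have [_ pss _ _] := psi_s _ _ (psP _ pps); have [_ pss' _ _] := psi_s _ _ (psP _ pps').
  rewrite !psiM // !psiX // e0 (compat chi psi _ _ g1E (psP _ pps)).
  by rewrite (compat chi psi' _ _ g1E (psP _ pps')).
have ps3 : (size ps <= 3)%N by apply: leq_trans size_ps n3.
have nu_x : u = 1%g -> E chi *m nu = 0.
  move=> u1; rewrite -ER -mulmxA (_ : Rx *m nu = 0) ?mulmx0 //.
  rewrite /Rx /f /nu -rep_algM // /nil_gen u1 mulrBl mul1r mulrDl /= constt1 kmorM mulg1.
  by rewrite kmor_mul0 ?addr0 ?subrr ?rep_alg0.
have nu_y : w = 1%g -> forall c, Ec ps c *m nu = 0.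
  move=> w1 c; apply: (EcP (fun X => X *m nu = 0)) => [|psi pps]; first by rewrite mul0mx.
  have [_ pss _ p1] := psi_s _ _ (psP _ pps); have [_ ER' _ _] := ytype psi pss p1.
  have ERy : E psi *m Ry = E psi by rewrite -[RHS]mulmx1 -rep_idx_add_idy mulmxDr ER' add0r.
  rewrite -ERy -mulmxA (_ : Ry *m nu = 0) ?mulmx0 //.
  rewrite /Ry /f /nu -rep_algM // /nil_gen w1 mulrBl mul1r mulrDl /= constt1 kmorM mulg1.
  by rewrite kmor_mul0 ?add0r ?subrr ?rep_alg0 // eq_sym.
have E0n : E chi != 0 by rewrite Es.
apply: (finish (E chi) chi ps) => //.
- by move=> j; apply: tS.
- by move=> j; have [-> ->] := fE chi j.
- by move=> psi; rewrite mem_filter => /andP[].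
- by rewrite EE eqxx.
- by rewrite -RE mulmxA -rep_alpha_idy -(mulmxA e) -/Ry /Ry rep_idy_p'part_x mulmx0 mul0mx.
- rewrite -[LHS]mulmx1 -sE mulmx_sumr big_filter [RHS]big_mkcond /=.
  by apply: eq_bigr => psi _; case: eqP.
- move=> psi pps; have [_ pss _ p1] := psi_s _ _ (psP _ pps).
  have [_ ER' _ _] := ytype psi pss p1.
  have pc : (chi == psi) = false by apply: contraNF chi1 => /eqP ->; apply/eqP.
  split; rewrite ?EE ?(eq_sym psi) ?pc //.
    rewrite -[e in LHS]mul1mx -sE !mulmx_suml (bigD1_seq chi) //= big1 ?addr0 // => t tchi.
    apply/eqP/negPn/negP => n0; case/eqP: tchi.
    exact: chi_uniq (psP _ pps) n0.
  by rewrite -rep_idx_alpha -/Rx mulmxA ER' mul0mx.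
move=> sd; case: cond => [n1|[uw n2]|[u1 w1]].
- apply: (chains_one_leg sd) => // c c0; rewrite /Ec ltnNge (leq_trans size_ps) // n1.
  by rewrite lt0n; apply: contraNneq c0 => c0; apply/eqP/val_inj.
- have Ec2 : Ec ps ord_max = 0 by rewrite /Ec ltnNge (leq_trans size_ps).
  case: uw => [u1|w1].
    by apply: (chains_two_legs sd) => //; apply: nu_x.
  by apply: (chains_left_and_two_legs sd) => //; apply: nu_y.
- by apply: (chains_three_legs sd) => //; [apply: nu_y|apply: nu_x].
Qed.

End Rep.
End Sufficiency.

(** * The classification *)
Local Close Scope ring_scope.

Lemma Op'_cyclic (p : nat) (gT : finGroupType) : abelian [set: gT] ->
  cyclic_Sylows p [set: gT] -> exists u : gT, Op' p [set: gT] = <[u]>%g.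
Proof.
move=> ab cyc; have [P sP] := Sylow_exists p [set: gT].
by have /cyclicP[u Pu] := cyc P sP; exists u; rewrite (Op'_abelian ab sP).
Qed.

(** All eigenvalues of the elements of order prime to [p] lie in one finite set. *)
Lemma fixed_powers_finite (k : closedFieldType) (N : nat) :
  exists S : seq k, forall c : k, (c ^+ N.+2 = c -> c \in S)%R.
Proof.
pose q : {poly k} := ('X^(N.+2) - 'X)%R.
have [r qr] := closed_field_poly_normal q.
have sq : size q = N.+3 by rewrite size_polyDl ?size_polyXn // size_polyN size_polyX.
have q0 : q != 0%R by rewrite -size_poly_eq0 sq.
exists r => c cN; have : root q c by rewrite /root hornerD hornerN hornerXn hornerX cN subrr.
by rewrite qr rootZ ?lead_coef_eq0 // root_prod_XsubC.
Qed.

Theorem theorem1p4 (k : closedFieldType) (p : nat) (hp : has_char p k)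
  (C : finEICat) (hconn : connected_cat C) (hskel : skeletal C)
  (x y : ob C) (hxy : x != y) (hob : forall z : ob C, z = x \/ z = y)
  (hyx : #|mor y x| = 0)
  (horbit : forall a b : mor x y, exists (h : endo y) (g : endo x),
     b = ccomp (ccomp h a) g)
  (alpha : mor x y)
  (hG : cyclic_Sylows p [set: endo x]) (hH : cyclic_Sylows p [set: endo y])
  (hp2 : p <> 2) (hp3 : p <> 3)
  (htrans : forall a b : mor x y, exists h : endo y, b = ccomp h a)
  (hGab : abelian [set: endo x]) (hHab : abelian [set: endo y]) :
  let H1 := stab_right_orbit alpha in
  let s := #|Op' p [set: endo x]| in
  let t := #|Op' p [set: endo y]| in
  let n := #|[set: endo y] : H1|%g in
  finite_rep_type (catalg k C) <->
  [/\ acts_trivially_right y (Op' p [set: endo x]),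
      acts_trivially_left x (Op' p [set: endo y])
    & [\/ [/\ p <= s, p <= t & n = 1],
          ((s = 1 /\ p <= t) \/ (t = 1 /\ p <= s)) /\ n <= 2
        | [/\ s = 1, t = 1 & n <= 3]]].
Proof.
move=> H1 s t n; split=> [fin|[trG trH cond]].
  exact: (@necessity k p C x y hp hxy hob hyx alpha hG hH hp2 hp3 htrans hGab hHab fin).
have [u hu] := Op'_cyclic hGab hG; have [w hw] := Op'_cyclic hHab hH.
have one_of (z : ob C) (g : endo z) : #|Op' p [set: endo z]| = 1 ->
    Op' p [set: endo z] = <[g]>%g -> g = 1%g.
  by move=> + e; rewrite e -orderE => /eqP; rewrite order_eq1 => /eqP.
have u1 e : u = 1%g := one_of x u e hu.
have w1 e : w = 1%g := one_of y w e hw.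
have n3 : n <= 3.
  by case: cond => [[_ _ ->]|[_ n2]|[_ _ n3]] //; apply: leq_trans n2 _.
have cases : [\/ n = 1, (u = 1%g \/ w = 1%g) /\ n <= 2 | u = 1%g /\ w = 1%g].
  case: cond => [[_ _ n1]|[[[s1 _]|[t1 _]] n2]|[s1 t1 _]].
  - by constructor 1.
  - by constructor 2; split=> //; left; apply: u1.
  - by constructor 2; split=> //; right; apply: w1.
  - by constructor 3; split; [apply: u1|apply: w1].
have [N NE] : exists N, ord_p' p x y = N.+1.
  by exists (ord_p' p x y).-1; rewrite prednK // muln_gt0 !part_gt0.
have [S SP] := fixed_powers_finite k N.
apply: (@finite_rep_type_criterion k C _ (algebra_gens k p alpha u w) (0%R :: 1%R :: S)
  (5 * (#[u]%g * #[w]%g))).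
  exact: algebra_gens_generate hu hw.
move=> d R hR ind.
have S0 : (0%R \in 0%R :: 1%R :: S) by rewrite inE eqxx.
have S1 : (1%R \in 0%R :: 1%R :: S) by rewrite !inE eqxx orbT.
have SX (c : k) : (c ^+ (ord_p' p x y).+1 = c -> c \in 0%R :: 1%R :: S)%R.
  by rewrite NE !inE => /SP->; rewrite !orbT.
have [r [R' [hR' [rD iso eS]]]] := sufficiency_rep hp hxy hob hyx htrans hGab hHab
  trG trH hu hw ind S0 S1 SX n3 cases.
by exists r, R', hR'.
Qed.
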